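(* Let $H:\mathbb{T}^d\times\mathbb{R}^d\to\mathbb{R}$ be a Tonelli Hamiltonian with associated Lagrangian $L$, and let $\mathcal{L}_\tau$ and $\mathcal{E}_\tau$ be the discrete action and the minimal action associated with $L$. Consider the two equations $$\text{(E1)}\qquad u_\tau(y)+\bar{\mathcal{L}}_\tau=\min_{x\in\mathbb{R}^d}\big\{u_\tau(x)+\mathcal{L}_\tau(x,y)\big\},\quad\forall y\in\mathbb{R}^d,\ \forall\tau>0,$$ $$\text{(E2)}\qquad u(y)-\tau\bar H=\min_{x\in\mathbb{R}^d}\big\{u(x)+\mathcal{E}_\tau(x,y)\big\},\quad\forall y\in\mathbb{R}^d,\ \forall\tau>0,$$ where $u_\tau$ and $u$ are continuous $\mathbb{Z}^d$-periodic functions on $\mathbb{R}^d$ ($u_\tau$ may depend on $\tau$, while $u$ does not), and $\bar{\mathcal{L}}_\tau,\bar H\in\mathbb{R}$. Then: (i) For every $\tau>0$ there is a unique $\bar{\mathcal{L}}_\tau\in\mathbb{R}$ such that (E1) admits a solution $u_\tau$. Moreover $$\bar{\mathcal{L}}_\tau=\lim_{k\to+\infty}\ \inf_{z_0,\ldots,z_k\in\mathbb{R}^d}\ \frac1k\sum_{i=0}^{k-1}\mathcal{L}_\tau(z_i,z_{i+1}).$$ (ii) There is a unique $\bar H\in\mathbb{R}$ such that (E2) admits a solution $u$. Moreover $$-\bar H=\lim_{\tau\to+\infty}\frac1\tau\min_{x,y\in\mathbb{R}^d}\mathcal{E}_\tau(x,y).$$ (iii) There exists a constant $C>0$ such that $$\Big|\frac{\bar{\mathcal{L}}_\tau}{\tau}+\bar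 H\Big|\le C\tau,\qquad\forall\tau\in(0,1].$$ (iv) There exist constants $C,R>0$ such that, for every $\tau\in(0,1]$ and for every solution $v=u_\tau$ of (E1), or $v=u$ of (E2): (a) $\mathrm{Lip}(v)\le C$; in particular $\|v\|_\infty\le C$ if $\min(v)=0$; (b) for every $y\in\mathbb{R}^d$, if $x\in\arg\min_{x\in\mathbb{R}^d}\{v(x)+E_\tau(x,y)\}$ then $\|y-x\|\le\tau R$, where $E_\tau=\mathcal{L}_\tau$ when $v=u_\tau$ is a solution of (E1), and $E_\tau=\mathcal{E}_\tau$ when $v=u$ is a solution of (E2). (v) There exist a sequence $\tau_i\to0$ (with $\tau_i>0$) and solutions $u_{\tau_i}$ of (E1) (with $\tau=\tau_i$) such that $u_{\tau_i}\to u$ uniformly for some function $u$. Moreover every such limit $u$ is a solution of (E2).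
   Context: $\mathbb{T}^d=\mathbb{R}^d/\mathbb{Z}^d$; functions on $\mathbb{T}^d$ are identified with $\mathbb{Z}^d$-periodic functions on $\mathbb{R}^d$, and ''periodic'' means $\mathbb{Z}^d$-periodic. $\|\cdot\|$ is the sup norm on $\mathbb{R}^d$; $\mathrm{Lip}(v)$ is the best Lipschitz constant of $v$. Tonelli Hamiltonian: a time-independent $C^2$ function $H(x,p):\mathbb{T}^d\times\mathbb{R}^d\to\mathbb{R}$ (periodic in $x$) such that (L1) for every $R>0$, $\frac{\partial^2H}{\partial p^2}(x,p)$ is positive definite as a quadratic form, uniformly in $x\in\mathbb{T}^d$ and $\|p\|\le R$; (L2) $\lim_{\|p\|\to+\infty}\inf_{x\in\mathbb{T}^d}H(x,p)/\|p\|=+\infty$. Lagrangian: the Legendre–Fenchel transform $L(x,v)=\sup_{p\in\mathbb{R}^d}\{p\cdot v-H(x,p)\}$, seen as a function on $\mathbb{R}^d\times\mathbb{R}^d$ which is periodic in $x$. Discrete action: $\mathcal{L}_\tau(x,y):=\tau L\big(x,\frac{y-x}{\tau}\big)$ for $\tau>0$, $x,y\in\mathbb{R}^d$. Minimal action: $\mathcal{E}_\tau(x,y):=\inf\int_0^\tau L(\gamma(t),\dot\gamma(t))\,dt$ for $\tau>0$, $x,y\in\mathbb{R}^d$, the infimum being over absolutely continuous curves $\gamma:[0,\tau]\to\mathbb{R}^d$ with $\gamma(0)=x$, $\gamma(\tau)=y$. *)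

(* Defs.v *)
From HB Require Import structures.
From mathcomp Require Export all_boot all_order all_algebra.
From mathcomp Require Export all_classical all_reals all_analysis.

Set Implicit Arguments.
Unset Strict Implicit.
Unset Printing Implicit Defensive.

Export Order.TTheory GRing.Theory Num.Theory.
Export numFieldNormedType.Exports.

Local Open Scope classical_set_scope.
Local Open Scope ring_scope.

(* R^d is 'rV[R]_d, whose library norm is the sup norm; functions on the torus
   are Z^d-periodic functions on 'rV[R]_d. *)

Section Defs.
Context {R : realType} {d : nat}.
Local Notation V := 'rV[R]_d.

Definition periodic (T : Type) (f : V -> T) : Prop :=
  forall (x : V) (k : 'rV[int]_d), f (x + map_mx intr k) = f x.

(* The derivatives are taken along all directions; once they are continuous this
   is the same as asking for continuous partial derivatives. *)
Fixpoint Ck (n : nat) (W : normedModType R) (f : W -> R) : Prop :=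
  continuous f /\
  if n is m.+1 then
    forall w : W, (forall z, derivable f z w) /\ Ck m ('D_w f)
  else True.

Definition dot (p v : V) : R := \sum_(i < d) p ord0 i * v ord0 i.

Definition hessian (f : V -> R) (p : V) : 'M[R]_d :=
  \matrix_(i < d, j < d)
    'D_(delta_mx ord0 i) ('D_(delta_mx ord0 j : V) f) p.

Definition quad_form (A : 'M[R]_d) (w : V) : R := dot (w *m A) w.

(* The last clause is the limit +oo, as |p| --> +oo, of the infimum. *)
Record tonelli (H : V -> V -> R) : Prop := Tonelli {
  tonelli_periodic : forall p, periodic (H^~ p) ;
  tonelli_C2 : Ck 2 (fun z : (V * V)%type => H z.1 z.2) ;
  tonelli_convex : forall r : R, 0 < r -> exists2 a : R, 0 < a &
    forall x p, `|p| <= r ->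
      forall w, a * `|w| ^+ 2 <= quad_form (hessian (H x) p) w ;
  tonelli_superlinear : forall M : R, exists K : R, forall p : V, K <= `|p| ->
    M <= inf (range (fun x : V => H x p / `|p|)) }.

(* Real supremum: the set is bounded above as soon as H is Tonelli. *)
Definition lagrangian (H : V -> V -> R) (x v : V) : R :=
  sup (range (fun p : V => dot p v - H x p)).

Definition discrete_action (L : V -> V -> R) (tau : R) (x y : V) : R :=
  tau * L x (tau^-1 *: (y - x)).

Definition abs_continuous (a b : R) (g : R -> V) : Prop :=
  forall e : R, 0 < e -> exists2 delta : R, 0 < delta &
    forall (n : nat) (s t : 'I_n -> R),
      (forall i, a <= s i /\ s i <= t i /\ t i <= b) ->
      trivIset setT (fun i => `]s i, t i[%classic) ->
      \sum_(i < n) (t i - s i) < delta ->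
      \sum_(i < n) `|g (t i) - g (s i)| < e.

(* Curves on [0, tau] are restrictions of total functions g; the values of g
   outside [0, tau] only affect the integrand at 0 and tau. When L is bounded
   below the integral is well defined in ]-oo, +oo]. *)
Definition action (L : V -> V -> R) (tau : R) (g : R -> V) : \bar R :=
  \int[lebesgue_measure]_(t in `[0, tau]) (L (g t) (derive1 g t))%:E.

(* [fine] only forgets that the infimum is computed in \bar R: for the
   Lagrangian of a Tonelli Hamiltonian and tau > 0 it is finite. *)
Definition minimal_action (L : V -> V -> R) (tau : R) (x y : V) : R :=
  fine (ereal_inf [set action L tau g | g in
    [set g : R -> V | [/\ abs_continuous 0 tau g, g 0 = x & g tau = y]]]).

Definition is_min (A : set R) (m : R) : Prop := A m /\ lbound A m.

Definition argmin (T : Type) (f : T -> R) : set T :=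
  [set x | forall x', f x <= f x'].

Definition sol_discrete (L : V -> V -> R) (tau c : R) (u : V -> R) : Prop :=
  [/\ continuous u, periodic u &
      forall y, is_min (range (fun x => u x + discrete_action L tau x y))
                       (u y + c)].

Definition sol_continuous (L : V -> V -> R) (h : R) (u : V -> R) : Prop :=
  [/\ continuous u, periodic u &
      forall (y : V) (tau : R), 0 < tau ->
        is_min (range (fun x => u x + minimal_action L tau x y))
               (u y - tau * h)].

(* Only z 0, ..., z k matter. *)
Definition mean_discrete_action (L : V -> V -> R) (tau : R) (k : nat)
    (z : nat -> V) : R :=
  k%:R^-1 * \sum_(0 <= i < k) discrete_action L tau (z i) (z i.+1).

Definition Lip (v : V -> R) : \bar R :=
  ereal_inf [set k%:E | k in [set k : R | 0 <= k /\ k.-lipschitz v]].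

Definition norm_infty (v : V -> R) : \bar R :=
  ereal_sup (range (fun x => `|v x|%:E)).

Definition cvg_discrete_sols (L : V -> V -> R) (Lbar : R -> R)
    (tau : nat -> R) (us : nat -> V -> R) (u : V -> R) : Prop :=
  [/\ forall i, 0 < tau i,
      tau @ \oo --> (0 : R),
      forall i, sol_discrete L (tau i) (Lbar (tau i)) (us i) &
      {uniform, us @ \oo --> u}].

End Defs.

(* Main.v *)
(* The Lagrangian is handled only through Fenchel's inequality and the attainment of
   the supremum at bounded momenta, so that it is periodic, superlinear and locally
   bounded and Lipschitz.

   For (E1), the iterates from 0 of the discrete Lax-Oleinik operator have uniformly
   bounded oscillation, so their values at a point are additive up to a constant and
   grow like n times some real c; the lower limit of the iterates minus n c is a
   solution. Comparing the velocity of minimisers with superlinearity gives Lipschitz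
   and speed bounds that are uniform in tau.

   (E2) is obtained from (E1) by letting tau tend to 0 along an ultrafilter: if the
   steps delta_i tend to 0, the iterates over a time tau of functions u_i converging
   to u converge to y |-> min_x (u x + E_tau (x, y)). For the upper bound, an absolutely
   continuous curve is sampled and each step is compared with the discrete action; for
   the attainment, minimising chains converge to a Lipschitz curve, and lower
   semicontinuity of the action along them follows by testing constant momenta on
   small blocks of the chain. The same principle applied to u_i = 0 shows that the
   minimum of E_tau over (x, y) is attained. *)

From HB Require Import structures.
Require Import Defs.
From mathcomp Require Import measurable_realfun simple_functions.
From mathcomp Require Import ring lra.

Set Implicit Arguments.
Unset Strict Implicit.
Unset Printing Implicit Defensive.

Local Open Scope classical_set_scope.
Local Open Scope ring_scope.

(** Three obstacles shape the proof. The action is defined with [derive1] on curves that are only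
    absolutely continuous. The link between such a curve and its derivative is established first:
    total variation, Stieltjes measures and Radon-Nikodym give densities, and Lebesgue
    differentiation identifies them with the velocity. Lower bounds on the action then use only
    additivity in time and Fenchel's inequality for constant momenta ([partial_action_of]). The
    estimates for a single step degenerate as tau tends to 0: points of the unit cell are joined at
    velocity 1 / tau. They serve only at fixed tau. Uniform estimates join points by many steps of
    velocity at most 1, hence hold at scales above tau; below tau, a minimiser at one point is
    reused at the other. In (E2) the same u must work at every time. All times are treated at once,
    by reading the same chains at the index floor (t / delta). At bounded speed the two actions
    differ by O(tau^2). This gives (iii), which in turn identifies the limit of Lbar / tau for the
    arbitrary sequences of (v). *)

Lemma lipschitz_continuous (R : realType) (W : normedModType R) (f : W -> R)
    (C : R) : (forall x y, `|f x - f y| <= C * `|x - y|) -> continuous f.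
Proof.
move=> fC x; apply/cvgrPdist_le => /= e e0.
have C0 : 0 < `|C| + 1 by rewrite ltr_wpDl.
near=> y; rewrite (le_trans (fC _ _))//.
rewrite (le_trans (ler_wpM2r _ (_ : C <= `|C| + 1)))//.
  by rewrite (le_trans (ler_norm _))// lerDl.
rewrite -ler_pdivlMl//; near: y.
by apply: cvgr_dist_le; [exact: cvg_id|rewrite mulr_gt0 ?invr_gt0].
Unshelve. all: by end_near. Qed.

(** * Hamiltonian and Lagrangian *)

Section Vectors.
Context {R : realType} {d : nat}.
Local Notation V := 'rV[R]_d.
Implicit Types (x y v p : V).

Lemma ler_coord x i : `|x ord0 i| <= `|x|.
Proof.
rewrite [leRHS]/Num.Def.normr/= mx_normrE.
exact: (le_bigmax _ (fun ij : 'I_1 * 'I_d => `|x ij.1 ij.2|) (ord0, i)).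
Qed.

Lemma ler_rV_norm x (r : R) :
  0 <= r -> (forall i, `|x ord0 i| <= r) -> `|x| <= r.
Proof.
move=> r0 xr; rewrite [leLHS]/Num.Def.normr/= mx_normrE.
by apply: bigmax_le => //= -[i j] _ /=; rewrite ord1.
Qed.

Lemma dotBr p v w : dot p (v - w) = dot p v - dot p w.
Proof.
rewrite /dot -sumrB; apply: eq_bigr => i _.
by rewrite !mxE mulrBr.
Qed.

Lemma dotZr p (a : R) v : dot p (a *: v) = a * dot p v.
Proof. by rewrite /dot mulr_sumr; apply: eq_bigr => i _; rewrite mxE mulrCA. Qed.

Lemma dotC p v : dot p v = dot v p.
Proof. by apply: eq_bigr => i _; rewrite mulrC. Qed.

Lemma dot0l v : dot 0 v = 0.
Proof. by rewrite /dot big1 // => i _; rewrite mxE mul0r. Qed.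

Lemma ler_dot p v : `|dot p v| <= d%:R * `|p| * `|v|.
Proof.
rewrite /dot (le_trans (ler_norm_sum _ _ _))//.
rewrite (le_trans (ler_sum _ (G := fun=> `|p| * `|v|) _))//.
  by move=> i _; rewrite normrM ler_pM ?ler_coord.
by rewrite sumr_const card_ord -mulrA mulr_natl.
Qed.

(** For nonzero [v] the momentum is supported on one coordinate where [v] attains its sup norm.
    Tested in Fenchel's inequality, it turns bounds on H into growth of L and of the action. *)
Lemma dot_norming (K : R) v :
  0 <= K -> exists2 p, `|p| <= K & dot p v = K * `|v|.
Proof.
move=> K0; have [v0|v0] := eqVneq `|v| 0.
  by exists 0; rewrite ?normr0 // dot0l v0 mulr0.
have [[i j] /= vi] := mx_norm_neq0 v0.
rewrite ord1 in vi.
exists (\row_k (if k == j then K * Num.sg (v ord0 j) else 0)).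
  apply: ler_rV_norm => // k; rewrite mxE; case: ifP => _; last by rewrite normr0.
  by rewrite normrM (ger0_norm K0) normr_sg ler_piMr//; case: (_ != _).
rewrite /dot (bigD1 j)//= big1 ?addr0; last first.
  by move=> k kj; rewrite mxE (negPf kj) mul0r.
by rewrite mxE eqxx -mulrA [`|v|]vi normrEsg.
Qed.

Lemma closed_ball_compact (r : R) : compact [set x : V | `|x| <= r].
Proof.
apply: bounded_closed_compact.
  by exists r; split; [exact: num_real|move=> M rM x /= /le_trans; apply; exact: ltW].
rewrite (_ : mkset _ = (fun x : V => `|x|) @^-1` [set s | s <= r])//.
by apply: preimage_closed; [move=> x _; exact: norm_continuous|exact: closed_le].
Qed.

Lemma unit_cell x : exists k : 'rV[int]_d, `|x + map_mx intr k| <= 1.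
Proof.
exists (\row_i (- Num.floor (x ord0 i))).
apply: ler_rV_norm => // i; rewrite !mxE rmorphN/=.
have := floor_itv (x ord0 i); rewrite intrD.
case/andP=> h1 h2; rewrite ger0_norm ?subr_ge0// lerBlDr.
by rewrite addrC ltW.
Qed.

Lemma periodicW (T : Type) (f : V -> T) (P : T -> Prop) : periodic f ->
  (forall x, `|x| <= 1 -> P (f x)) -> forall x, P (f x).
Proof. by move=> pf Pf x; have [k /Pf] := unit_cell x; rewrite pf. Qed.

Lemma periodic_min (f : V -> R) : continuous f -> periodic f ->
  exists m, forall x, f m <= f x.
Proof.
move=> cf pf.
have [|m _ mP] := compact_EVT_min _ (@closed_ball_compact 1)
   (continuous_subspaceT cf).
  by exists 0; rewrite /= normr0.
exists m => x; have [k xk] := unit_cell x.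
by rewrite -(pf x k) mP// inE.
Qed.

Lemma dot_continuous (v : V) : continuous (fun p : V => dot p v).
Proof.
apply: (@lipschitz_continuous _ _ _ (d%:R * `|v|)) => q q'.
by rewrite !(dotC _ v) -dotBr (le_trans (ler_dot _ _)).
Qed.

End Vectors.

(** * Bounds, growth and Lipschitz estimates for H and L *)

Section Hamiltonian.
Context {R : realType} {d : nat}.
Local Notation V := 'rV[R]_d.
Context (H : V -> V -> R) (tH : tonelli H).
Implicit Types (x y v p : V).

Let HH (z : V * V) := H z.1 z.2.

Lemma tonelli_continuous : continuous HH.
Proof. by have [] := tonelli_C2 tH. Qed.

Lemma hamiltonian_continuous x : continuous (H x).
Proof.
move=> p; apply: (@continuous_comp _ _ _ (fun p => (x, p)) (fun z => H z.1 z.2)).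
  move=> A [[B C] [/= Bx Cp] BC]; apply: filterS Cp => q Cq.
  by apply: BC; split => //; exact: nbhs_singleton.
exact: tonelli_continuous.
Qed.

Lemma bounded_strip (f : V * V -> R) (P : R) : continuous f ->
  (forall p, periodic (fun x => f (x, p))) ->
  exists2 B : R, 0 <= B & forall x p, `|p| <= P -> `|f (x, p)| <= B.
Proof.
move=> cf pf.
have cK := compact_setX (@closed_ball_compact R d 1)
  (@closed_ball_compact R d P).
have cnf : continuous (fun z => `|f z|).
  by move=> z; apply: continuous_comp; [exact: cf|exact: norm_continuous].
have [P0|P0] := ltP P 0.
  exists 0 => // x p pP; exfalso.
  by have := le_lt_trans pP P0; rewrite normr_lt0.
have [|c _ cP] := compact_EVT_max _ cK (continuous_subspaceT cnf).
  by exists (0, 0); split; rewrite /= normr0.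
exists `|f c| => // x p pP; apply: (@periodicW _ _ _ (fun x => f (x, p)) (fun t => `|t| <= _)) => // y y1.
by apply: cP; rewrite inE.
Qed.

Lemma hamiltonian_bounded P :
  exists2 B : R, 0 <= B & forall x p, `|p| <= P -> `|H x p| <= B.
Proof.
by apply: (@bounded_strip HH); [exact: tonelli_continuous|exact: tonelli_periodic tH].
Qed.

Lemma is_derive_line (W : normedModType R) (f : W -> R) (z w : W) (s : R) :
  (forall y : W, derivable f y w) ->
  is_derive s 1 (fun t : R => f (z + t *: w)) ('D_w f (z + s *: w)).
Proof.
move=> df.
have E : (fun h : R => h^-1 *: (f (z + (h *: 1 + s) *: w) - f (z + s *: w))) =
         (fun h : R => h^-1 *: (f (h *: w + (z + s *: w)) - f (z + s *: w))).
  apply/funext => h; congr (_ *: (f _ - _)).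
  by rewrite [h *: 1]mulr1 scalerDl addrCA.
by apply: DeriveDef; rewrite /derivable /derive /= E //; exact: df.
Qed.

(** The derivative of H along (e_i, 0) is continuous and periodic in x, hence bounded on the strip
    [|p| <= P]; the mean value theorem does the rest. [hamiltonian_lip] then moves one coordinate at
    a time. *)
Lemma hamiltonian_lip_coord (P : R) (i : 'I_d) :
  exists2 B : R, 0 <= B & forall x p (s : R), `|p| <= P ->
    `|H (x + s *: delta_mx ord0 i) p - H x p| <= B * `|s|.
Proof.
pose w : V * V := (delta_mx ord0 i, 0).
have [cf fC] := tonelli_C2 tH.
have [df [cdf _]] := fC w.
have line (z : V * V) (s : R) : z + s *: w = (z.1 + s *: delta_mx ord0 i, z.2).
  rewrite /w [z]surjective_pairing /=.
  by congr pair; rewrite /= scaler0 addr0.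
have perdf p : periodic (fun x => 'D_w HH (x, p)).
  move=> x k; rewrite /derive; under eq_fun do rewrite /HH /= addrA !(tonelli_periodic tH).
  by [].
have [B B0 BP] := bounded_strip P cdf perdf.
exists B => //.
have pos x p (s : R) : `|p| <= P -> 0 <= s ->
    `|H (x + s *: delta_mx ord0 i) p - H x p| <= B * s.
  move=> pP s0.
  have D (t : R) : is_derive t (1 : R) (fun t : R => HH ((x, p) + t *: w))
      ('D_w HH ((x, p) + t *: w)).
    exact: is_derive_line.
  have [|c _] := MVT_segment s0 (fun t _ => D t).
    apply: continuous_subspaceT => t.
    by apply: differentiable_continuous; apply/derivable1_diffP; case: (D t).
  rewrite !line /HH /= scale0r addr0 subr0 => ->.
  by rewrite normrM (ger0_norm s0) ler_wpM2r// BP.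
move=> x p s pP; have [s0|s0] := leP 0 s; first by rewrite (ger0_norm s0) pos.
rewrite distrC (ltr0_norm s0).
have := pos (x + s *: delta_mx ord0 i) p (- s) pP.
by rewrite scaleNr addrK; apply; rewrite oppr_ge0 ltW.
Qed.

Lemma hamiltonian_lip P : exists2 B : R, 0 <= B &
  forall x y p, `|p| <= P -> `|H x p - H y p| <= B * `|x - y|.
Proof.
have /choice[B0 BP] (i : 'I_d) : exists B : R, 0 <= B /\
    forall x p (s : R), `|p| <= P ->
      `|H (x + s *: delta_mx ord0 i) p - H x p| <= B * `|s|.
  by have [B] := hamiltonian_lip_coord P i; exists B.
exists (\sum_(i < d) B0 i); first by apply: sumr_ge0 => i _; case: (BP i).
move=> x y p pP.
have step (s : seq 'I_d) : `|H (y + \sum_(i <- s) ((x - y) ord0 i) *: delta_mx ord0 i) p - H y p|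
    <= (\sum_(i <- s) B0 i) * `|x - y|.
  elim: s => [|i s IH]; first by rewrite !big_nil addr0 subrr normr0 mul0r.
  rewrite !big_cons mulrDl addrCA [X in H X]addrC.
  have [Bi BiP] := BP i.
  rewrite -(subrKA (H (y + \sum_(i <- s) ((x - y) ord0 i) *: delta_mx ord0 i) p)).
  rewrite (le_trans (ler_normD _ _))// lerD//.
  by rewrite (le_trans (BiP _ _ _ pP))// ler_wpM2l// ler_coord.
have := step (index_enum 'I_d).
by rewrite -row_sum_delta [y + _]addrC subrK.
Qed.

Lemma hamiltonian_superlinear (M : R) :
  exists2 K : R, 0 < K & forall x p, K <= `|p| -> M * `|p| <= H x p.
Proof.
have [K KP] := tonelli_superlinear tH M.
exists (Num.max 1 K); first by rewrite lt_max ltr01.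
move=> x p; rewrite ge_max => /andP[p1 Kp].
have p0 : 0 < `|p| by rewrite (lt_le_trans _ p1).
rewrite -ler_pdivlMr// (le_trans (KP _ Kp))//.
(* A real [inf] is a lower bound only for a set that is bounded below; the bound on H over a ball of
   momenta supplies this. *)
apply: ge_inf; last by exists x.
have [B _ BP] := hamiltonian_bounded `|p|.
exists (- B / `|p|) => _ [y _ <-].
rewrite ler_pM2r ?invr_gt0// lerNl.
by rewrite (le_trans (ler_norm _))// normrN BP.
Qed.

Local Notation L := (lagrangian H).

Lemma legendre_ubound r : exists2 P : R, 0 <= P & forall x v p, `|v| <= r ->
  P < `|p| -> dot p v - H x p < dot 0 v - H x 0.
Proof.
have [B B0 BP] := hamiltonian_bounded 0.
pose r' := Num.max 0 r.
(* The slope d r' absorbs [dot p v]; the extra 1 leaves [|p|], which exceeds the bound B on H x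
   0. *)
have [K K0 KP] := hamiltonian_superlinear (d%:R * r' + 1).
exists (Num.max K B); first by rewrite le_max (ltW K0).
move=> x v p vr; rewrite gt_max => /andP[Kp Bp].
rewrite dot0l sub0r.
have h1 := KP x p (ltW Kp).
have h2 := BP x 0; rewrite normr0 lexx in h2.
have {}h2 := le_trans (ler_norm _) (h2 isT).
have h3 : dot p v <= d%:R * r' * `|p|.
  rewrite (le_trans (ler_norm _))// (le_trans (ler_dot _ _))//.
  by rewrite mulrAC ler_wpM2r// ler_wpM2l// le_max vr orbT.
lra.
Qed.

Lemma lagrangian_max r : exists2 P : R, 0 <= P & forall x v, `|v| <= r ->
  exists2 p, `|p| <= P & L x v = dot p v - H x p /\
    forall q, dot q v - H x q <= L x v.
Proof.
have [P P0 PP] := legendre_ubound r.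
exists P => // x v vr.
pose f p := dot p v - H x p.
have cdot := @dot_continuous R d v; have cH := @hamiltonian_continuous x.
have cf : continuous f by move=> p; exact: (continuousB (cdot p) (cH p)).
have [|m mP mm] := compact_EVT_max _ (@closed_ball_compact R d P)
   (continuous_subspaceT cf).
  by exists 0; rewrite /= normr0.
have ub q : f q <= f m.
  have [qP|qP] := leP `|q| P; first by apply: mm; rewrite inE.
  rewrite (le_trans (ltW (PP x v q vr qP)))//.
  by apply: mm; rewrite inE/= normr0.
exists m; first by move: mP; rewrite inE.
suff E : L x v = f m by rewrite E; split.
rewrite /lagrangian; apply/eqP; rewrite eq_le; apply/andP; split.
  by apply: ge_sup; [exists (f 0), 0|move=> _ [q _ <-]; exact: ub].
by apply: ub_le_sup; [exists (f m) => _ [q _ <-]; exact: ub|exists m].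
Qed.

Lemma fenchel x v p : dot p v - H x p <= L x v.
Proof. by have [P _ /(_ x v (lexx _))[q _ [_ ]]] := lagrangian_max `|v|. Qed.

Lemma lagrangian_periodic v : periodic (L ^~ v).
Proof.
move=> x k; rewrite /lagrangian.
by under eq_fun do rewrite (tonelli_periodic tH).
Qed.

Lemma lagrangian_superlinear K : 0 <= K ->
  exists2 C : R, 0 <= C & forall x v, K * `|v| - C <= L x v.
Proof.
move=> K0; have [C C0 CP] := hamiltonian_bounded K.
exists C => // x v; have [p pK pv] := dot_norming v K0.
rewrite (le_trans _ (fenchel x v p))// pv lerD2l lerN2.
by rewrite (le_trans (ler_norm _))// CP.
Qed.

Lemma lagrangian_bounded r :
  exists2 B : R, 0 <= B & forall x v, `|v| <= r -> `|L x v| <= B.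
Proof.
have [P P0 PP] := lagrangian_max r.
have [B B0 BP] := hamiltonian_bounded P.
exists (d%:R * P * Num.max 0 r + B).
  by rewrite addr_ge0// !mulr_ge0// le_max lexx.
move=> x v vr; have [p pP [-> _]] := PP x v vr.
rewrite (le_trans (ler_normB _ _))// lerD ?BP//.
rewrite (le_trans (ler_dot _ _))// ler_pM// ?ler_wpM2l//.
by rewrite le_max vr orbT.
Qed.

(** The momentum optimal at (x, v) is a competitor at (y, w), and it stays in a ball on which H is
    Lipschitz in x. *)
Lemma lagrangian_lip r : exists2 B : R, 0 <= B & forall x y v w,
  `|v| <= r -> `|w| <= r -> `|L x v - L y w| <= B * (`|x - y| + `|v - w|).
Proof.
have [P P0 PP] := lagrangian_max r.
have [B B0 BP] := hamiltonian_lip P.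
exists (B + d%:R * P); first by rewrite addr_ge0// mulr_ge0.
have half x y v w : `|v| <= r ->
    L x v - L y w <= (B + d%:R * P) * (`|x - y| + `|v - w|).
  move=> vr; have [p pP [-> _]] := PP x v vr.
  have h1 := fenchel y w p.
  have h2 := le_trans (ler_norm _) (BP y x p pP); rewrite distrC in h2.
  have h3 : dot p v - dot p w <= d%:R * P * `|v - w|.
    rewrite -dotBr (le_trans (ler_norm _))// (le_trans (ler_dot _ _))//.
    by rewrite ler_wpM2r// ler_wpM2l.
  have h4 : 0 <= B * `|v - w| by rewrite mulr_ge0.
  have h5 : 0 <= d%:R * P * `|x - y| by rewrite !mulr_ge0.
  lra.
move=> x y v w vr wr; rewrite ler_norml half// andbT lerNl opprB.
by rewrite (distrC x) (distrC v) half.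
Qed.

End Hamiltonian.

(** * Absolutely continuous functions *)

Section NonmeasurableIntegrands.
Context d (T : measurableType d) (R : realType).
Context (mu : {measure set T -> \bar R}).
Local Open Scope ereal_scope.

(** The integral is a difference of suprema over simple functions lying below the positive and
    negative parts, and such suprema are monotone without any measurability. *)
Lemma le_integral_pointwise (D : set T) (f g : T -> \bar R) :
  (forall x, D x -> f x <= g x) ->
  \int[mu]_(x in D) f x <= \int[mu]_(x in D) g x.
Proof.
move=> fg.
have fgD x : (f \_ D) x <= (g \_ D) x.
  by rewrite !patchE; case: ifPn => // /set_mem; exact: fg.
rewrite /integral leeB//.
  apply: le_ereal_sup; apply: image_subset => h /= hf x; rewrite (le_trans (hf x))//.
  by rewrite !funeposE ge_max !le_max lexx orbT fgD.
apply: le_ereal_sup; apply: image_subset => h /= hf x; rewrite (le_trans (hf x))//.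
by rewrite !funenegE ge_max !le_max lexx orbT leeN2 fgD.
Qed.

(* [f] is not assumed measurable: in [action], [derive1 g] takes junk values where
   [g] is not differentiable. [f] is squeezed between the patches of [g] by [-oo]
   and [+oo] on [N]. *)
Lemma integral_eq_off_null (D N : set T) (f g : T -> \bar R) :
  measurable D -> measurable_fun D g -> measurable N -> mu N = 0 ->
  (forall x, D x -> ~ N x -> f x = g x) ->
  \int[mu]_(x in D) f x = \int[mu]_(x in D) g x.
Proof.
move=> mD mg mN N0 fg.
pose patch (c : \bar R) x := if x \in N then c else g x.
have mpatch c : measurable_fun D (patch c).
  apply: measurable_fun_if => //.
  - apply: (measurable_fun_bool true).
    rewrite [X in _ `&` X](_ : _ = N); first exact: measurableI.
    by apply/seteqP; split => x; [exact: set_mem|exact: mem_set].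
  - exact: measurable_funS mg.
have Epatch c : \int[mu]_(x in D) patch c x = \int[mu]_(x in D) g x.
  apply: ae_eq_integral => //.
  exists N; split => // x /= h; apply: contrapT => Nx; apply: h => Dx.
  by rewrite /patch memNset.
apply/eqP; rewrite eq_le; apply/andP; split.
  rewrite -(Epatch +oo); apply: le_integral_pointwise => x Dx; rewrite /patch.
  by case: ifPn => [_|/negP xN]; [rewrite leey|rewrite fg//; rewrite inE in xN].
rewrite -(Epatch -oo); apply: le_integral_pointwise => x Dx; rewrite /patch.
by case: ifPn => [_|/negP xN]; [rewrite leNye|rewrite fg//; rewrite inE in xN].
Qed.

End NonmeasurableIntegrands.

(** * Families of intervals and total variation *)

Section AbsoluteContinuity.
Context {R : realType}.
Implicit Types (a b e : R) (f : R -> R) (s t : seq (R * R)).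

Definition apart (p q : R * R) := (p.2 <= q.1) || (q.2 <= p.1).

(** Lists, in any order, can be concatenated and refined by induction, unlike the indexed families
    of [abs_continuous]. *)
Definition family a b (s : seq (R * R)) :=
  pairwise apart s && all (fun p => (a <= p.1) && (p.1 <= p.2) && (p.2 <= b)) s.

Definition total_length s := \sum_(p <- s) (p.2 - p.1).

Definition ac_family (W : normedModType R) a b (f : R -> W) :=
  forall e, 0 < e -> exists2 delta : R, 0 < delta & forall s, family a b s ->
    total_length s < delta -> \sum_(p <- s) `|f p.2 - f p.1| <= e.

Lemma apartC p q : apart p q = apart q p.
Proof. by rewrite /apart orbC. Qed.

Lemma family_cat a b s t : family a b (s ++ t) =
  [&& allrel apart s t, family a b s & family a b t].
Proof.
rewrite /family pairwise_cat all_cat.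
by case: (allrel _ _ _) => //=; do 2!case: (pairwise _ _); rewrite //= andbF.
Qed.

Lemma family_mem a b s p : family a b s -> p \in s ->
  [/\ a <= p.1, p.1 <= p.2 & p.2 <= b].
Proof. by case/andP => _ /allP h /h /andP[/andP[]]. Qed.

Lemma family_cons a b p s : family a b (p :: s) =
  [&& all (apart p) s, [&& a <= p.1, p.1 <= p.2 & p.2 <= b] & family a b s].
Proof.
rewrite /family /=; case: (all (apart p) s) => //=.
by case: (pairwise _ _); rewrite /= ?andbF// andbA.
Qed.

Lemma total_length_cat s t :
  total_length (s ++ t) = total_length s + total_length t.
Proof. by rewrite /total_length big_cat. Qed.

Lemma total_length_cons p s :
  total_length (p :: s) = p.2 - p.1 + total_length s.
Proof. by rewrite /total_length big_cons. Qed.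

Lemma abs_continuous_family (d : nat) a b (g : R -> 'rV[R]_d) :
  abs_continuous a b g -> ac_family a b g.
Proof.
move=> acg e e0; have [delta delta0 gP] := acg e e0.
exists delta => // s fs ls.
pose nths (i : 'I_(size s)) := nth (0, 0) s i.
have mem i : nths i \in s by rewrite mem_nth.
have sumE (F : R * R -> R) : \sum_(p <- s) F p = \sum_(i < size s) F (nths i).
  by rewrite (big_nth (0, 0)) big_mkord.
rewrite sumE ltW//; apply: (gP _ (fun i => (nths i).1) (fun i => (nths i).2)).
- by move=> i; have [] := family_mem fs (mem i).
- apply/trivIsetP => i j _ _; rewrite -val_eqE => ij.
  have : apart (nths i) (nths j).
    case/andP : fs => /(pairwiseP (0, 0)) h _.
    have [lij|lji|E] := ltngtP i j; last by move: ij; rewrite (val_inj E) eqxx.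
      by apply: h; rewrite ?inE.
    by rewrite apartC; apply: h; rewrite ?inE.
  move=> ap; apply/seteqP; split => // x /=; rewrite !in_itv/= => -[].
  move=> /andP[h1 h2] /andP[h3 h4].
  by case/orP : ap => h; lra.
- by rewrite -(sumE (fun p => p.2 - p.1)).
Qed.

Lemma ac_family_coord (d : nat) a b (g : R -> 'rV[R]_d) i :
  ac_family a b g -> ac_family a b ((fun r : R => g r ord0 i) : R -> R^o).
Proof.
move=> acg e e0; have [delta delta0 gP] := acg e e0.
exists delta => // s fs ls; rewrite (le_trans _ (gP s fs ls))//.
apply: ler_sum => p _; have := ler_coord (g p.2 - g p.1) i.
by rewrite !mxE.
Qed.

(** The last clause exchanges the two ways of pairing consecutive points, to match the sum produced
    by [variation_zip]. *)
Lemma partition_family : forall (l : seq R) a, path <%R a l ->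
  [/\ family a (last a l) (zip (a :: l) l),
      total_length (zip (a :: l) l) = last a l - a &
      forall F : R -> R -> R, \sum_(x <- zip l (a :: l)) F x.1 x.2 =
        \sum_(p <- zip (a :: l) l) F p.2 p.1].
Proof.
elim=> [|x l IH] a /=.
  by move=> _; rewrite /total_length big_nil subrr; split => // F; rewrite !big_nil.
move=> /andP[ax xl]; have [fl tl Fl] := IH x xl; split.
- rewrite family_cons /= lexx (ltW ax)/=.
  have xla : x <= last x l.
    by move: xl; rewrite lt_path_sortedE => /andP[]; case: (l) => // y l' /allP/(_ (last y l'))/= h _; apply/ltW/h; rewrite mem_last.
  rewrite xla/=; apply/andP; split.
    by apply/allP => p pl; rewrite /apart/=; have [-> _ _] := family_mem fl pl.
  case/andP : fl => h1 /allP h2; rewrite /family h1; apply/allP => p /h2.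
  by move=> /andP[/andP[h3 ->] ->]; rewrite (le_trans (ltW ax)).
- by rewrite total_length_cons tl /= addrC addrA subrK.
- by move=> F; rewrite !big_cons /= Fl.
Qed.

(* Induction on the family: each interval is refined into a subdivision, so the
   intervals already treated are kept in an auxiliary family [t]. *)
Lemma ac_total_variation a b f : ac_family a b (f : R -> R^o) ->
  forall e, 0 < e -> exists2 delta : R, 0 < delta & forall s, family a b s ->
    total_length s < delta ->
    (\sum_(p <- s) total_variation p.1 p.2 f <= e%:E)%E.
Proof.
move=> acf e e0; have [delta delta0 fP] := acf e e0; exists delta => // s.
suff H t : family a b (s ++ t) -> total_length (s ++ t) < delta ->
    (\sum_(p <- s) total_variation p.1 p.2 f +
      (\sum_(p <- t) `|f p.2 - f p.1|)%:E <= e%:E)%E.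
  move=> fs ls; have := H [::]; rewrite cats0 big_nil adde0; exact.
elim: s t => [|p s IH] t.
  by rewrite big_nil add0e => ft lt; rewrite lee_fin; exact: fP.
rewrite big_cons cat_cons family_cons total_length_cons => /and3P[pst /and3P[ap p12 pb]].
move=> fst' lst.
set X := (\sum_(p <- s) _)%E; set Y := \sum_(p <- t) _.
have p0 : 0 <= p.2 - p.1 by rewrite subr_ge0.
have XY : (X + Y%:E <= e%:E)%E by apply: IH => //; lra.
have X0 : (0 <= X)%E.
  rewrite /X big_seq; apply: sume_ge0 => q qs; apply: total_variation_ge0.
  by have [] := family_mem fst' (_ : q \in s ++ t); rewrite ?mem_cat ?qs.
have Y0 : 0 <= Y by apply: sumr_ge0.
have Xfin : X \is a fin_num.
  rewrite ge0_fin_numE// (le_lt_trans _ (ltry e))// (le_trans _ XY)//.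
  by rewrite leeDl// lee_fin.
have [p12E|p12N] := eqVneq p.1 p.2.
  by rewrite p12E total_variationxx add0e.
have {}p12 : p.1 < p.2 by rewrite lt_neqAle p12N.
rewrite -addeA -leeBrDr ?fin_numD ?Xfin//.
apply: ge_ereal_sup => _ [v [l pl <-] <-].
rewrite leeBrDr ?fin_numD ?Xfin// addeCA.
have [lp /eqP ll] := pl.
rewrite variation_zip//.
have [fl tl Fl] := partition_family lp; rewrite ll in fl tl.
rewrite (Fl (fun x y => `|f x - f y|)).
rewrite -EFinD -big_cat; apply: IH.
  move: fst'; rewrite !family_cat allrel_catr => /and3P[ast fs ft].
  have pl_in q : q \in zip (p.1 :: l) l -> [/\ p.1 <= q.1, q.1 <= q.2 & q.2 <= p.2].
    exact: family_mem fl.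
  have apl q u : q \in zip (p.1 :: l) l -> apart p u -> apart q u.
    by move=> /pl_in[h1 h2 h3] /orP[h|h]; apply/orP; [left|right]; lra.
  move: pst; rewrite all_cat => /andP[/allP ps /allP pt].
  rewrite ast fs ft /= !andbT; apply/and3P; split.
  - by apply/allrelP => u q us ql; rewrite apartC; apply: apl => //; exact: ps.
  - by apply/allrelP => q u ql ut; apply: apl => //; exact: pt.
  - case/andP : fl => h1 /allP h2; rewrite /family h1; apply/allP => q /h2.
    by move=> /andP[/andP[h3 ->] h4]; rewrite (le_trans ap)//= (le_trans h4).
move: lst; rewrite !total_length_cat tl; lra.
Qed.

End AbsoluteContinuity.

(** * Densities of bounded nondecreasing functions *)

Section StieltjesDensity.
Context {R : realType}.
Local Notation leb := (@lebesgue_measure R).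

Lemma stieltjes_itv (F : cumulative R R) (x y : R) : x <= y ->
  lebesgue_stieltjes_measure F `]x, y]%classic = (F y - F x)%:E.
Proof.
move=> xy; rewrite /lebesgue_stieltjes_measure /= /measure_extension.
rewrite measurable_mu_extE; last exact: is_ocitv.
exact: (wlength_itv_bnd F false false xy).
Qed.

(** Absolute continuity on the whole line: [delta] does not depend on [lo] and [hi]. Absolute values
    are omitted because [F] will be nondecreasing. *)
Definition ac_increments (F : R -> R) := forall e, 0 < e ->
  exists2 delta : R, 0 < delta & forall lo hi s, family lo hi s ->
    total_length s < delta -> \sum_(p <- s) (F p.2 - F p.1) <= e.

Let bound n : R := n.+1%:R.
(** Half-open cells, as in [stieltjes_itv]; 2 (n + 1)^2 of them tile the interval from -(n + 1) to n
    + 1. *)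
Let cell n i : set R := `]i%:R / bound n - bound n, i.+1%:R / bound n - bound n]%classic.

Let bound_gt0 n : 0 < bound n. Proof. exact: ltr0Sn. Qed.

Let cell_cover n (x : R) : `|x| < bound n ->
  exists2 i, (i < 2 * n.+1 * n.+1)%N & cell n i x.
Proof.
move=> xn; have b0 := bound_gt0 n.
pose z := (x + bound n) * bound n.
move: xn; rewrite ltr_norml => /andP[x1 x2].
have z0 : 0 < z by rewrite mulr_gt0// -ltrBlDr sub0r.
(* Cells are open on the left, so the index is the ceiling of [z] minus one. *)
have [k zE] : exists k : nat, Num.ceil z = k.+1%:Z.
  have : 0 < Num.ceil z by rewrite ceil_gt0.
  by case: (Num.ceil z) => // -[//|k] _; exists k.
have := ceil_itv z; rewrite zE => /andP[k1 k2].
have k1' : k%:R < z by move: k1; rewrite -addn1 PoszD addrK.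
exists k.
  rewrite -(ltr_nat R) (lt_le_trans k1')// /z !natrM.
  rewrite ler_wpM2r// ?ltW// -[n.+1%:R]/(bound n); lra.
rewrite /cell /= in_itv/= ltrBlDr lerBrDr; apply/andP; split.
  by rewrite ltr_pdivrMr.
by rewrite ler_pdivlMr.
Qed.

Let cell_disjoint n : trivIset setT (cell n).
Proof.
apply: ltn_trivIset => i j ij; apply/seteqP; split => // x [].
rewrite /cell /= !in_itv/= => /andP[h1 h2] /andP[h3 h4].
have : j.+1%:R / bound n - bound n <= i%:R / bound n - bound n.
  by rewrite lerB// ler_pM2r ?invr_gt0// ler_nat.
by move=> h5; have := lt_le_trans h3 (le_trans h2 h5); rewrite ltxx.
Qed.

Let cells (U : set R) n : set R :=
  \big[setU/set0]_(i < 2 * n.+1 * n.+1 | `[< cell n i `<=` U >]) cell n i.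

Let measurable_cells U n : measurable (cells U n).
Proof. by apply: bigsetU_measurable => i _; exact: measurable_itv. Qed.

Let cells_sub U n : cells U n `<=` U.
Proof.
rewrite /cells; elim/big_ind : _ => //; first by move=> A B AU BU x [/AU|/BU].
by move=> i /asboolP.
Qed.

Let cells_mem U (x : R) : open U -> U x ->
  \forall n \near \oo, cells U n x.
Proof.
move=> oU Ux; have /nbhs_ballP[e /= e0 eU] : nbhs x U by exact: open_nbhs_nbhs.
near=> n.
have xn : `|x| < bound n.
  near: n; exists (Num.bound `|x|) => // n /= hn.
  apply: (lt_le_trans (archi_boundP _)) => //.
  by rewrite ler_nat (leq_trans hn).
have ne : (bound n)^-1 < e.
  rewrite invf_plt ?posrE//; near: n; exists (Num.bound e^-1) => // n /= hn.
  apply: (lt_le_trans (archi_boundP _)); first by rewrite invr_ge0 ltW.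
  by rewrite ler_nat (leq_trans hn).
have [i iN ix] := cell_cover xn.
rewrite /cells (bigD1 (Ordinal iN))/=; first by left.
apply/asboolP => y /= iy; apply: eU => /=.
move: ix iy; rewrite /cell /= !in_itv/= -natr1 mulrDl mul1r.
move=> /andP[h1 h2] /andP[h3 h4].
have [yx xy] : y - x < e /\ x - y < e.
  move: ne h1 h2 h3 h4; move: (i%:R / bound n) (bound n)^-1 (bound n) => A B C.
  by move=> ? ? ? ? ?; split; lra.
by rewrite /ball/= ltr_norml xy ltrNl opprB yx.
Unshelve. all: by end_near. Qed.

(* An open set is the limit of the unions of the cells of mesh [1 / n] in
   [[-n, n]] that it contains. *)
Lemma stieltjes_open_le (F : cumulative R R) (U : set R) (e delta : R) :
  open U ->
  (forall lo hi s, family lo hi s -> total_length s < delta ->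
    \sum_(p <- s) (F p.2 - F p.1) <= e) ->
  (leb U < delta%:E)%E -> (lebesgue_stieltjes_measure F U <= e%:E)%E.
Proof.
move=> oU Fe Ud; set mu := lebesgue_stieltjes_measure F.
have mcell n i : measurable (cell n i) by exact: measurable_itv.
have cell_le n i : i%:R / bound n - bound n <= i.+1%:R / bound n - bound n.
  by rewrite lerB// ler_pM2r ?invr_gt0// ler_nat.
have cells_le n : (mu (cells U n) <= e%:E)%E.
  pose N := (2 * n.+1 * n.+1)%N.
  pose P (i : 'I_N) := `[< cell n i `<=` U >].
  pose s := [seq (i%:R / bound n - bound n, i.+1%:R / bound n - bound n) | i : 'I_N <- enum 'I_N & P i].
  have big (m : {measure set (measurableTypeR R) -> \bar R}) :
      m (cells U n) = (\sum_(i < N | P i) m (cell n i))%E.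
    rewrite /cells; apply: (@measure_bigsetU_ord_cond _ _ _ m N P (fun i : 'I_N => cell n i)).
      by move=> i _; exact: measurable_itv.
    by move=> i j _ _ ij; apply/val_inj; exact: (cell_disjoint I I ij).
  have fs : family (- bound n) (N%:R / bound n - bound n) s.
    apply/andP; split.
      rewrite pairwise_map; apply: sub_pairwise (_ : pairwise [rel i j | i != j] _); last first.
        by rewrite -uniq_pairwise filter_uniq// enum_uniq.
      move=> i j /= ij; rewrite /apart/= !lerD2r !ler_pM2r ?invr_gt0//.
      rewrite !ler_nat; move: ij; rewrite -val_eqE /=.
      by case: ltngtP.
    apply/allP => _ /mapP[i _ ->] /=; rewrite cell_le andbT.
    rewrite lerBrDr addNr divr_ge0 ?ler0n ?(ltW (bound_gt0 n))//=.
    by rewrite lerB// ler_pM2r ?invr_gt0// ler_nat.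
  have -> : mu (cells U n) = (\sum_(i < N | P i) mu (cell n i))%E by exact: (big (lebesgue_stieltjes_measure F)).
  rewrite (eq_bigr (fun i : 'I_N => (F (i.+1%:R / bound n - bound n) -
    F (i%:R / bound n - bound n))%:E)); last by move=> i _; exact: stieltjes_itv.
  rewrite sumEFin lee_fin.
  have -> : \sum_(i < N | P i) (F (i.+1%:R / bound n - bound n) - F (i%:R / bound n - bound n))
      = \sum_(p <- s) (F p.2 - F p.1).
    by rewrite big_map big_filter big_enum_cond.
  apply: Fe fs _; rewrite -lte_fin; apply: le_lt_trans Ud.
  apply: (@le_trans _ _ (leb (cells U n))).
    have -> : leb (cells U n) = (\sum_(i < N | P i) leb (cell n i))%E by exact: (big lebesgue_measure).
    rewrite le_eqVlt; apply/orP; left; apply/eqP.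
    rewrite /total_length big_map big_filter big_enum_cond -sumEFin.
    apply: eq_bigr => i _; rewrite lebesgue_measure_itv/= lte_fin.
    case: ltP => // h.
    by apply/eqP; rewrite eqe subr_eq0 eq_le h cell_le.
  apply: le_measure; rewrite ?inE; [exact: measurable_cells|exact: open_measurable|exact: cells_sub].
(* The meshes 1 / (n + 1) are not nested, so [cells U n] is not monotone in n; the intersections of
   its tails are, and they still exhaust [U]. *)
pose V n := \bigcap_(m in [set m | (n <= m)%N]) cells U m.
have mV n : measurable (V n) by apply: bigcap_measurable => //; exists n => /=.
have UV : \bigcup_n V n = U.
  apply/seteqP; split; first by move=> x [n _ /(_ n (leqnn n))]; exact: cells_sub.
  by move=> x /(cells_mem oU)[n _ nx]; exists n => // m /= nm; exact: nx.
have cV : mu (V n) @[n --> \oo] --> mu U.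
  rewrite -UV; apply: nondecreasing_cvg_mu => //; first by rewrite UV; exact: open_measurable.
  move=> n m nm; apply/subsetPset => x Vx k /= mk; apply: Vx => /=.
  exact: leq_trans mk.
rewrite -(cvg_lim _ cV)//; apply: lime_le; first by apply/cvg_ex; exists (mu U).
apply: nearW => n; apply: le_trans (cells_le n); apply: le_measure; rewrite ?inE.
- exact: mV.
- exact: measurable_cells.
- by move=> x /(_ n); apply => /=.
Qed.

(** Boundedness of [F] makes its Stieltjes measure finite. It is dominated by the Lebesgue measure:
    by outer regularity a null set lies in an open set of length less than [delta], to which
    [stieltjes_open_le] applies. *)
Lemma stieltjes_density (F : R -> R) (m M : R) :
  {homo F : x y / x <= y} -> (forall x, m <= F x <= M) -> ac_increments F ->
  exists2 f : R -> R, leb.-integrable setT (EFin \o f) &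
    forall x y, x <= y -> F y - F x = \int[leb]_(t in `]x, y]) f t.
Proof.
move=> ndF bF acF.
have rcF : right_continuous F.
  move=> x; apply/cvgrPdist_lt => e e0.
  have [delta delta0 dP] := acF (e / 2) (divr_gt0 e0 (ltr0Sn _ 1)).
  near=> y.
  have xy : x < y by near: y; exact: nbhs_right_gt.
  have := dP x y [:: (x, y)].
  rewrite /total_length !big_seq1 /= => h; rewrite distrC ger0_norm ?subr_ge0 ?ndF ?ltW//.
  apply: (@le_lt_trans _ _ (e / 2)); last by rewrite ltr_pdivrMr// ltr_pMr// ltr1n.
  apply: h; first by rewrite /family /= !lexx (ltW xy).
  by rewrite ltrBlDl; near: y; apply: nbhs_right_lt; rewrite ltrDl.
pose Fc : cumulative R R := HB.pack F (isCumulative.Build R _ R F ndF rcF).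
pose mu := lebesgue_stieltjes_measure Fc.
have muT : (mu setT <= (M - m)%:E)%E.
  pose V n : set R := `](- n.+1%:R), n.+1%:R]%classic.
  have VT : \bigcup_n V n = setT.
    apply/seteqP; split => // x _; exists (Num.bound `|x|) => //.
    rewrite /V /= in_itv/=.
    have : `|x| < (Num.bound `|x|).+1%:R.
      by apply: (lt_trans (archi_boundP _)); rewrite // ltr_nat.
    by rewrite ltr_norml => /andP[-> /ltW].
  have cV : mu (V n) @[n --> \oo] --> mu setT.
    rewrite -VT; apply: nondecreasing_cvg_mu.
    - by move=> i; exact: measurable_itv.
    - by rewrite VT.
    move=> n k nk; apply/subsetPset; apply: subset_itv; rewrite bnd_simp ?lerN2 ler_nat//.
  rewrite -(cvg_lim _ cV)//; apply: lime_le; first by apply/cvg_ex; exists (mu setT).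
  apply: nearW => n; rewrite /mu stieltjes_itv; last first.
    by rewrite (@le_trans _ _ 0) ?oppr_le0.
  by rewrite lee_fin lerB//; [case/andP: (bF n.+1%:R)|case/andP: (bF (- n.+1%:R))].
have fin : fin_num_fun mu.
  move=> A mA; rewrite ge0_fin_numE// (le_lt_trans _ (ltry (M - m)))//.
  by apply: le_trans muT; apply: le_measure; rewrite ?inE.
pose nu : {finite_measure set (measurableTypeR R) -> \bar R} :=
  HB.pack (lebesgue_stieltjes_measure Fc)
    (Measure_isFinite.Build _ (measurableTypeR R) R
      (lebesgue_stieltjes_measure Fc) fin).
have [|f [f0 ffin fint fE]] := @radon_nikodym_sigma_finite _ _ _ leb nu.
  apply/null_content_dominatesP => A mA A0.
  apply/eqP; rewrite eq_le measure_ge0 andbT; apply/lee_addgt0Pr => e e0.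
  rewrite add0e.
  have [delta delta0 dP] := acF e e0.
  have [|U [oU AU Ue]] := lebesgue_regularity_outer mA _ delta0.
    by rewrite [X in (X < _)%E]A0.
  apply: (@le_trans _ _ (mu U)).
    by apply: le_measure; rewrite ?inE//; exact: open_measurable.
  apply: (@stieltjes_open_le Fc U e delta oU dP).
  have mU : measurable U by exact: open_measurable.
  rewrite -(setDUK AU) measureU//; last 2 first.
    exact: measurableD.
    by rewrite setDIK.
  by rewrite [X in (X + _)%E]A0 add0e.
have fineE : EFin \o (fine \o f) = f by apply/funext => x /=; rewrite fineK.
exists (fine \o f); first by rewrite fineE.
move=> x y xy; rewrite /Rintegral.
have -> : (\int[leb]_(t in `]x, y]) (EFin ((fine \o f) t)) = \int[leb]_(t in `]x, y]) f t)%E.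
  by apply: eq_integral => t _ /=; rewrite fineK.
by rewrite -fE// [nu _]stieltjes_itv.
Unshelve. all: by end_near. Qed.

End StieltjesDensity.

(** * Densities of absolutely continuous functions *)

Section AcDensity.
Context {R : realType}.
Local Notation leb := (@lebesgue_measure R).
Local Notation TV := total_variation.
Context (a b : R) (f : R -> R) (ab : a <= b) (acf : ac_family a b (f : R -> R^o)).

(** Extends functions from [a, b] to the line by constants, because Stieltjes measures are attached
    to functions on all of R. It is monotone and shortens intervals, hence maps families to
    families. *)
Let clamp x := Num.max a (Num.min b x).

Let clamp_in x : a <= clamp x <= b.
Proof. by rewrite /clamp le_max lexx ge_max ab ge_min lexx. Qed.

Let clamp_id x : a <= x -> x <= b -> clamp x = x.
Proof. by move=> ax xb; rewrite /clamp min_r// max_r. Qed.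

Let clamp_homo : {homo clamp : x y / x <= y}.
Proof.
move=> x y xy; rewrite /clamp ge_max le_max lexx /= le_max.
by apply/orP; right; rewrite le_min !ge_min lexx xy orbT.
Qed.

Let clamp_length x y : x <= y -> clamp y - clamp x <= y - x.
Proof.
move=> xy; rewrite /clamp !maxEle !minEle.
case: (leP b y) => ?; case: (leP b x) => ?; case: (leP a b) ab => // ? _;
  by case: (leP a x) => ?; case: (leP a y) => ?; lra.
Qed.

(** Walk from [x] to [y] by steps of length delta / 2: each piece is shorter than [delta], hence has
    variation at most 1. *)
Let ac_tv_fin n x y : a <= x -> x <= y -> y <= b ->
  forall delta, 0 < delta -> y - x < delta / 2 * n%:R ->
  (forall s, family a b s -> total_length s < delta ->
    (\sum_(p <- s) TV p.1 p.2 f <= 1%:E)%E) ->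
  TV x y f \is a fin_num.
Proof.
move=> + + yb delta delta0 + dP.
elim: n x => [|n IH] x ax xy; first by rewrite mulr0 subr_lt0 ltNge xy.
have small z w : a <= z -> z <= w -> w <= b -> w - z < delta ->
    TV z w f \is a fin_num.
  move=> az zw wb wz; rewrite ge0_fin_numE ?total_variation_ge0//.
  apply: le_lt_trans (ltry 1).
  have := dP [:: (z, w)]; rewrite /total_length !big_seq1/=; apply => //.
  by rewrite /family /= az zw wb.
move=> yx; have [h|h] := ltP (y - x) delta; first exact: small.
pose z := x + delta / 2.
have [az xz zy] : [/\ a <= z, x <= z & z <= y] by rewrite /z; split; lra.
rewrite (total_variationD f xz zy) fin_numD small//=; last 2 first.
  by rewrite (le_trans zy).
  by rewrite /z; lra.
apply: IH => //.
move: yx; rewrite -[n.+1%:R]natr1 mulrDr mulr1 /z; lra.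
Qed.

Lemma ac_total_variation_fin x y : a <= x -> x <= y -> y <= b ->
  TV x y f \is a fin_num.
Proof.
move=> ax xy yb; have [delta delta0 dP] := ac_total_variation acf (@ltr01 R).
pose n := Num.bound ((y - x) / (delta / 2)).
apply: (@ac_tv_fin n _ _ ax xy yb delta delta0 _ dP).
rewrite mulrC -ltr_pdivrMr ?divr_gt0// archi_boundP// divr_ge0 ?subr_ge0//.
by rewrite divr_ge0// ltW.
Qed.

Let G x := fine (TV a (clamp x) f).

Let G_sub x y : x <= y -> G y - G x = fine (TV (clamp x) (clamp y) f).
Proof.
move=> xy; have /andP[ax xb] := clamp_in x; have /andP[ay yb] := clamp_in y.
rewrite /G (total_variationD f ax (clamp_homo xy)) fineD ?ac_total_variation_fin//.
  by rewrite addrC addKr.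
exact: clamp_homo.
Qed.

Let G_f x y : x <= y -> `|f (clamp y) - f (clamp x)| <= G y - G x.
Proof.
move=> xy; have /andP[ax xb] := clamp_in x; have /andP[ay yb] := clamp_in y.
rewrite G_sub// -lee_fin fineK ?ac_total_variation_fin ?clamp_homo//.
by rewrite total_variation_ge// clamp_homo.
Qed.

Let G_ac : ac_increments G.
Proof.
move=> e e0; have [delta delta0 dP] := ac_total_variation acf e0.
exists delta => // lo hi s fs ls.
have sP p : p \in s -> p.1 <= p.2 by case/(family_mem fs).
pose s' := [seq (clamp p.1, clamp p.2) | p <- s].
have fs' : family a b s'.
  case/andP : fs => ps _; apply/andP; split.
    rewrite pairwise_map; apply: sub_pairwise ps => p q /orP[h|h].
      by apply/orP; left; exact: clamp_homo.
    by apply/orP; right; exact: clamp_homo.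
  apply/allP => _ /mapP[p ps' ->] /=.
  have /andP[-> _] := clamp_in p.1; have /andP[_ ->] := clamp_in p.2.
  by rewrite clamp_homo// sP.
have ls' : total_length s' < delta.
  apply: le_lt_trans ls; rewrite /total_length big_map big_seq [leRHS]big_seq.
  by apply: ler_sum => p ps; rewrite clamp_length// sP.
have := dP s' fs' ls'; rewrite big_map -lee_fin -sumEFin.
apply: le_trans; rewrite big_seq [leRHS]big_seq; apply: lee_sum => p ps.
have pp := sP p ps.
have /andP[ax xb] := clamp_in p.1; have /andP[ay yb] := clamp_in p.2.
by rewrite G_sub//= fineK// ac_total_variation_fin// clamp_homo.
Qed.

Let G_bound x : 0 <= G x <= G b.
Proof.
have G0 y z : y <= z -> G y <= G z.
  by move=> yz; rewrite -subr_ge0 (le_trans _ (G_f yz)).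
have /andP[ax xb] := clamp_in x.
apply/andP; split.
  by rewrite fine_ge0// total_variation_ge0.
have -> : G x = G (clamp x) by rewrite /G (clamp_id ax xb).
exact: G0.
Qed.

(* [f] is a difference of two nondecreasing functions with absolutely continuous
   increments, namely its variation [G] and [G - f]; their Stieltjes measures are
   dominated by the Lebesgue measure, whence densities by Radon-Nikodym. *)
Lemma ac_density : exists2 g : R -> R, leb.-integrable setT (EFin \o g) &
  forall x y, a <= x -> x <= y -> y <= b ->
    f y - f x = \int[leb]_(t in `]x, y]) g t.
Proof.
have ndG : {homo G : x y / x <= y}.
  by move=> y z yz; rewrite -subr_ge0 (le_trans _ (G_f yz)).
have [g1 ig1 Eg1] := stieltjes_density ndG G_bound G_ac.
pose F x := G x - f (clamp x).
have F_sub x y : x <= y -> 0 <= F y - F x <= 2 * (G y - G x).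
  move=> xy; have := G_f xy; rewrite ler_norml /F => /andP[h1 h2].
  by apply/andP; split; lra.
have ndF : {homo F : x y / x <= y}.
  by move=> x y /F_sub/andP[h _]; rewrite -subr_ge0.
have bF x : F a <= F x <= F b.
  have /andP[ax xb] := clamp_in x.
  have -> : F x = F (clamp x) by rewrite /F /G (clamp_id ax xb).
  by rewrite !ndF.
have acF : ac_increments F.
  move=> e e0; have [delta delta0 dP] := G_ac (divr_gt0 e0 (ltr0Sn _ 1)).
  exists delta => // lo hi s fs ls.
  have := dP _ _ _ fs ls; rewrite ler_pdivlMr// mulrC mulr_sumr.
  apply: le_trans; rewrite big_seq [leRHS]big_seq; apply: ler_sum => p ps.
  by have [_ /F_sub/andP[_ ->]] := family_mem fs ps.
have [g2 ig2 Eg2] := stieltjes_density ndF bF acF.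
have gE : EFin \o (fun t => g1 t - g2 t) = ((EFin \o g1) \- (EFin \o g2))%E by [].
exists (fun t => g1 t - g2 t).
  by rewrite gE; exact: integrableB.
move=> x y ax xy yb.
rewrite RintegralB//; [|exact: integrableS ig1|exact: integrableS ig2].
rewrite -Eg1// -Eg2// /F (clamp_id ax (le_trans xy yb)).
rewrite (clamp_id (le_trans ax xy) yb); lra.
Qed.

End AcDensity.

(** * Derivatives of absolutely continuous curves *)

Section Curves.
Context {R : realType} {d : nat}.
Local Notation V := 'rV[R]_d.
Local Notation leb := (@lebesgue_measure R).
Implicit Types (g : R -> V) (tau : R).

Lemma ac_uniformly_continuous tau g : abs_continuous 0 tau g ->
  forall e, 0 < e -> exists2 delta : R, 0 < delta & forall s t,
    0 <= s <= tau -> 0 <= t <= tau -> `|s - t| < delta -> `|g s - g t| <= e.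
Proof.
move=> /abs_continuous_family acg e e0; have [delta delta0 dP] := acg e e0.
exists delta => // s t.
wlog st : s t / s <= t => [h|/andP[s0 _] /andP[_ tT]].
  have [|/ltW ts] := leP s t; first exact: h.
  by move=> sT tT; rewrite distrC (distrC (g s)); exact: h.
rewrite distrC ger0_norm ?subr_ge0// distrC => std.
have := dP [:: (s, t)]; rewrite /total_length !big_seq1/=; apply => //.
by rewrite /family/= s0 st tT.
Qed.

Lemma lipschitz_abs_continuous (r : R) tau g : 0 <= r ->
  (forall s t, 0 <= s <= tau -> 0 <= t <= tau -> `|g s - g t| <= r * `|s - t|) ->
  abs_continuous 0 tau g.
Proof.
move=> r0 lipg e e0; exists (e / (r + 1)); first by rewrite divr_gt0// ltr_wpDl.
move=> n s t st _; rewrite ltr_pdivlMr ?ltr_wpDl// => lst.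
apply: le_lt_trans lst; rewrite mulr_suml; apply: ler_sum => i _.
have [s0 [sti tT]] := st i.
rewrite (le_trans (lipg _ _ _ _))//.
- by rewrite tT andbT (le_trans s0).
- by rewrite s0 (le_trans sti).
- by rewrite mulrC ger0_norm ?subr_ge0// ler_wpM2l ?subr_ge0// lerDl.
Qed.

(** Each coordinate is, up to a constant, the primitive of its density, which Lebesgue's theorem
    differentiates almost everywhere. One null set [N] serves all coordinates; off [N] the velocity
    is the measurable function [phi]. *)
Lemma ac_curve tau g : 0 < tau -> abs_continuous 0 tau g ->
  exists (phi : 'I_d -> R -> R) (N : set R),
  [/\ forall i, leb.-integrable setT (EFin \o phi i),
      forall i x y, 0 <= x -> x <= y -> y <= tau ->
        g y ord0 i - g x ord0 i = \int[leb]_(t in `]x, y]) phi i t,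
      measurable N, leb N = 0 &
      forall t, 0 < t < tau -> ~ N t -> is_derive t 1 g (\row_i phi i t)].
Proof.
move=> tau0 acg; have acf := abs_continuous_family acg.
have /choice[phi phiP] (i : 'I_d) : exists f : R -> R,
    leb.-integrable setT (EFin \o f) /\
    forall x y, 0 <= x -> x <= y -> y <= tau ->
      g y ord0 i - g x ord0 i = \int[leb]_(t in `]x, y]) f t.
  have [f fint fE] := ac_density (ltW tau0) (ac_family_coord i acf).
  by exists f.
have intphi i : leb.-integrable setT (EFin \o phi i) by case: (phiP i).
pose F i x := \int[leb]_(t in [set` `]-oo, x]]) phi i t.
have [N [mN N0 sN]] : {ae leb, forall x, forall i,
    derivable (F i) x 1 /\ derive1 (F i) x = phi i x}.
  apply: filter_forall => i; apply: FTC1Ny.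
    by move=> y; apply: integrableS (intphi i).
  exact: open_integrable_locally (openT) (intphi i).
exists phi, N; split => //; first by move=> i; case: (phiP i).
move=> t /andP[t0 tT] Nt.
have dF i : derivable (F i) t 1 /\ derive1 (F i) t = phi i t.
  by apply: contrapT => h; apply: Nt; apply: sN => /(_ i).
have gF i : \forall s \near t, F i s + (g 0 ord0 i - F i 0) = g s ord0 i.
  near=> s.
  have s0 : 0 < s by near: s; exact: lt_nbhsr.
  have sT : s < tau by near: s; exact: lt_nbhsl.
  have := (phiP i).2 _ _ (lexx 0) (ltW s0) (ltW sT).
  rewrite -(@Rintegral_itvB _ (phi i) -oo%O (BRight s) 0)//; first last.
  - by rewrite bnd_simp ltW.
  - exact: integrableS (intphi i).
  rewrite -/(F i s) -/(F i 0) => E; rewrite addrCA -E; ring.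
have dg i : is_derive t 1 (fun s => g s ord0 i) (phi i t).
  apply: near_eq_is_derive (gF i) _.
  have [d1 d2] := dF i; rewrite -[phi i t]addr0.
  have dFi : is_derive t (1 : R) (F i) (phi i t).
    by apply: DeriveDef; [exact: d1|rewrite -derive1E].
  exact: (is_deriveD dFi (is_derive_cst _ _ _)).
have dgt : derivable g t 1.
  by apply/derivable_mxP => i j; rewrite ord1; case: (dg j).
apply: DeriveDef => //; rewrite derive_mx//; apply/matrixP => i j.
by rewrite !mxE ord1; have [_ ->] := dg j.
Unshelve. all: by end_near. Qed.

(** Straddle lemma: the errors at the two ends add up to e (b - t) + e (t - a) = e (b - a). It is
    needed because a grid cell contains [t] without starting there. *)
Lemma derive_straddle g (t : R) (v : V) : is_derive t 1 g v ->
  forall e, 0 < e -> exists2 delta : R, 0 < delta & forall a b,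
    a <= t -> t <= b -> a < b -> b - a < delta ->
    `|(b - a)^-1 *: (g b - g a) - v| <= e.
Proof.
move=> [dgt dgv] e e0.
have gcvg : (s^-1 *: (g (s *: 1 + t) - g t)) @[s --> 0^'] --> v.
  by rewrite -dgv; exact: dgt.
have [delta /= delta0 deltaP] := (cvgrPdist_le _ _).1 gcvg e e0.
have lin s : `|s - t| < delta -> `|g s - g t - (s - t) *: v| <= e * `|s - t|.
  have [->|st] := eqVneq s t.
    by rewrite !subrr scale0r subrr normr0 normr0 mulr0.
  move=> std; have st0 : s - t != 0 by rewrite subr_eq0.
  have := deltaP (s - t); rewrite /ball_/= sub0r normrN => /(_ std st0).
  rewrite [(s - t) *: 1]mulr1 subrK distrC => h1.
  rewrite -[g s - g t](scalerKV st0) -scalerBr normrZ mulrC.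
  by rewrite ler_wpM2r.
exists delta => // a b at_ tb ab abd.
have ba0 : 0 < b - a by rewrite subr_gt0.
have ban0 : b - a != 0 by rewrite gt_eqF.
rewrite -{1}(scalerK ban0 v) -scalerBr normrZ ger0_norm ?invr_ge0 ?(ltW ba0)//.
rewrite ler_pdivrMl//.
have -> : g b - g a - (b - a) *: v =
    (g b - g t - (b - t) *: v) - (g a - g t - (a - t) *: v).
  by apply/rowP => i; rewrite !mxE; ring.
have l1 := lin b; have l2 := lin a.
rewrite ger0_norm ?subr_ge0// in l1; rewrite ler0_norm ?subr_le0// opprB in l2.
rewrite (le_trans (ler_normB _ _))// (le_trans (lerD (l1 _) (l2 _)))//; [lra|lra|].
by have -> : e * (b - t) + e * (t - a) = (b - a) * e by ring.
Qed.

End Curves.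

(** * The action integral *)

Section Action.
Context {R : realType} {d : nat}.
Local Notation V := 'rV[R]_d.
Local Notation leb := (@lebesgue_measure R).
Context (H : V -> V -> R) (tH : tonelli H).
Local Notation L := (lagrangian H).
Implicit Types (g : R -> V) (tau : R).

Lemma rational_near (p : V) (e : R) : 0 < e ->
  exists q : 'rV[rat]_d, `|p - map_mx ratr q| <= e.
Proof.
move=> e0; have /choice[q qP] (i : 'I_d) : exists q : rat,
    p ord0 i - e < ratr q < p ord0 i.
  have [|q] := @rat_in_itvoo R (p ord0 i - e) (p ord0 i); first by lra.
  by rewrite in_itv/=; exists q.
exists (\row_i q i); apply: ler_rV_norm; first exact: ltW.
move=> i; rewrite !mxE; have /andP[h1 h2] := qP i.
by rewrite ler_norml; apply/andP; split; lra.
Qed.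

(** By continuity in the momentum, the supremum may be restricted to rational momenta. Superlevel
    sets of L along a curve thus become countable unions, whence [lagrangian_measurable]. *)
Lemma lagrangian_gt x v (c : R) : c < L x v ->
  exists q : 'rV[rat]_d, c < dot (map_mx ratr q) v - H x (map_mx ratr q).
Proof.
have [P P0 /(_ x v (lexx _))[p _ [-> _]]] := lagrangian_max tH `|v|.
have cf : {for p, continuous (fun p => dot p v - H x p)}.
  have c1 := @dot_continuous R d v; have c2 := @hamiltonian_continuous R d H tH x.
  exact: (continuousB (c1 p) (c2 p)).
move=> cp; have /cf/nbhs_ballP[e /= e0 eP] : nbhs (dot p v - H x p) [set s | c < s].
  exact: lt_nbhsr.
have [q pq] := rational_near p (divr_gt0 e0 (ltr0Sn _ 1)).
exists q; apply: eP; rewrite -ball_normE /ball_/= (le_lt_trans pq)//.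
by rewrite ltr_pdivrMr// ltr_pMr// ltr1n.
Qed.

Lemma hamiltonian_measurable tau g p : abs_continuous 0 tau g ->
  measurable_fun `[0, tau] (fun t => H (g t) p).
Proof.
move=> acg; have [tau0|tau0] := ltP tau 0.
  by rewrite set_itv_ge -?ltNge ?bnd_simp//; exact: measurable_fun_set0.
(* Clamping the time gives a function that is continuous on the whole line and agrees with the given
   one on [0, tau]. *)
pose clamp (x : R) := Num.max 0 (Num.min tau x).
have clamp_in x : 0 <= clamp x <= tau.
  by rewrite /clamp le_max lexx ge_max tau0 ge_min lexx.
have clamp_lip x y : `|clamp x - clamp y| <= `|x - y|.
  wlog xy : x y / x <= y => [h|].
    have [|/ltW yx] := leP x y; first exact: h.
    by rewrite distrC (distrC x); exact: h.
  rewrite ler_norml distrC ger0_norm ?subr_ge0// /clamp !maxEle !minEle.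
  by case: (leP tau y) => ?; case: (leP tau x) => ?; case: (leP 0 tau) tau0 => // ? _;
  case: (leP 0 x) => ?; case: (leP 0 y) => ?; apply/andP; split; lra.
apply: (@eq_measurable_fun _ _ _ _ _ (fun t => H (g (clamp t)) p)).
  move=> t; rewrite inE /= in_itv/= => /andP[t0 tT].
  by rewrite /clamp min_r// max_r.
apply: measurable_funTS; apply: continuous_measurable_fun => t.
have [B B0 BP] := hamiltonian_lip tH `|p|.
apply/cvgrPdist_le => /= e e0.
have [|delta delta0 dP] := ac_uniformly_continuous acg (_ : 0 < e / (B + 1)).
  by rewrite divr_gt0// ltr_wpDl.
near=> s; rewrite (le_trans (BP _ _ _ (lexx _)))//.
apply: (@le_trans _ _ (B * (e / (B + 1)))); last first.
  by rewrite mulrCA ger_pMr// ler_pdivrMr ?mul1r ?lerDl// ltr_wpDl.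
rewrite ler_wpM2l// dP//; apply: le_lt_trans (clamp_lip _ _) _.
by near: s; apply: cvgr_dist_lt => //; exact: cvg_id.
Unshelve. all: by end_near. Qed.

Lemma lagrangian_measurable tau g (phi : 'I_d -> R -> R) :
  abs_continuous 0 tau g -> (forall i, measurable_fun setT (phi i)) ->
  measurable_fun `[0, tau] (fun t => L (g t) (\row_i phi i t)).
Proof.
move=> acg mphi mD; apply: (measurability _ (RGenOInfty.measurableE R)) => //.
move=> _ [_ [c ->] <-].
pose f (q : 'rV[rat]_d) (t : R) : R :=
  dot (map_mx ratr q) (\row_i phi i t) - H (g t) (map_mx ratr q).
rewrite [X in measurable X](_ : _ =
   \bigcup_q (`[0, tau] `&` (f q) @^-1` `]c, +oo[)).
  apply: countable_bigcupT_measurable; first exact: countableP.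
  move=> q; apply: (_ : measurable_fun `[0, tau] (f q)) => //.
  apply: measurable_funB; last exact: hamiltonian_measurable.
  apply: measurable_sum => i; apply: measurable_funM => //.
  apply: (@eq_measurable_fun _ _ _ _ _ (phi i)); first by move=> t _; rewrite mxE.
  exact: measurable_funTS.
apply/seteqP; split => t.
  move=> [/= tD]; rewrite in_itv/= andbT => /lagrangian_gt[q qc].
  by exists q => //; split => //=; rewrite in_itv/= qc.
move=> [q _ [/= tD]]; rewrite !in_itv/= !andbT => qc; split => //.
by rewrite (lt_le_trans qc)// fenchel.
Qed.

(** The negative part is bounded on a set of finite measure, so its integral is finite; the integral
    of the positive part could then be infinite only if the whole integral were. *)
Lemma measurable_lower_bound_integral (D : set R) (l : R -> R) (C : R) :
  measurable D -> (leb D < +oo)%E -> measurable_fun D l ->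
  (forall t, D t -> - C <= l t) ->
  (\int[leb]_(t in D) (l t)%:E < +oo)%E -> leb.-integrable D (EFin \o l).
Proof.
move=> mD Dfin ml lC lfin.
have [C0 lC'] : 0 <= `|C| /\ forall t, D t -> 0 <= l t + `|C|.
  split=> // t /lC lCt; rewrite -lerBlDr sub0r (le_trans _ lCt)// lerN2.
  exact: ler_norm.
have mE : measurable_fun D (EFin \o l) by exact/measurable_EFinP.
have negfin : (\int[leb]_(t in D) (EFin \o l)^\- t < +oo)%E.
  apply: (@le_lt_trans _ _ (\int[leb]_(t in D) (`|C|)%:E)%E).
    apply: ge0_le_integral => //.
    - exact: measurable_funeneg.
    - move=> t Dt; rewrite funenegE/= ge_max; apply/andP; split; rewrite -?EFinN lee_fin//.
      by have := lC' _ Dt; rewrite -[l t]opprK addrC subr_ge0 opprK.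
  by rewrite integral_cst// lte_mul_pinfty.
have negfin' : (\int[leb]_(t in D) (EFin \o l)^\- t)%E \is a fin_num.
  by rewrite ge0_fin_numE// integral_ge0.
apply/integrableP; split => //.
have -> : (\int[leb]_(t in D) `|(EFin \o l) t| =
    \int[leb]_(t in D) ((EFin \o l)^\+ t + (EFin \o l)^\- t))%E.
  by apply: eq_integral => t _; rewrite -[LHS]/((abse \o (EFin \o l)) t) fune_abse.
rewrite ge0_integralD//; [|exact: measurable_funepos|exact: measurable_funeneg].
rewrite lte_add_pinfty//.
rewrite ltNge leye_eq; apply/negP => /eqP posE; move: lfin.
by rewrite integralE posE; move/fin_numP: negfin'; case: (\int[leb]_(x in D) _)%E => // -[].
Qed.

Lemma Rintegral_sum (D : set R) (I : Type) (s : seq I) (f : I -> R -> R) :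
  measurable D -> (forall i, leb.-integrable D (EFin \o f i)) ->
  leb.-integrable D (EFin \o (fun t => \sum_(i <- s) f i t)) /\
  \int[leb]_(t in D) (\sum_(i <- s) f i t) = \sum_(i <- s) \int[leb]_(t in D) f i t.
Proof.
move=> mD intf; elim: s => [|i s [IH1 IH2]].
  under eq_fun do rewrite big_nil; rewrite big_nil; split.
    exact: integrable0.
  by rewrite Rintegral_cst// mul0r.
under eq_fun do rewrite big_cons.
rewrite big_cons RintegralD// IH2; split => //.
have -> : EFin \o (fun t => f i t + \sum_(j <- s) f j t) =
  ((EFin \o f i) \+ (EFin \o (fun t => (\sum_(j <- s) f j t)%R)))%E by [].
by apply: integrableD => //; exact: intf.
Qed.

Lemma Rintegral_itv_cst (a b h : R) : a <= b ->
  \int[leb]_(t in `]a, b]) h = (b - a) * h.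
Proof.
move=> ab; rewrite Rintegral_cst// mulrC; congr (_ * _).
suff E : leb `]a, b]%classic = (b - a)%:E by rewrite [X in fine X]E.
rewrite [LHS]lebesgue_measure_itv/= lte_fin; case: ltP => // ba.
by apply/eqP; rewrite eqe eq_sym subr_eq0 eq_le ba ab.
Qed.

(** The end points join the null set, since there [derive1 g] depends on values of [g] outside
    [0, tau]. *)
Lemma action_eq_off_null tau g N (l : R -> \bar R) : measurable_fun `[0, tau] l ->
  measurable N -> leb N = 0 ->
  (forall t, 0 < t < tau -> ~ N t -> (L (g t) (derive1 g t))%:E = l t) ->
  action L tau g = (\int[leb]_(t in `[0%R, tau]) l t)%E.
Proof.
move=> ml mN N0 gl; rewrite /action.
apply: (@integral_eq_off_null _ (measurableTypeR R) R leb _ (N `|` ([set 0] `|` [set tau]))) => //.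
- by apply: measurableU => //; exact: measurableU.
- apply/eqP; rewrite -[_ == 0]measure_le0.
  apply: le_trans (measureU2 _ _ _) _ => //; first exact: measurableU.
  rewrite -[leRHS]adde0; apply: leeD; first by rewrite [leLHS]N0.
  apply: le_trans (measureU2 _ _ _) _ => //.
  by rewrite -[leRHS]adde0; apply: leeD; rewrite [leLHS]lebesgue_measure_set1.
move=> t; rewrite /= in_itv/= => /andP[t0 tT] /not_orP[Nt /not_orP[/eqP tn0 /eqP tnT]].
by apply: gl => //; rewrite !lt_neqAle eq_sym tn0 t0 tnT.
Qed.

(* [I a b] is the action of [g] on [[a, b]]; the last clause integrates Fenchel's
   inequality with a constant momentum. *)
Lemma partial_action tau g : 0 < tau -> abs_continuous 0 tau g ->
  (action L tau g < +oo)%E -> exists I : R -> R -> R,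
  [/\ (I 0 tau)%:E = action L tau g,
      forall a b c, 0 <= a -> a <= b -> b <= c -> c <= tau ->
        I a c = I a b + I b c &
      forall a b p h, 0 <= a -> a <= b -> b <= tau ->
        (forall t, a <= t <= b -> H (g t) p <= h) ->
        dot p (g b - g a) - (b - a) * h <= I a b].
Proof.
move=> tau0 acg actfin.
have [phi [N [intphi phiE mN N0 dphi]]] := ac_curve tau0 acg.
have mphi i : measurable_fun setT (phi i).
  by have /integrableP[/measurable_EFinP] := intphi i.
pose l t := L (g t) (\row_i phi i t).
have ml : measurable_fun `[0, tau] l by exact: lagrangian_measurable.
have actE : action L tau g = (\int[leb]_(t in `[0%R, tau]) (l t)%:E)%E.
  apply: (action_eq_off_null _ mN N0) => [|t tI Nt]; first exact/measurable_EFinP.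
  by rewrite derive1E; have [_ ->] := dphi t tI Nt.
have [C C0 CP] := lagrangian_superlinear tH (lexx 0).
have intl : leb.-integrable `[0, tau] (EFin \o l).
  apply: (@measurable_lower_bound_integral _ _ C) => //.
  - by rewrite lebesgue_measure_itv/=; case: ifP => _; rewrite -?EFinB ltry.
  - by move=> t _; have := CP (g t) (\row_i phi i t); rewrite mul0r sub0r.
  - by rewrite -actE.
have intS a b : 0 <= a -> b <= tau -> leb.-integrable `]a, b] (EFin \o l).
  move=> a0 bT; apply: integrableS intl => // t /=; rewrite !in_itv/=.
  by move=> /andP[at_ tb]; rewrite (le_trans a0 (ltW at_)) (le_trans tb).
exists (fun a b => \int[leb]_(t in `]a, b]) l t); split.
- rewrite actE /Rintegral integral_itv_obnd_cbnd; last first.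
    by apply/measurable_EFinP; apply: measurable_funS ml => //; exact: subset_itv_oc_cc.
  by rewrite fineK// integrable_fin_num.
- move=> a b c a0 ab bc cT.
  have E : `]a, c]%classic = `]a, b] `|` `]b, c].
    by rewrite -itv_bndbnd_setU// bnd_simp.
  rewrite E Rintegral_setU//; first by rewrite -E; exact: intS.
  apply/disj_setPS => t [] /=; rewrite !in_itv/= => /andP[_ tb] /andP[bt _].
  by have := lt_le_trans bt tb; rewrite ltxx.
move=> a b p h a0 ab bT hP.
have mab : measurable `]a, b] by [].
have intab i : leb.-integrable `]a, b] (EFin \o phi i).
  exact: integrableS (intphi i).
have intpab i : leb.-integrable `]a, b] (EFin \o (fun t => p ord0 i * phi i t)).
  rewrite (_ : EFin \o _ = (fun t => (p ord0 i)%:E * (EFin \o phi i) t)%E)//.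
  exact: integrableZl.
have [intsum sumE] := Rintegral_sum (index_enum 'I_d) mab intpab.
have inth : leb.-integrable `]a, b] (EFin \o (fun=> h)).
  apply/integrableP; split; first exact: measurable_cst.
  rewrite integral_cst//= lebesgue_measure_itv/=.
  by case: ifP => _; rewrite ?mule0 -?EFinB -?EFinM ltry.
have -> : dot p (g b - g a) - (b - a) * h =
    \int[leb]_(t in `]a, b]) (\sum_(i < d) p ord0 i * phi i t - h).
  rewrite RintegralB// sumE Rintegral_itv_cst//; congr (_ - _).
  apply: eq_bigr => i _; rewrite !mxE phiE//.
  by symmetry; apply: RintegralZl => //; exact: intab.
apply: le_Rintegral => //.
- by rewrite (_ : EFin \o _ = (EFin \o (fun t => (\sum_(i < d) p ord0 i * phi i t)%R)) \- (EFin \o (fun=> h)))%E//; exact: integrableB.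
- exact: intS.
move=> t; rewrite /= in_itv/= => /andP[at_ tb].
apply: le_trans (fenchel tH _ _ p).
have -> : dot p (\row_i phi i t) = \sum_(i < d) p ord0 i * phi i t.
  by apply: eq_bigr => i _; rewrite mxE.
by rewrite lerB// hP// (ltW at_).
Qed.

(* At points of differentiability the difference quotients over grid cells
   containing the point converge to the velocity; then Fatou's lemma applies. *)
Lemma action_le_grid tau g (r S : R) : 0 < tau -> 0 <= r ->
  (forall s t, 0 <= s <= tau -> 0 <= t <= tau -> `|g s - g t| <= r * `|s - t|) ->
  (forall e, 0 < e -> \forall m \near \oo,
     \sum_(0 <= j < m.+1) tau / m.+1%:R *
       L (g (tau / m.+1%:R * j%:R))
         ((tau / m.+1%:R)^-1 *: (g (tau / m.+1%:R * j.+1%:R) - g (tau / m.+1%:R * j%:R)))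
     <= S + e) ->
  (action L tau g <= S%:E)%E.
Proof.
move=> tau0 r0 lipg gridS.
have acg := lipschitz_abs_continuous r0 lipg.
have [phi [N [intphi phiE mN N0 dphi]]] := ac_curve tau0 acg.
pose h (m : nat) := tau / m.+1%:R.
have h0 m : 0 < h m by rewrite divr_gt0.
pose idx m (t : R) := Num.truncn (t / h m).
pose f m t := L (g (h m * (idx m t)%:R))
  ((h m)^-1 *: (g (h m * (idx m t).+1%:R) - g (h m * (idx m t)%:R))).
have idx_itv m t : 0 <= t -> h m * (idx m t)%:R <= t < h m * (idx m t).+1%:R.
  move=> t0; have := truncn_itv (divr_ge0 t0 (ltW (h0 m))).
  by rewrite ler_pdivlMr// ltr_pdivrMr// !(mulrC (h m)).
have hM m : h m * m.+1%:R = tau by rewrite /h mulfVK.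
have idx_lt m t : 0 <= t -> t < tau -> (idx m t < m.+1)%N.
  move=> t0 tT; have /andP[h1 _] := idx_itv m t t0.
  by have := le_lt_trans h1 tT; rewrite -(hM m) ltr_pM2l// ltr_nat.
have idx_eq m j t : h m * j%:R <= t -> t < h m * j.+1%:R -> idx m t = j.
  move=> h1 h2; apply/eqP; rewrite /idx truncn_eq.
    by rewrite ler_pdivlMr// ltr_pdivrMr// !(mulrC _ (h m)) h1 h2.
  by rewrite divr_ge0 ?(ltW (h0 m))// (le_trans _ h1)// mulr_ge0 ?(ltW (h0 m)).
(* Adding [C] makes the integrands nonnegative, as Fatou's lemma requires; tau C is subtracted at
   the end. *)
have [C C0 CP] := lagrangian_superlinear tH (lexx 0).
have {}CP x v : 0 <= L x v + C by have := CP x v; rewrite mul0r sub0r -subr_ge0 opprK.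
have fcvg t : 0 < t < tau -> ~ N t ->
    (f m t + C)%:E @[m --> \oo] --> (L (g t) (\row_i phi i t) + C)%:E.
  move=> tI Nt; have /andP[t0 tT] := tI.
  set v := \row_i phi i t.
  have [B B0 BP] := lagrangian_lip tH (r + `|v|).
  apply: cvg_EFin; first exact: nearW.
  rewrite /comp /=; apply: cvgD; last exact: cvg_cst.
  apply/cvgrPdist_le => /= e e0.
  have B1 : 0 < B + 1 by rewrite ltr_wpDl.
  pose e' := e / (2 * (B + 1)).
  have e'0 : 0 < e' by rewrite divr_gt0// mulr_gt0.
  have [delta delta0 lin] := derive_straddle (dphi t tI Nt) e'0.
  have h_small (eta : R) : 0 < eta -> \forall m \near \oo, h m < eta.
    move=> eta0; exists (Num.bound (tau / eta)) => // m /= Nm.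
    rewrite /h ltr_pdivrMr// mulrC -ltr_pdivrMr//.
    apply: lt_le_trans (archi_boundP _) _; first by rewrite divr_ge0// ltW.
    by rewrite ler_nat (leq_trans Nm).
  near=> m.
  have hd : h m < delta by near: m; exact: h_small.
  have he : r * h m <= e'.
    rewrite (le_trans (ler_wpM2r (ltW (h0 m)) (_ : r <= r + 1)))// ?lerDl//.
    rewrite mulrC -ler_pdivlMr ?ltr_wpDl// ltW//; near: m; apply: h_small.
    by rewrite divr_gt0// ltr_wpDl.
  have /andP[] := idx_itv m t (ltW t0).
  rewrite -natr1 mulrDr mulr1; set a := h m * (idx m t)%:R => at_ ta.
  have a0 : 0 <= a by rewrite mulr_ge0 ?(ltW (h0 m)).
  have ahT : a + h m <= tau.
    by rewrite /a -[X in _ + X](mulr1 (h m)) -mulrDr natr1 -[leRHS](hM m) ler_pM2l// ler_nat idx_lt// ltW.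
  have hn0 : h m != 0 by rewrite gt_eqF.
  have gat : `|g t - g a| <= e'.
    rewrite (le_trans (lipg _ _ _ _))//; [lra..|].
    rewrite (le_trans _ he)// ler_wpM2l// ger0_norm ?subr_ge0//; lra.
  pose D := (h m)^-1 *: (g (a + h m) - g a).
  have Dr : `|D| <= r.
    rewrite normrZ ger0_norm ?invr_ge0 ?(ltW (h0 m))// ler_pdivrMl// mulrC.
    rewrite (le_trans (lipg _ _ _ _))//; [have := h0 m; lra|lra|].
    by rewrite addrC addKr ger0_norm// ltW.
  have Dv : `|v - D| <= e'.
    have ahE : a + h m - a = h m by rewrite addrAC subrr add0r.
    rewrite distrC /D -{1}ahE lin ?ahE//; [lra|by rewrite ltrDl].
  rewrite /f -/a -[(idx m t).+1%:R]natr1 mulrDr mulr1 -/a -/D.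
  rewrite (le_trans (BP _ _ _ _ _ _))//; [by rewrite lerDr|by rewrite (le_trans Dr)// lerDl|].
  rewrite (le_trans (ler_wpM2l B0 (lerD gat Dv)))// -mulr2n -mulr_natr.
  have -> : B * (e' * 2) = e * (B / (B + 1)) by rewrite /e'; field; lra.
  by rewrite ger_pMr// ler_pdivrMr// mul1r lerDl.
pose F m t := (f m t + C)%:E.
have F0 m t : (0 <= F m t)%E by rewrite lee_fin CP.
pose D : set R := `[0, tau]%classic.
have mD : measurable D by exact: measurable_itv.
have cell_cover m t : D t ->
    (\bigcup_j (D `&` `[h m * j%:R, h m * j.+1%:R[)) t.
  rewrite /D /= in_itv/= => tD; exists (idx m t) => //; split => //=.
  by have /andP[t0 _] := tD; rewrite in_itv/= idx_itv.
have mF m : measurable_fun D (F m).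
  (* [f m] is constant on each cell, so the preimage of [Y] is a union of cells. *)
  apply/measurable_EFinP => _ Y mY.
  rewrite (_ : D `&` _ = \bigcup_(j in [set j | exists2 t, (D `&` `[h m * j%:R, h m * j.+1%:R[) t & Y (f m t + C)])
    (D `&` `[h m * j%:R, h m * j.+1%:R[)).
    by apply: bigcup_measurable => j _; exact: measurableI.
  apply/seteqP; split => t.
    move=> [tD Yt]; have [j _ tj] := cell_cover m t tD.
    by exists j => //=; exists t.
  move=> [j /= [s [sD sj] Ys] [tD tj]]; split => //=.
  rewrite /= in_itv/= in sj; rewrite /= in_itv/= in tj.
  have /andP[/idx_eq si /si {}si] := sj.
  have /andP[/idx_eq ti /ti {}ti] := tj.
  by rewrite /f ti -si.
have intF m : (\int[leb]_(t in D) F m t)%E = (\sum_(0 <= j < m.+1) h m *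
    (L (g (h m * j%:R)) ((h m)^-1 *: (g (h m * j.+1%:R) - g (h m * j%:R))) + C))%:E.
  have mFS (A : set R) : measurable A -> A `<=` D -> measurable_fun A (F m).
    by move=> mA AD; apply: measurable_funS (mF m).
  rewrite /D -integral_itv_bndo_bndc; last first.
    apply: mFS; first exact: measurable_itv.
    by move=> t; rewrite /D /= !in_itv/= => /andP[-> /ltW].
  suff IH k : (k <= m.+1)%N ->
     (\int[leb]_(t in `[0%R, (h m * k%:R)%R[) F m t)%E = (\sum_(0 <= j < k) h m *
    (L (g (h m * j%:R)) ((h m)^-1 *: (g (h m * j.+1%:R) - g (h m * j%:R))) + C))%:E.
    by rewrite -{1}(hM m) IH.
  elim: k => [_|k IH km].
    by rewrite mulr0 set_itv_ge ?bnd_simp ?ltxx// integral_set0 big_nil.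
  rewrite big_nat_recr//= EFinD -IH ?(ltnW km)//.
  have hk : h m * k%:R <= h m * k.+1%:R by rewrite ler_pM2l// ler_nat.
  have hk0 : 0 <= h m * k%:R by rewrite mulr_ge0 ?(ltW (h0 m)).
  have hkT : h m * k.+1%:R <= tau by rewrite -[leRHS](hM m) ler_pM2l// ler_nat.
  have E : `[0, h m * k.+1%:R[%classic = `[0, h m * k%:R[ `|` `[h m * k%:R, h m * k.+1%:R[.
    by rewrite -itv_bndbnd_setU// bnd_simp.
  rewrite E ge0_integral_setU//; last 2 first.
  - apply: mFS; first exact: measurableU.
    rewrite -E => t; rewrite /D /= !in_itv/= => /andP[-> h1].
    by rewrite (le_trans (ltW h1)).
  - apply/disj_setPS => t [] /=; rewrite !in_itv/= => /andP[_ h1] /andP[h2 _].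
    by have := lt_le_trans h1 h2; rewrite ltxx.
  congr (_ + _)%E.
  set c := L _ _ + C.
  rewrite (_ : (\int[leb]_(t in _) _)%E = (\int[leb]_(t in `[(h m * k%:R)%R, (h m * k.+1%:R)%R[) c%:E)%E).
    rewrite integral_cst//= [X in (_ * X)%E]lebesgue_measure_itv/= lte_fin.
    have -> : h m * k%:R < h m * k.+1%:R by rewrite ltr_pM2l// ltr_nat.
    rewrite -EFinB -EFinM; congr (_%:E).
    by rewrite -mulrBr -natr1 addrAC subrr add0r mulr1 mulrC.
  apply: eq_integral => t; rewrite inE /= in_itv/= => /andP[/idx_eq h1 /h1 E1].
  by rewrite /F /f E1.
pose G t := limn_einf (F ^~ t).
have mG : measurable_fun D G.
  apply: measurableT_comp => //; apply: measurable_fun_limn_esup => k.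
  exact: measurableT_comp.
have G0 t : (0 <= G t)%E.
  rewrite /G limn_einf_lim; apply: lime_ge; first exact: is_cvg_einfs.
  by apply: nearW => n; apply: le_ereal_inf_tmp => _ [k _ <-].
have intG : (\int[leb]_(t in D) G t <= (S + tau * C)%:E)%E.
  apply: (@le_trans _ _ (limn_einf (fun m => \int[leb]_(t in D) F m t)%E)).
    exact: fatou.
  apply/lee_addgt0Pr => e e0; rewrite limn_einf_lim; apply: lime_le; first exact: is_cvg_einfs.
  have [M _ MP] := gridS e e0.
  (* The infimum over the tail from [n] is at most the term of index [maxn n M], where the grid
     bound already holds. *)
  apply: nearW => n; apply: (@le_trans _ _ (\int[leb]_(t in D) F (maxn n M) t)%E).
    by apply: ereal_inf_lbound; exists (maxn n M) => //=; exact: leq_maxl.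
  rewrite intF -EFinD lee_fin.
  under eq_bigr do rewrite mulrDr.
  rewrite big_split/= sumr_const_nat subn0 -mulr_natr mulrAC hM.
  by rewrite addrAC lerD2r; apply: MP => /=; exact: leq_maxr.
have GE t : 0 < t < tau -> ~ N t -> G t = (L (g t) (\row_i phi i t) + C)%:E.
  move=> tI Nt; rewrite /G is_cvg_limn_einfE; first exact: (cvg_lim _ (fcvg t tI Nt)).
  by apply/cvg_ex; eexists; exact: fcvg.
have intC : (\int[leb]_(t in D) C%:E)%E = (tau * C)%:E.
  rewrite integral_cst//= [X in (_ * X)%E]lebesgue_measure_itv/= lte_fin tau0.
  by rewrite -EFinB -EFinM subr0 mulrC.
have iG : leb.-integrable D G.
  apply/integrableP; split => //.
  under eq_integral do rewrite gee0_abs//.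
  exact: le_lt_trans intG (ltry _).
have iC : leb.-integrable D (fun=> C%:E).
  apply/integrableP; split; first exact: measurable_cst.
  under eq_integral do rewrite gee0_abs ?lee_fin//.
  by rewrite intC ltry.
have -> : action L tau g = (\int[leb]_(t in D) (G \- (fun=> C%:E)) t)%E.
  apply: (action_eq_off_null _ mN N0) => [|t tI Nt]; first exact: emeasurable_funB.
  by rewrite GE// derive1E -EFinB addrK; have [_ ->] := dphi t tI Nt.
by rewrite integralB// intC leeBlDr// -EFinD.
Unshelve. all: by end_near. Qed.

End Action.

(** * Minimal action *)

Section MinimalAction.
Context {R : realType} {d : nat}.
Local Notation V := 'rV[R]_d.
Local Notation leb := (@lebesgue_measure R).
Context (H : V -> V -> R) (tH : tonelli H).
Local Notation L := (lagrangian H).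
Local Notation DA := (discrete_action L).
Local Notation MA := (minimal_action L).
Implicit Types (g : R -> V) (tau : R) (x y : V).

Lemma velocity_le tau x y (r : R) : 0 < tau -> `|y - x| <= r * tau ->
  `|tau^-1 *: (y - x)| <= r.
Proof.
move=> tau0 yx; rewrite normrZ ger0_norm ?invr_ge0 ?(ltW tau0)//.
by rewrite ler_pdivrMl// mulrC.
Qed.

(** The interface through which lower bounds on the action are proved; [partial_action] provides it
    for every curve of finite action. *)
Definition partial_action_of g tau (I : R -> R -> R) :=
  (forall a b c, 0 <= a -> a <= b -> b <= c -> c <= tau ->
     I a c = I a b + I b c) /\
  (forall a b p h, 0 <= a -> a <= b -> b <= tau ->
     (forall t, a <= t <= b -> H (g t) p <= h) ->
     dot p (g b - g a) - (b - a) * h <= I a b).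

(** Tests on [a, b] the constant momentum that norms the displacement; the constant is a bound on H
    over momenta of norm at most [K]. *)
Lemma partial_action_coercive (K : R) : 0 <= K ->
  exists2 C : R, 0 <= C & forall g tau I, partial_action_of g tau I ->
    forall a b, 0 <= a -> a <= b -> b <= tau ->
      K * `|g b - g a| - C * (b - a) <= I a b.
Proof.
move=> K0; have [B B0 BP] := hamiltonian_bounded tH K.
exists B => // g tau I [_ IP] a b a0 ab bT.
have [p pK pE] := dot_norming (g b - g a) K0.
rewrite -pE mulrC; apply: IP => // t _.
by rewrite (le_trans (ler_norm _))// BP.
Qed.

(* Test the momentum that is optimal for the mean velocity; [g] stays close to
   [g a] unless its action exceeds that of the constant-velocity curve. *)
Lemma partial_action_discrete (r : R) :
  exists2 C : R, 0 <= C & forall g tau I, partial_action_of g tau I ->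
    forall a b, 0 <= a -> a < b -> b <= tau ->
      `|g b - g a| <= r * (b - a) ->
      DA (b - a) (g a) (g b) - C * (b - a) ^+ 2 <= I a b.
Proof.
have [P P0 PP] := lagrangian_max tH r.
have [Lam Lam0 LamP] := hamiltonian_lip tH P.
have [B B0 BP] := lagrangian_bounded tH r.
have [C C0 CP] := partial_action_coercive (@ler01 R).
exists (Lam * (B + C)); first by rewrite mulr_ge0// addr_ge0.
move=> g tau I gI a b a0 ab bT gab.
have [Iadd IP] := gI.
pose delta := b - a; rewrite -/delta.
have delta0 : 0 < delta by rewrite subr_gt0.
pose v := delta^-1 *: (g b - g a).
have vr : `|v| <= r by exact: velocity_le.
rewrite /discrete_action -/v.
have quad0 : 0 <= Lam * (B + C) * delta ^+ 2.
  by rewrite mulr_ge0 ?sqr_ge0// mulr_ge0// addr_ge0.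
have [big|small] := leP (delta * B) (I a b).
  rewrite (le_trans _ big)// lerBlDr (le_trans _ (_ : delta * B <= _))// ?lerDl//.
  by rewrite ler_pM2l// (le_trans (ler_norm _))// BP.
(* Add up the coercivity with slope 1 on [a, t] and on [t, b], then use the bound [small] on the
   total action. *)
have near_a t : a <= t <= b -> `|g t - g a| <= (B + C) * delta.
  move=> /andP[at_ tb].
  have h1 := CP g tau I gI a t a0 at_ (le_trans tb bT).
  have h2 := CP g tau I gI t b (le_trans a0 at_) tb bT.
  have h3 := Iadd a t b a0 at_ tb bT.
  have h4 : 0 <= 1 * `|g b - g t| by rewrite mul1r.
  rewrite mul1r in h1; move: small; rewrite /delta; nra.
have [p pP [LE _]] := PP (g a) v vr.
have := IP a b p (H (g a) p + Lam * ((B + C) * delta)) a0 (ltW ab) bT.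
rewrite -/delta => h; have {}h : dot p (g b - g a) -
    delta * (H (g a) p + Lam * ((B + C) * delta)) <= I a b.
  apply: h => t tab; rewrite -lerBlDl (le_trans (ler_norm _))//.
  by rewrite (le_trans (LamP _ _ _ pP))// ler_wpM2l// near_a.
apply: le_trans h; rewrite LE.
have -> : g b - g a = delta *: v by rewrite scalerKV// gt_eqF.
by rewrite (dotZr p delta v) le_eqVlt; apply/orP; left; apply/eqP; ring.
Qed.

Lemma action_line x v tau (h : R) : 0 < tau ->
  (forall t, 0 <= t <= tau -> L (x + t *: v) v <= h) ->
  (action L tau (fun t => (x + t *: v)%R) <= (tau * h)%:E)%E.
Proof.
move=> tau0 Lh.
have dv t : derive1 (fun t : R => x + t *: v) t = v.
  rewrite /derive1; apply/cvg_lim => //; apply: cvg_near_cst; near=> s.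
  have s0 : s != 0 by near: s; exact: nbhs_dnbhs_neq.
  by rewrite opprD addrACA subrr add0r -scalerBl addrK scalerK.
rewrite /action; apply: (@le_trans _ _ (\int[leb]_(t in `[0%R, tau]) h%:E)%E).
  apply: le_integral_pointwise => t; rewrite /= in_itv/= => tI.
  by rewrite lee_fin dv Lh.
rewrite integral_cst//= [X in (_ * X)%E]lebesgue_measure_itv/= lte_fin tau0.
by rewrite -EFinB -EFinM subr0 mulrC.
Unshelve. all: by end_near. Qed.

Lemma abs_continuous_line x v tau : abs_continuous 0 tau (fun t => x + t *: v).
Proof.
apply: (@lipschitz_abs_continuous _ _ `|v|) => // s t _ _.
by rewrite opprD addrACA subrr add0r -scalerBl normrZ mulrC.
Qed.

Definition curve tau x y g :=
  [/\ abs_continuous 0 tau g, g 0 = x & g tau = y].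

Lemma curve_line tau x y : 0 < tau ->
  curve tau x y (fun t => x + t *: (tau^-1 *: (y - x))).
Proof.
move=> tau0; split; first exact: abs_continuous_line.
  by rewrite scale0r addr0.
by rewrite scalerA mulfV ?gt_eqF// scale1r addrC subrK.
Qed.

(** A curve of infinite action satisfies every lower bound; for the others [partial_action]
    applies. *)
Lemma action_lower tau g : 0 < tau -> abs_continuous 0 tau g ->
  forall m : R, (forall I, partial_action_of g tau I ->
    (I 0 tau)%:E = action L tau g -> m <= I 0 tau) ->
  (m%:E <= action L tau g)%E.
Proof.
move=> tau0 acg m mI; have [fin|] := ltP (action L tau g) +oo%E; last first.
  by rewrite leye_eq => /eqP ->; rewrite leey.
have [I [IE Iadd IP]] := partial_action tH tau0 acg fin.
by rewrite -IE lee_fin; exact: mI.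
Qed.

Lemma minimal_action_fin tau x y : 0 < tau ->
  ereal_inf [set action L tau g | g in [set g | [/\ abs_continuous 0 tau g, g 0 = x & g tau = y]]]
   \is a fin_num.
Proof.
move=> tau0; have [C C0 CP] := partial_action_coercive (lexx 0).
rewrite fin_numE; apply/andP; split.
  rewrite gt_eqF// (lt_le_trans (ltNyr (- C * tau)))//.
  apply: le_ereal_inf_tmp => _ [g [acg _ _] <-].
  apply: action_lower => // I gI _.
  have := CP g tau I gI 0 tau (lexx 0) (ltW tau0) (lexx tau).
  by rewrite mul0r sub0r subr0 mulNr.
pose v := tau^-1 *: (y - x).
have [B B0 BP] := lagrangian_bounded tH `|v|.
rewrite lt_eqF//; apply: le_lt_trans (ltry (tau * B)).
apply: le_trans (action_line (x := x) (v := v) tau0 _); last first.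
  by move=> t _; rewrite (le_trans (ler_norm _))// BP.
by apply: ereal_inf_lbound; exists (fun t => x + t *: v) => //; exact: curve_line.
Qed.

Lemma minimal_action_le tau x y g : 0 < tau -> curve tau x y g ->
  ((MA tau x y)%:E <= action L tau g)%E.
Proof.
move=> tau0 cg; rewrite /minimal_action fineK ?minimal_action_fin//.
by apply: ereal_inf_lbound; exists g.
Qed.

Lemma minimal_action_ge tau x y (m : R) : 0 < tau ->
  (forall g, curve tau x y g -> (m%:E <= action L tau g)%E) -> m <= MA tau x y.
Proof.
move=> tau0 mg; rewrite -lee_fin /minimal_action fineK ?minimal_action_fin//.
by apply: le_ereal_inf_tmp => _ [g cg <-]; exact: mg.
Qed.

Lemma minimal_action_coercive (K : R) : 0 <= K ->
  exists2 C : R, 0 <= C & forall tau x y, 0 < tau ->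
    K * `|y - x| - C * tau <= MA tau x y.
Proof.
move=> K0; have [C C0 CP] := partial_action_coercive K0; exists C => // tau x y tau0.
apply: minimal_action_ge => // g [acg g0 gT]; apply: action_lower => // I gI _.
by have := CP g tau I gI 0 tau (lexx 0) (ltW tau0) (lexx tau); rewrite g0 gT subr0.
Qed.

(** The source of the rate in (iii). The lower bound is [partial_action_discrete]. For the upper
    bound, along the straight line the position drifts by at most r tau, so L changes by at most B r
    tau during a time tau. *)
Lemma minimal_action_discrete_le (r : R) : 0 <= r ->
  exists2 C : R, 0 <= C & forall tau x y, 0 < tau -> `|y - x| <= r * tau ->
    `|MA tau x y - DA tau x y| <= C * tau ^+ 2.
Proof.
move=> r0; have [C1 C10 C1P] := partial_action_discrete r.
have [B B0 BP] := lagrangian_lip tH r.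
exists (Num.max C1 (B * r)); first by rewrite le_max C10.
move=> tau x y tau0 yx.
pose v := tau^-1 *: (y - x).
have vr : `|v| <= r by exact: velocity_le.
rewrite ler_norml; apply/andP; split.
  rewrite lerNl opprB lerBlDr -lerBlDl; apply: minimal_action_ge => // g [acg g0 gT].
  apply: action_lower => // I gI _.
  have := C1P g tau I gI 0 tau (lexx 0) tau0 (lexx tau).
  rewrite g0 gT subr0 => /(_ yx); apply: le_trans.
  by rewrite lerB// ler_wpM2r ?sqr_ge0// le_max lexx.
rewrite lerBlDl -lee_fin.
apply: le_trans (minimal_action_le tau0 (curve_line x y tau0)) _; rewrite -/v.
apply: (@le_trans _ _ (tau * (L x v + B * (r * tau)))%:E); last first.
  rewrite lee_fin /discrete_action -/v mulrDr lerD2l.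
  have -> : tau * (B * (r * tau)) = B * r * tau ^+ 2 by ring.
  by rewrite ler_wpM2r ?sqr_ge0// le_max lexx orbT.
apply: action_line => // t /andP[t0 tT].
have := BP (x + t *: v) x v v vr vr.
rewrite subrr normr0 addr0 [x + _]addrC addrK normrZ (ger0_norm t0) => h.
rewrite -lerBlDl (le_trans (ler_norm _))// (le_trans h)// ler_wpM2l//.
by rewrite mulrC ler_pM.
Qed.

End MinimalAction.

(** * The discrete equation *)

Lemma locally_lipschitz_continuous (R : realType) (W : normedModType R) (f : W -> R) :
  (forall x, exists2 C : R, 0 <= C &
     forall y, `|x - y| <= 1 -> `|f x - f y| <= C * `|x - y|) -> continuous f.
Proof.
move=> fC x; have [C C0 CP] := fC x.
have C1 : 0 < C + 1 by rewrite ltr_wpDl.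
apply/cvgrPdist_le => /= e e0; near=> y.
have xy1 : `|x - y| <= 1.
  by near: y; apply: cvgr_dist_le; [exact: cvg_id|exact: ltr01].
have xye : `|x - y| <= e / (C + 1).
  by near: y; apply: cvgr_dist_le; [exact: cvg_id|rewrite divr_gt0].
rewrite (le_trans (CP y xy1))// (le_trans (_ : _ <= (C + 1) * `|x - y|))//.
  by rewrite ler_wpM2r// lerDl.
by rewrite mulrC -ler_pdivlMr.
Unshelve. all: by end_near. Qed.

(** * One step of the discrete operator, at fixed tau *)

Section LaxOleinik.
Context {R : realType} {d : nat}.
Local Notation V := 'rV[R]_d.
Context (H : V -> V -> R) (tH : tonelli H).
Local Notation L := (lagrangian H).
Local Notation DA := (discrete_action L).
Implicit Types (tau : R) (x y : V) (u v w : V -> R).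

Lemma discrete_action_periodic tau x y (k : 'rV[int]_d) :
  DA tau (x + map_mx intr k) (y + map_mx intr k) = DA tau x y.
Proof.
by rewrite /discrete_action (lagrangian_periodic tH) opprD addrACA subrr addr0.
Qed.

Lemma discrete_action_bounded (r : R) : exists2 B : R, 0 <= B &
  forall tau x y, 0 < tau -> `|y - x| <= r * tau -> DA tau x y <= tau * B.
Proof.
have [B B0 BP] := lagrangian_bounded tH r; exists B => // tau x y tau0 yx.
by rewrite /discrete_action ler_pM2l// (le_trans (ler_norm _))// BP// velocity_le.
Qed.

Lemma discrete_action_coercive (K : R) : 0 <= K -> exists2 C : R, 0 <= C &
  forall tau x y, 0 < tau -> K * `|y - x| - C * tau <= DA tau x y.
Proof.
move=> K0; have [C C0 CP] := lagrangian_superlinear tH K0.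
exists C => // tau x y tau0; rewrite /discrete_action.
have := CP x (tau^-1 *: (y - x)); rewrite normrZ ger0_norm ?invr_ge0 ?(ltW tau0)//.
rewrite -(ler_pM2l tau0); apply: le_trans.
by rewrite mulrBr mulrCA mulVKf ?gt_eqF// [C * _]mulrC.
Qed.

Lemma discrete_action_lip (r : R) : exists2 B : R, 0 <= B &
  forall tau x x' y y', 0 < tau -> `|y - x| <= r * tau -> `|y' - x'| <= r * tau ->
  `|DA tau x y - DA tau x' y'| <= B * (tau * `|x - x'| + `|(y - x) - (y' - x')|).
Proof.
have [B B0 BP] := lagrangian_lip tH r; exists B => // tau x x' y y' tau0 yx yx'.
rewrite /discrete_action -mulrBr normrM (gtr0_norm tau0).
rewrite (le_trans (ler_wpM2l (ltW tau0) (BP _ _ _ _ _ _)))//; [exact: velocity_le..|].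
rewrite -scalerBr normrZ ger0_norm ?invr_ge0 ?(ltW tau0)//.
by rewrite mulrCA mulrDr mulVKf ?gt_eqF.
Qed.

(* One step of the discrete Lax-Oleinik semigroup. *)
Definition step tau v w :=
  forall y, is_min (range (fun x => v x + DA tau x y)) (w y).

Lemma step_le tau v w x y : step tau v w -> w y <= v x + DA tau x y.
Proof. by move=> /(_ y)[_]; apply; exists x. Qed.

Lemma step_argmin tau v w y : step tau v w -> exists x, w y = v x + DA tau x y.
Proof. by move=> /(_ y)[[x _ <-] _]; exists x. Qed.

Lemma step_mono tau v w v' w' (c : R) : step tau v w -> step tau v' w' ->
  (forall x, v x <= v' x + c) -> forall y, w y <= w' y + c.
Proof.
move=> vw vw' vv' y; have [x ->] := step_argmin y vw'.
by rewrite (le_trans (step_le x y vw))// addrAC lerD2r.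
Qed.

Lemma step_periodic tau v w : periodic v -> step tau v w -> periodic w.
Proof.
move=> pv vw; suff le y k : w (y + map_mx intr k) <= w y.
  move=> y k; apply/eqP; rewrite eq_le le/=.
  have := le (y + map_mx intr k) (- k).
  by rewrite -addrA -map_mxD subrr map_mx0 addr0.
have [x ->] := step_argmin y vw.
rewrite -(pv x k) -(discrete_action_periodic tau x y k); exact: step_le.
Qed.

Lemma step_shift tau v w (c : R) : step tau v w ->
  step tau (fun x => v x + c) (fun x => w x + c).
Proof.
move=> vw y; split; last by move=> _ [x _ <-]; rewrite addrAC lerD2r; exact: step_le.
by have [x ->] := step_argmin y vw; exists x => //; rewrite addrAC.
Qed.

Lemma periodic_bounded v : continuous v -> periodic v ->
  exists2 M : R, 0 <= M & forall x, `|v x| <= M.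
Proof.
move=> cv pv.
have cnv : continuous (fun x => - `|v x|).
  move=> x; have c1 : {for x, continuous (fun y => `|v y|)}.
    by apply: continuous_comp; [exact: cv|exact: norm_continuous].
  exact: (continuousN c1).
have [|m mP] := periodic_min cnv; first by move=> x k; rewrite pv.
by exists `|v m| => // x; rewrite -lerN2.
Qed.

Lemma discrete_action_continuous tau y : 0 < tau -> continuous (fun x => DA tau x y).
Proof.
move=> tau0; apply: locally_lipschitz_continuous => x.
have [B B0 BP] := discrete_action_lip ((`|y - x| + 1) / tau).
exists (B * (tau + 1)) => [|z xz]; first by rewrite mulr_ge0// addr_ge0// (ltW tau0).
rewrite (le_trans (BP tau x z y y tau0 _ _))//.
- by rewrite divfK ?gt_eqF// lerDl.
- rewrite divfK ?gt_eqF//; have -> : y - z = (y - x) + (x - z) by rewrite addrA subrK.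
  by rewrite (le_trans (ler_normD _ _))// lerD2l.
have -> : y - x - (y - z) = - (x - z) by rewrite opprB addrC subrKA opprB.
by rewrite normrN -mulrA ler_wpM2l// mulrDl mul1r.
Qed.

Lemma step_exists tau v : 0 < tau -> continuous v -> periodic v ->
  exists w, step tau v w.
Proof.
move=> tau0 cv pv.
suff /choice[m mP] y : exists m, forall x, v m + DA tau m y <= v x + DA tau x y.
  exists (fun y => v (m y) + DA tau (m y) y) => y; split; first by exists (m y).
  by move=> _ [x _ <-]; exact: mP.
have [M M0 MP] := periodic_bounded cv pv.
have [C C0 CP] := discrete_action_coercive (@ler01 R).
have [B B0 BP] := discrete_action_bounded 0.
(* Beyond the distance [r] from [y], coercivity makes a point more expensive than staying at [y]. *)
pose r := 2 * M + C * tau + tau * B.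
have r0 : 0 <= r by rewrite /r !addr_ge0 ?mulr_ge0 ?(ltW tau0).
pose f x := v x + DA tau x y.
have cf : continuous f.
  have c2 := @discrete_action_continuous tau y tau0; move=> x; exact: (continuousD (cv x) (c2 x)).
have [|m _ mP] := compact_EVT_min _ (@closed_ball_compact R d (`|y| + r))
   (continuous_subspaceT cf).
  by exists y; rewrite /= lerDl.
exists m => x; have [xr|xr] := leP `|x| (`|y| + r); first by apply: mP; rewrite inE.
apply: (@le_trans _ _ (f y)); first by apply: mP; rewrite inE/= lerDl.
have xy : r < `|y - x|.
  have := ler_normB y (y - x); rewrite opprB addrC subrK; lra.
have h1 : DA tau y y <= tau * B by apply: BP => //; rewrite subrr normr0 mul0r.
have h2 := CP tau x y tau0; rewrite mul1r in h2.
have := MP x; have := MP y; rewrite !ler_norml => /andP[_ h3] /andP[h4 _].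
rewrite /f; rewrite /r in xy; lra.
Qed.

(** By periodicity the minimiser for [y'] can be translated to within distance 1 of [y], that is, to
    a velocity at most 1 / tau. Hence [K] does not depend on [v]. *)
Lemma step_osc tau : 0 < tau -> exists2 K : R, 0 <= K &
  forall v w, periodic v -> step tau v w -> forall y y', w y <= w y' + K.
Proof.
move=> tau0; have [C C0 CP] := discrete_action_coercive (lexx 0).
have [B B0 BP] := discrete_action_bounded tau^-1.
exists (tau * B + C * tau); first by rewrite addr_ge0 ?mulr_ge0// (ltW tau0).
move=> v w pv vw y y'; have [x ->] := step_argmin y' vw.
have [k xk] := unit_cell (x - y).
have h1 := step_le (x + map_mx intr k) y vw; rewrite pv in h1.
have h2 : DA tau (x + map_mx intr k) y <= tau * B.
  by apply: BP => //; rewrite mulVf ?gt_eqF// distrC addrAC.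
have := CP tau x y' tau0; rewrite mul0r; lra.
Qed.

(** The minimiser for [y'] is a competitor for a nearby [y]; distant points are handled by the
    oscillation. The constant depends on [v] only through its oscillation, so it serves all
    iterates. *)
Lemma step_lip tau (K : R) : 0 < tau -> exists2 C : R, 0 <= C &
  forall v w, periodic v -> (forall x x', v x <= v x' + K) -> step tau v w ->
  forall y y', `|w y - w y'| <= C * `|y - y'|.
Proof.
move=> tau0; have [K' K'0 K'P] := step_osc tau0.
have [C C0 CP] := discrete_action_coercive (@ler01 R).
have [B B0 BP] := discrete_action_bounded 0.
(* Minimisers for [y'] lie within r - 1 of it; the extra 1 leaves room for [y]. *)
pose r := K + tau * B + C * tau + 1.
have [A A0 AP] := discrete_action_lip (r / tau).
exists (Num.max A K'); first by rewrite le_max A0.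
move=> v w pv oscv vw.
suff half y y' : w y - w y' <= Num.max A K' * `|y - y'|.
  by move=> y y'; rewrite ler_norml half andbT lerNl opprB distrC half.
have [yy1|yy1] := leP `|y - y'| 1; last first.
  have h1 := K'P v w pv vw y y'.
  rewrite (le_trans (_ : _ <= K' * `|y - y'|))//.
    by rewrite lerBlDl (le_trans h1)// lerD2l ler_peMr// ltW.
  by rewrite ler_wpM2r// le_max lexx orbT.
have [x wE] := step_argmin y' vw.
have h1 := step_le y' y' vw; have h2 : DA tau y' y' <= tau * B.
  by apply: BP => //; rewrite subrr normr0 mul0r.
have h3 := CP tau x y' tau0; rewrite mul1r in h3; have h4 := oscv y' x.
have y'x : `|y' - x| <= r - 1 by rewrite /r; lra.
have yx : `|y - x| <= r.
  have -> : y - x = (y - y') + (y' - x) by rewrite addrA subrK.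
  rewrite (le_trans (ler_normD _ _))//; lra.
have := AP tau x x y y' tau0.
rewrite divfK ?gt_eqF// subrr normr0 mulr0 add0r => /(_ yx).
have -> : y - x - (y' - x) = y - y' by rewrite opprB addrA subrK.
have y'x' : `|y' - x| <= r by lra.
move=> /(_ y'x') h5; rewrite wE lerBlDl (le_trans (step_le x y vw))// -addrA lerD2l.
rewrite -lerBlDl (le_trans (ler_norm _))// (le_trans h5)// ler_wpM2r//.
by rewrite le_max lexx.
Qed.

End LaxOleinik.

(** Along such a [U] every bounded sequence converges, so limits at all points of space and at all
    times exist at once, in place of diagonal extractions. *)
Lemma ultrafilter_infty : exists2 U : set_system nat, UltraFilter U & \oo `<=` U.
Proof. by have [U [UU leU]] := ultraFilterLemma eventually_filter; exists U. Qed.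

Lemma compact_ultra_cvg (T : topologicalType) (K : set T) (I : Type)
    (U : set_system I) (f : I -> T) : UltraFilter U -> compact K ->
  (\forall i \near U, K (f i)) -> exists2 l, K l & f @ U --> l.
Proof.
move=> UU cK fK; have PU : ProperFilter U := ultra_proper.
have [l [Kl cl]] := cK (f @ U) _ fK.
exists l => // A lA.
have [//|UA] := in_ultra_setVsetC (f @^-1` A) UU.
by have [x [nAx Ax]] := cl (~` A) A UA lA.
Qed.

Lemma norm_bounded_ultra_cvg (R : realType) (d : nat) (I : Type) (U : set_system I)
    (z : I -> 'rV[R]_d) (M : R) : UltraFilter U -> (forall i, `|z i| <= M) ->
  exists2 l, `|l| <= M & z @ U --> l.
Proof.
move=> UU zM; have PU : ProperFilter U := ultra_proper.
by have [|l] := compact_ultra_cvg UU (@closed_ball_compact R d M) (f := z);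
  [exact: nearW|exists l].
Qed.

Lemma bounded_ultra_cvg (R : realType) (I : Type) (U : set_system I)
    (a : I -> R) (M : R) : UltraFilter U -> (forall i, `|a i| <= M) ->
  exists2 l, `|l| <= M & a @ U --> l.
Proof.
move=> UU aM; have PU : ProperFilter U := ultra_proper.
have [|l lM al] := compact_ultra_cvg UU (@segment_compact R (- M) M) (f := a).
  by apply: nearW => i; rewrite /= in_itv/= -ler_norml.
by exists l => //; move: lM; rewrite /= in_itv/= -ler_norml.
Qed.

(** A two-sided version of Fekete's lemma. Comparing both with a (m n) gives (a m - K) / m <= (a n +
    K) / n for all positive m and n; [c] is the supremum of the left-hand sides. *)
Lemma quasi_additive (R : realType) (a : nat -> R) (K : R) :
  (forall m n, `|a (m + n)%N - a m - a n| <= K) ->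
  exists c : R, forall n, `|a n - n%:R * c| <= K.
Proof.
move=> aK.
have ub m n : a (m + n)%N <= a m + a n + K.
  have := aK m n; rewrite ler_norml => /andP[_]; lra.
have lb m n : a m + a n - K <= a (m + n)%N.
  have := aK m n; rewrite ler_norml => /andP[]; lra.
have a0 : `|a 0%N| <= K by have := aK 0%N 0%N; rewrite addn0 subrr sub0r normrN.
have mulb m n : m.+1%:R * (a n - K) <= a (m.+1 * n)%N - K /\
                a (m.+1 * n)%N + K <= m.+1%:R * (a n + K).
  elim: m => [|m [IH1 IH2]]; first by rewrite !mul1r mul1n.
  have h1 := lb n (m.+1 * n)%N; have h2 := ub n (m.+1 * n)%N.
  by rewrite (mulSn m.+1) -[m.+2]add1n natrD !mulrDl !mul1r; split; lra.
have le m n : (a m.+1 - K) / m.+1%:R <= (a n.+1 + K) / n.+1%:R.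
  rewrite ler_pdivrMr// mulrAC ler_pdivlMr// mulrC [leRHS]mulrC.
  have [h1 _] := mulb n m.+1; have [_ h2] := mulb m n.+1.
  rewrite (le_trans h1)// (le_trans _ h2)// mulnC.
  have K0 : 0 <= K := le_trans (normr_ge0 _) a0; lra.
pose A := range (fun m => (a m.+1 - K) / m.+1%:R).
have A0 : A !=set0 by exists ((a 1%N - K) / 1%:R); exists 0%N.
have Aub n : ubound A ((a n.+1 + K) / n.+1%:R) by move=> _ [m _ <-]; exact: le.
exists (sup A) => -[|n]; first by rewrite mul0r subr0.
have h1 : (a n.+1 - K) / n.+1%:R <= sup A.
  by apply: ub_le_sup; [exists ((a 1%N + K) / 1%:R); exact: Aub|exists n].
have h2 := ge_sup A0 (Aub n).
rewrite ler_pdivrMr// mulrC in h1; rewrite ler_pdivlMr// mulrC in h2.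
by rewrite ler_norml; apply/andP; split; lra.
Qed.

(** * Solutions of (E1) and estimates uniform in tau *)

Section DiscreteSolution.
Context {R : realType} {d : nat}.
Local Notation V := 'rV[R]_d.
Context (H : V -> V -> R) (tH : tonelli H).
Local Notation L := (lagrangian H).
Local Notation DA := (discrete_action L).
Local Notation step := (step H).
Implicit Types (tau c : R) (x y : V) (u v w : V -> R).

Lemma step_iter tau : 0 < tau -> exists v : nat -> V -> R,
  v 0%N = cst 0 /\ forall n, periodic (v n) /\ step tau (v n) (v n.+1).
Proof.
move=> tau0; pose P v := continuous v /\ periodic v.
have stepP v : exists w, P v -> P w /\ step tau v w.
  case: (pselect (P v)) => [[cv pv]|nP]; last by exists v.
  have [w vw] := step_exists tH tau0 cv pv; exists w => _; split=> //.
  split; last exact: (step_periodic tH pv vw).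
  have [M M0 MP] := periodic_bounded cv pv.
  have [A A0 AP] := step_lip tH (2 * M) tau0.
  apply: (@lipschitz_continuous _ _ _ A) => y y'; apply: (AP v w) => // x x'.
  have := MP x; have := MP x'; rewrite !ler_norml => /andP[? ?] /andP[? ?]; lra.
have [T TP] := choice stepP.
exists (fun n => iter n T (cst 0)); split=> // n.
suff Pn : P (iter n T (cst 0)) by split; [case: Pn|case: (TP _ Pn)].
elim: n => [|n IH]; last by case: (TP _ IH).
split=> //; exact: cst_continuous.
Qed.

Lemma step_comparison tau (v v' : nat -> V -> R) (c : R) :
  (forall n, step tau (v n) (v n.+1)) -> (forall n, step tau (v' n) (v' n.+1)) ->
  (forall x, v 0%N x <= v' 0%N x + c) -> forall n x, v n x <= v' n x + c.
Proof.
by move=> sv sv' v0; elim=> [//|n IH]; apply: (step_mono (sv n) (sv' n)).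
Qed.

(** A supremum of infima need not commute with the minimum over x. The inequality [lower] follows by
    monotonicity; attainment needs compactness of the minimisers for the tail infima [uN N]. *)
Lemma step_liminf tau c (M C : R) (w : nat -> V -> R) : 0 < tau ->
  (forall n, periodic (w n)) -> (forall n x, `|w n x| <= M) ->
  (forall n x y, `|w n x - w n y| <= C * `|x - y|) ->
  (forall n, step tau (w n) (fun y => w n.+1 y + c)) ->
  exists u, sol_discrete L tau c u.
Proof.
move=> tau0 pw wM wC sw.
have wlip n x y : w n x <= w n y + C * `|x - y|.
  by have := wC n x y; rewrite ler_norml => /andP[_]; lra.
pose A N x := [set w n x | n in [set n | (N <= n)%N]].
have A0 N x : A N x !=set0 by exists (w N x), N => /=.
pose uN N x := inf (A N x).
have uN_le N n x : (N <= n)%N -> uN N x <= w n x.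
  move=> Nn; apply: ge_inf; last by exists n.
  by exists (- M) => _ [m _ <-]; have := wM m x; rewrite ler_norml => /andP[].
have le_uN N x (m : R) : (forall n, (N <= n)%N -> m <= w n x) -> m <= uN N x.
  by move=> mP; apply: lb_le_inf => // _ [n Nn <-]; exact: mP.
have uN_lip N x y : uN N x <= uN N y + C * `|x - y|.
  rewrite -lerBlDr; apply/le_uN => n Nn.
  by rewrite lerBlDr (le_trans (uN_le N n x Nn)).
have uNM N x : uN N x <= M.
  by rewrite (le_trans (uN_le N N x _))//; have := wM N x; rewrite ler_norml => /andP[].
pose u x := sup (range (uN^~ x)).
have u_ge N x : uN N x <= u x.
  by apply: ub_le_sup; [exists M => _ [m _ <-]|exists N].
have u_le x (m : R) : (forall N, uN N x <= m) -> u x <= m.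
  by move=> mP; apply: ge_sup; [exists (uN 0%N x), 0%N|move=> _ [N _ <-]].
have cont f : (forall x y, f x <= f y + C * `|x - y|) -> continuous f.
  move=> fC; apply: (@lipschitz_continuous _ _ _ C) => x y.
  have := fC x y; have := fC y x; rewrite [`|y - x|]distrC ler_norml => h1 h2.
  by apply/andP; split; lra.
have puN N : periodic (uN N).
  move=> x k; rewrite /uN; congr inf.
  by apply: eq_imagel => n _; rewrite pw.
exists u; split.
- apply: cont => x y; apply: u_le => N.
  by rewrite (le_trans (uN_lip N x y))// lerD2r.
- by move=> x k; rewrite /u; congr sup; apply: eq_imagel => n _; rewrite puN.
move=> y; have lower x : u y + c <= u x + DA tau x y.
  rewrite -lerBrDr; apply/u_le => N.
  rewrite lerBrDr (le_trans (_ : _ <= uN N x + DA tau x y))//; last by rewrite lerD2r.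
  rewrite -lerBlDr; apply/le_uN => n Nn.
  rewrite lerBlDr; apply: le_trans (step_le x y (sw n)); rewrite lerD2r.
  rewrite (le_trans (_ : _ <= uN N.+1 y)) ?uN_le//.
  by apply/le_uN => k Nk; apply: uN_le; exact: ltnW.
split; last by move=> _ [x _ <-].
(* Since [uN N] lies below every [w n] with N <= n, its image under one step lies below the
   corresponding w (n + 1) + c, hence below uN (N + 1) + c. *)
have xP N : exists x, uN N x + DA tau x y <= u y + c.
  have [w' sw'] := step_exists tH tau0 (cont _ (uN_lip N)) (puN N).
  have [x wx] := step_argmin y sw'; exists x; rewrite -wx.
  rewrite -lerBlDr (le_trans _ (u_ge N.+1 y))//; apply/le_uN => -[//|n] Nn.
  rewrite lerBlDr -[leRHS]addr0; apply: (step_mono sw' (sw n)) => z.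
  by rewrite addr0 uN_le.
have [x xN] := choice xP.
have [U UU leU] := ultrafilter_infty; have PU : ProperFilter U := ultra_proper.
have [D D0 DP] := discrete_action_coercive tH (@ler01 R).
have uNm N z : - M <= uN N z.
  by apply/le_uN => n _; have := wM n z; rewrite ler_norml => /andP[].
have [|z _ xz] := norm_bounded_ultra_cvg (z := x) (M := `|y| + (u y + c + M + D * tau)) UU.
  move=> N; have := ler_normB y (y - x N); rewrite opprB addrC subrK.
  have := DP tau (x N) y tau0; have := xN N; have := uNm N (x N); rewrite mul1r; lra.
have cDA := @discrete_action_continuous R d H tH tau y tau0.
(* [z] is a limit of the points [x i]. For fixed [N] and i >= N one has [uN N <= uN i], so the bound
   at [x i] passes to the limit; then take the supremum over [N]. *)
suff zP N : uN N z + DA tau z y <= u y + c.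
  exists z => //; apply/eqP; rewrite eq_le; apply/andP; split.
    by rewrite -lerBrDr; apply/u_le => N; rewrite lerBrDr.
  exact: lower.
have cf : continuous (fun p => uN N p + DA tau p y).
  by move=> p; exact: (continuousD (cont _ (uN_lip N) p) (cDA p)).
have : (uN N \o x) i + DA tau (x i) y @[i --> U] --> uN N z + DA tau z y.
  exact: (continuous_cvg _ (cf z) xz).
move=> /cvgr_to_le; apply; apply: leU; near=> i.
apply: le_trans (xN i); rewrite lerD2r; apply/le_uN => k ik; apply: uN_le.
apply: leq_trans ik; near: i; exact: nbhs_infty_ge.
Unshelve. all: by end_near. Qed.

Lemma sol_discrete_exists tau : 0 < tau -> exists c u, sol_discrete L tau c u.
Proof.
move=> tau0; have [v [v0 vP]] := step_iter tau0.
have sv n : step tau (v n) (v n.+1) by have [] := vP n.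
have [K K0 KP] := step_osc tH tau0; have [C C0 CP] := step_lip tH K tau0.
have osc n x x' : v n x <= v n x' + K.
  by case: n => [|n]; [rewrite v0 lerDl|have [pv _] := vP n; exact: (KP _ _ pv (sv n))].
(* [v m] differs from the constant [v m 0] by at most [K], and steps are monotone and commute with
   constants. So the iterates from [v m] stay within [K] of those from 0 shifted by [v m 0]. *)
have [|c cP] := @quasi_additive R (fun n => v n 0) K.
  move=> m n; pose a := v m 0.
  have h1 := @step_comparison tau (fun k => v (m + k)%N) v (a + K) _ sv _ n 0.
  have h2 := @step_comparison tau v (fun k => v (m + k)%N) (K - a) sv _ _ n 0.
  have sm k : step tau (v (m + k)%N) (v (m + k.+1)%N) by rewrite addnS.
  have {}h1 : v (m + n)%N 0 <= v n 0 + (a + K).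
    by apply: h1 => // x; rewrite addn0 v0 /cst/= add0r; exact: osc.
  have {}h2 : v n 0 <= v (m + n)%N 0 + (K - a).
    apply: h2 => // x; rewrite addn0 v0 /cst/=; have := osc m 0 x; rewrite /a; lra.
  by rewrite ler_norml; apply/andP; split; rewrite /a in h1 h2; lra.
exists c; apply: (@step_liminf tau c (2 * K) C (fun n x => v n x - n%:R * c)) => //.
- by move=> n x k; have [-> _] := vP n.
- move=> n x; have := cP n; have := osc n x 0; have := osc n 0 x.
  rewrite !ler_norml => h1 h2 /andP[h3 h4]; apply/andP; split; lra.
- move=> n x y; rewrite opprB addrA subrK; case: n => [|n].
    by rewrite v0 /cst/= subrr normr0 mulr_ge0.
  by have [pv _] := vP n; exact: (CP _ _ pv (osc n) (sv n)).
- move=> n; have := step_shift (- (n%:R * c)) (sv n).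
  congr (step tau _ _); apply: funext => x; rewrite -natr1 mulrDl mul1r; lra.
Qed.

Lemma step_chain tau (v : nat -> V -> R) k y : (forall n, step tau (v n) (v n.+1)) ->
  exists z : nat -> V, z k = y /\ forall j, (j < k)%N ->
    v j.+1 (z j.+1) = v j (z j) + DA tau (z j) (z j.+1).
Proof.
move=> sv; elim: k y => [|k IH] y; first by exists (cst y).
have [x vx] := step_argmin y (sv k); have [z [zk zP]] := IH x.
exists (fun j => if (j <= k)%N then z j else y); split; first by rewrite ltnn.
move=> j; rewrite ltnS leq_eqVlt => /predU1P[->|jk].
  by rewrite eqxx ltnn zk.
by rewrite jk orbT; exact: zP.
Qed.

(** Turns a solution into a sequence of steps, so that estimates for iterates apply to it. *)
Lemma sol_step tau c u : sol_discrete L tau c u ->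
  forall n, step tau (fun x => u x + n%:R * c) (fun x => u x + n.+1%:R * c).
Proof.
move=> [_ _ su] n; have := step_shift (n%:R * c) su.
by congr (step tau _ _); apply: funext => x; rewrite -natr1 mulrDl mul1r -addrA [c + _]addrC.
Qed.

Lemma sum_discrete_action_bounds tau c u (M : R) k : sol_discrete L tau c u ->
  (forall x, `|u x| <= M) ->
  (forall z, k%:R * c - 2 * M <= \sum_(0 <= i < k) DA tau (z i) (z i.+1)) /\
  exists z, \sum_(0 <= i < k) DA tau (z i) (z i.+1) <= k%:R * c + 2 * M.
Proof.
move=> su uM; have st := sol_step su.
have osc x y : u x - u y <= 2 * M.
  have := uM x; have := uM y; rewrite !ler_norml => /andP[? ?] /andP[? ?]; lra.
split=> [z|].
  suff h : u (z k) + k%:R * c <= u (z 0%N) + \sum_(0 <= i < k) DA tau (z i) (z i.+1).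
    have := osc (z 0%N) (z k); lra.
  elim: k => [|k IH]; first by rewrite big_geq// mul0r.
  rewrite big_nat_recr//=; have := step_le (z k) (z k.+1) (st k); lra.
have [z [_ zP]] := step_chain k 0 st; exists z.
have osck := osc (z k) (z 0%N); suff h j : (j <= k)%N ->
    u (z j) + j%:R * c = u (z 0%N) + \sum_(0 <= i < j) DA tau (z i) (z i.+1).
  by have := h k (leqnn k); lra.
elim: j => [|j IH] jk; first by rewrite big_geq// mul0r.
by rewrite big_nat_recr//= zP// IH 1?ltnW// addrA.
Qed.

(** The left-hand side does not involve [u], so this limit also yields the uniqueness of [c]. *)
Lemma inf_mean_discrete_action tau c u : sol_discrete L tau c u ->
  (fun k => inf (range (mean_discrete_action L tau k))) @ \oo --> c.
Proof.
move=> su; have [M M0 uM] := let: And3 cu pu _ := su in periodic_bounded cu pu.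
apply/cvgrPdist_le => /= e e0; near=> k.
have k0 : 0 < k%:R :> R by rewrite ltr0n; near: k; exact: nbhs_infty_gt.
have ke : 2 * M <= k%:R * e.
  rewrite -ler_pdivrMr//; near: k; exact: nbhs_infty_ger.
have [lb [z zP]] := sum_discrete_action_bounds k su uM.
have h1 : c - e <= inf (range (mean_discrete_action L tau k)).
  apply: lb_le_inf; first by exists (mean_discrete_action L tau k z), z.
  move=> _ [z' _ <-]; rewrite /mean_discrete_action ler_pdivlMl//.
  have := lb z'; rewrite mulrBr; lra.
have h2 : inf (range (mean_discrete_action L tau k)) <= c + e.
  apply: (@le_trans _ _ (mean_discrete_action L tau k z)).
    apply: ge_inf; last by exists z.
    exists (c - e) => _ [z' _ <-]; rewrite /mean_discrete_action ler_pdivlMl//.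
    by have := lb z'; rewrite mulrBr; lra.
  rewrite /mean_discrete_action ler_pdivrMl// mulrDr; lra.
rewrite ler_norml; apply/andP; split; lra.
Unshelve. all: by end_near. Qed.

(** Evaluate the equation at a minimum of [u]: staying put bounds [c] from above, and the lower
    bound of L bounds it from below. *)
Lemma discrete_constant_bounded : exists2 C : R, 0 <= C &
  forall tau c u, 0 < tau -> sol_discrete L tau c u -> `|c| <= C * tau.
Proof.
have [B B0 BP] := discrete_action_bounded tH 0.
have [C C0 CP] := discrete_action_coercive tH (lexx 0).
exists (B + C) => [|tau c u tau0 [cu pu su]]; first exact: addr_ge0.
have [m mP] := periodic_min cu pu; have [x mx] := step_argmin m su.
have h1 := step_le m m su.
have h2 : DA tau m m <= tau * B by apply: BP => //; rewrite subrr normr0 mul0r.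
have h3 := CP tau x m tau0; rewrite mul0r in h3; have h4 := mP x.
have h5 : 0 <= C * tau by rewrite mulr_ge0// ltW.
have h6 : 0 <= B * tau by rewrite mulr_ge0// ltW.
rewrite ler_norml mulrDl; apply/andP; split; lra.
Qed.

(* The displacement is split into steps of velocity at most 1. *)
Lemma step_lip_scale (C : R) : exists2 C' : R, 0 <= C' &
  forall tau (v : nat -> V -> R), 0 < tau -> (forall n, step tau (v n) (v n.+1)) ->
  (forall n x, `|v n.+1 x - v n x| <= C * tau) ->
  forall n x y, `|v n x - v n y| <= C' * (`|x - y| + tau).
Proof.
have [B B0 BP] := discrete_action_bounded tH 1.
exists (B + `|C|) => [|tau v tau0 sv vC n]; first exact: addr_ge0.
suff half x y : v n x - v n y <= (B + `|C|) * (`|x - y| + tau).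
  by move=> x y; rewrite ler_norml half andbT lerNl opprB distrC half.
(* Enough steps for a velocity at most 1; rounding up costs the additive [tau] of the statement. *)
pose m := (Num.truncn (`|x - y| / tau)).+1.
have m_lt : `|x - y| / tau < m%:R by rewrite truncnS_gt.
have m_le : m.-1%:R <= `|x - y| / tau by rewrite truncn_le// divr_ge0// ltW.
have m0 : 0 < m%:R :> R by rewrite ltr0n.
have mtau : m%:R * tau <= `|x - y| + tau.
  by move: m_le; rewrite ler_pdivlMr// -natr1 mulrDl mul1r lerD2r.
pose z j := y + (j%:R / m%:R) *: (x - y).
have zS j : DA tau (z j) (z j.+1) <= tau * B.
  apply: BP => //; rewrite /z opprD addrACA subrr add0r -scalerBl -mulrBl -natr1.
  rewrite addrC addKr mul1r normrZ mul1r ger0_norm ?invr_ge0 ?(ltW m0)//.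
  by rewrite ler_pdivrMl// -ler_pdivrMr// ltW.
have down j : v (n + j)%N (z j) <= v n y + j%:R * (tau * B).
  elim: j => [|j IH]; first by rewrite addn0 /z !mul0r scale0r !addr0.
  have := step_le (z j) (z j.+1) (sv (n + j)%N); have := zS j.
  rewrite addnS -natr1 mulrDl mul1r; lra.
(* Moving from [y] to [x] also advances the index; the index is brought back at [x], at a cost C tau
   per step. *)
have up j : v n x <= v (n + j)%N x + j%:R * (`|C| * tau).
  elim: j => [|j IH]; first by rewrite addn0 mul0r addr0.
  have := vC (n + j)%N x; rewrite ler_norml => /andP[h _].
  have : C * tau <= `|C| * tau by rewrite ler_wpM2r ?ler_norm// ltW.
  rewrite addnS -natr1 mulrDl mul1r; lra.
have zm : z m = x by rewrite /z divff ?gt_eqF// scale1r addrC subrK.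
have := down m; have := up m; rewrite zm.
have : (B + `|C|) * (m%:R * tau) <= (B + `|C|) * (`|x - y| + tau).
  by rewrite ler_wpM2l// addr_ge0.
lra.
Qed.

(** Coercivity with slope C + 1 beats the Lipschitz constant [C] by one unit, which is left to
    control the displacement. *)
Lemma step_speed (C : R) : 0 <= C -> exists2 r : R, 0 <= r &
  forall tau (v w : V -> R) x y, 0 < tau ->
  (forall x y, `|v x - v y| <= C * (`|x - y| + tau)) ->
  (forall x, w x <= v x + C * tau) -> w y = v x + DA tau x y ->
  `|y - x| <= r * tau.
Proof.
move=> C0; have [D D0 DP] := discrete_action_coercive tH (addr_ge0 C0 (@ler01 R)).
exists (C + C + D) => [|tau v w x y tau0 vC wv wE]; first by rewrite !addr_ge0.
have := vC y x; rewrite ler_norml => /andP[_]; have := wv y.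
have := DP tau x y tau0; rewrite wE !mulrDl mulrDr mul1r; lra.
Qed.

Lemma sol_discrete_lip : exists2 C : R, 0 <= C &
  forall tau c u, 0 < tau -> sol_discrete L tau c u ->
  (forall x y, `|u x - u y| <= C * `|x - y|) /\
  (forall x y, u y + c = u x + DA tau x y -> `|y - x| <= C * tau).
Proof.
have [C0 C00 C0P] := discrete_constant_bounded.
have [C1 C10 C1P] := step_lip_scale C0.
have [r r0 rP] := step_speed (addr_ge0 C00 C10).
have [B B0 BP] := discrete_action_lip tH (r + 1).
exists (2 * C1 + B + r) => [|tau c u tau0 su]; first by rewrite !addr_ge0// mulr_ge0.
have cC := C0P _ _ _ tau0 su; have st := sol_step su.
have large x y : `|u x - u y| <= C1 * (`|x - y| + tau).
  have := C1P tau _ tau0 st _ 0%N x y; rewrite mul0r !addr0; apply => n z.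
  by rewrite -natr1 mulrDl mul1r opprD addrACA subrr add0r addrAC subrr add0r.
have [cu pu min] := su.
have speed x y : u y + c = u x + DA tau x y -> `|y - x| <= r * tau.
  apply: (rP tau u (fun z => u z + c) x y tau0) => [x' y'|x'].
    rewrite (le_trans (large x' y'))// ler_wpM2r ?lerDr// addr_ge0// ltW//.
  rewrite lerD2l (le_trans (ler_norm c))// (le_trans cC)// ler_wpM2r ?lerDl//.
  exact: ltW.
split=> [|x y /speed /le_trans]; last first.
  by apply; rewrite ler_wpM2r ?(ltW tau0)// lerDr addr_ge0// mulr_ge0.
suff half x y : u x - u y <= (2 * C1 + B + r) * `|x - y|.
  by move=> x y; rewrite ler_norml half andbT lerNl opprB distrC half.
(* At distances at least [tau], the error in [large] is absorbed by doubling [C1]. Below, [x] reuses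
   the minimiser [x'] of [y], at velocity at most r + 1. *)
have [xy|xy] := leP tau `|x - y|.
  rewrite (le_trans (ler_norm _))// (le_trans (large x y))//.
  rewrite (le_trans (_ : _ <= C1 * (2 * `|x - y|)))//.
    by rewrite ler_wpM2l// mulr_natl mulr2n lerD2l.
  by rewrite mulrCA mulrA ler_wpM2r// -addrA lerDl addr_ge0.
have [x' yE] := step_argmin y min; have yx' := speed _ _ yE.
have xx' : `|x - x'| <= (r + 1) * tau.
  have -> : x - x' = (x - y) + (y - x') by rewrite addrA subrK.
  rewrite (le_trans (ler_normD _ _))// mulrDl mul1r addrC lerD// ltW//.
have yx'' : `|y - x'| <= (r + 1) * tau.
  by rewrite (le_trans yx')// ler_wpM2r ?lerDl// ltW.
have := BP tau x' x' x y tau0 xx' yx''.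
rewrite subrr normr0 mulr0 add0r opprB addrA subrK => h.
have h1 := step_le x' x min; have := le_trans (ler_norm _) h.
have : 0 <= (2 * C1 + r) * `|x - y| by rewrite mulr_ge0// addr_ge0// mulr_ge0.
rewrite !mulrDl; lra.
Qed.

End DiscreteSolution.

(** * Limits of chains of Lax-Oleinik steps *)

Lemma mulr_half_div (R : realFieldType) (K e : R) : 0 <= K ->
  (K + 1) * (e / (2 * (K + 1))) = e / 2.
Proof. by move=> K0; field; rewrite gt_eqF// ltr_wpDl. Qed.

Lemma cvg_sum_nat (R : realType) (I : Type) (F : set_system I) (f : nat -> I -> R)
    (l : nat -> R) n : ProperFilter F -> (forall j, (j < n)%N -> f j @ F --> l j) ->
  \sum_(0 <= j < n) f j i @[i --> F] --> \sum_(0 <= j < n) l j.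
Proof.
move=> PF; elim: n => [_|n IH fl].
  rewrite big_geq//; under eq_fun do rewrite big_geq//; exact: cvg_cst.
rewrite big_nat_recr//=; under eq_fun do rewrite big_nat_recr//=.
by apply: cvgD; [apply: IH => j jn; apply: fl; exact: ltnW|exact: fl].
Qed.

Lemma filter_ler_cvg (R : realType) (I : Type) (F : set_system I) (f g : I -> R) (a b : R) :
  ProperFilter F -> f @ F --> a -> g @ F --> b ->
  (\forall i \near F, f i <= g i) -> a <= b.
Proof.
move=> PF fa gb fg; rewrite -subr_ge0; apply: (cvgr_to_ge (cvgB gb fa)).
by near=> i; rewrite /= subr_ge0; near: i.
Unshelve. all: by end_near. Qed.

Lemma cvg_dominated_diff (R : realType) (I : Type) (F : set_system I) (f g b : I -> R)
    (a : R) : ProperFilter F -> (forall i, `|f i - g i| <= b i) -> b @ F --> (0 : R) ->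
  g @ F --> a -> f @ F --> a.
Proof.
move=> PF fg b0 ga; apply/cvgrPdist_le => /= e e0; near=> i.
have bi : `|0 - b i| <= e / 2 by near: i; apply: cvgr_dist_le => //; exact: divr_gt0.
have gi : `|a - g i| <= e / 2 by near: i; apply: cvgr_dist_le => //; exact: divr_gt0.
rewrite sub0r normrN in bi; have := le_trans (fg i) (le_trans (ler_norm _) bi).
have -> : a - f i = (a - g i) - (f i - g i) by rewrite opprB addrA subrK.
move=> h; rewrite (le_trans (ler_normB _ _))//; lra.
Unshelve. all: by end_near. Qed.

Lemma truncn_scaled (R : realType) (delta t : R) : 0 < delta -> 0 <= t ->
  (Num.truncn (t / delta))%:R * delta <= t < (Num.truncn (t / delta))%:R * delta + delta.
Proof.
move=> delta0 t0; rewrite -[X in _ < _ + X]mul1r -mulrDl natr1 -ler_pdivlMr// -ltr_pdivrMr// truncn_itv// divr_ge0// ltW//.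
Qed.

Section ChainLimits.
Context {R : realType} {d : nat}.
Local Notation V := 'rV[R]_d.
Context (H : V -> V -> R) (tH : tonelli H).
Local Notation L := (lagrangian H).
Local Notation DA := (discrete_action L).
Local Notation MA := (minimal_action L).
Local Notation step := (step H).
Implicit Types (tau c delta : R) (x y : V) (v : nat -> V -> R).

(** Common to the iterates from 0 and to the sequences u + n c of solutions: the drift in time is at
    a bounded rate, from which spatial estimates follow. *)
Definition chain (C delta : R) v :=
  (forall n, step delta (v n) (v n.+1)) /\
  (forall n x, `|v n.+1 x - v n x| <= C * delta).

Lemma chain_lip (C : R) : exists2 C' : R, 0 <= C' & forall delta v,
  0 < delta -> chain C delta v ->
  forall n x y, `|v n x - v n y| <= C' * (`|x - y| + delta).
Proof.
have [C' C'0 CP] := step_lip_scale tH C.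
by exists C' => // delta v delta0 [sv vC]; exact: CP.
Qed.

Lemma chain_speed (C : R) : 0 <= C -> exists2 r : R, 0 <= r & forall delta v,
  0 < delta -> chain C delta v -> forall n x y,
  v n.+1 y = v n x + DA delta x y -> `|y - x| <= r * delta.
Proof.
move=> C0; have [C' C'0 CP] := chain_lip C.
have [r r0 rP] := step_speed tH (addr_ge0 C0 C'0); exists r => // delta v delta0 cv n x y.
apply: rP => // [x' y'|x'].
  by rewrite (le_trans (CP _ _ delta0 cv n x' y'))// ler_wpM2r ?lerDr// addr_ge0// ltW.
have [_ /(_ n x')] := cv; rewrite ler_norml => /andP[_].
have : 0 <= C' * delta by rewrite mulr_ge0// ltW.
rewrite mulrDl; lra.
Qed.

(* Along [g], a step is controlled by [partial_action_discrete] if the displacement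
   is at most [O(delta)], and by the coercivity of the action otherwise. *)
Lemma chain_below (C tau : R) g I : 0 <= C -> 0 < tau -> abs_continuous 0 tau g ->
  partial_action_of H g tau I -> forall e, 0 < e ->
  exists2 eta : R, 0 < eta & forall delta v, 0 < delta -> delta <= eta ->
    chain C delta v ->
    v (Num.truncn (tau / delta)) (g tau) <= v 0%N (g 0) + I 0 tau + e.
Proof.
move=> C0 tau0 acg gI e e0; have [Iadd _] := gI.
have [C' C'0 lip] := chain_lip C.
have [D D0 DP] := partial_action_coercive tH (addr_ge0 C'0 (@ler01 R)).
have [D1 D10 D1P] := partial_action_coercive tH (lexx 0).
(* Above this velocity, coercivity with slope C' + 1 pays for the variation of [v] in space and in
   time. *)
have [M0 M00 M0P] := partial_action_discrete tH (C' + C + D).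
have e2 : 0 < e / (2 * (C' + 1)) by rewrite divr_gt0// mulr_gt0// ltr_wpDl.
have [eta1 eta10 unif] := ac_uniformly_continuous acg e2.
(* The errors of order [delta]: the quadratic errors of n steps, the action on the last incomplete
   step, and the Lipschitz defect of [v] at its end. *)
pose K := M0 * tau + D1 + C'.
have K0 : 0 <= K by rewrite !addr_ge0// mulr_ge0// ltW.
pose eta := Num.min (eta1 / 2) (e / (2 * (K + 1))).
exists eta; first by rewrite lt_min !divr_gt0// mulr_gt0// ltr_wpDl.
move=> delta v delta0; rewrite le_min => /andP[d1 d2] cv; have [sv vC] := cv.
set n := Num.truncn (tau / delta).
have /andP[n1 n2] : n%:R * delta <= tau < n%:R * delta + delta := truncn_scaled delta0 (ltW tau0).
have jtau j : (j <= n)%N -> j%:R * delta <= tau.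
  by move=> jn; rewrite (le_trans _ n1)// ler_wpM2r ?ler_nat// ltW.
have one j : (j < n)%N -> v j.+1 (g (j.+1%:R * delta)) <=
    v j (g (j%:R * delta)) + I (j%:R * delta) (j.+1%:R * delta) + M0 * delta ^+ 2.
  move=> jn; set a := j%:R * delta; set b := j.+1%:R * delta.
  have ba : b - a = delta by rewrite /b /a -natr1 mulrDl mul1r addrAC subrr add0r.
  have a0 : 0 <= a by rewrite mulr_ge0// ltW.
  have ab : a < b by rewrite -subr_gt0 ba.
  have bT : b <= tau by exact: jtau.
  have [small|large] := leP `|g b - g a| ((C' + C + D) * delta).
    have := M0P g tau I gI a b a0 ab bT; rewrite ba => /(_ small).
    have := step_le (g a) (g b) (sv j); lra.
  have := DP g tau I gI a b a0 (ltW ab) bT; rewrite ba => h1.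
  have := lip _ _ delta0 cv j (g b) (g a); rewrite ler_norml => /andP[_ h2].
  have := vC j (g b); rewrite ler_norml => /andP[_ h3].
  have h4 : 0 <= M0 * delta ^+ 2 by rewrite mulr_ge0// exprn_ge0// ltW.
  rewrite !mulrDl in large; rewrite mulrDl mul1r in h1; rewrite mulrDr in h2; lra.
have tel j : (j <= n)%N -> v j (g (j%:R * delta)) <=
    v 0%N (g 0) + I 0 (j%:R * delta) + j%:R * (M0 * delta ^+ 2).
  elim: j => [_|j IH jn].
    have I00 : I 0 0 = 0 by have := Iadd 0 0 0 (lexx _) (lexx _) (lexx _) (ltW tau0); lra.
    by rewrite !mul0r I00 !addr0.
  have := one j jn; have := IH (ltnW jn).
  rewrite (Iadd 0 (j%:R * delta) (j.+1%:R * delta)) ?jtau//.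
  - suff -> : j.+1%:R * (M0 * delta ^+ 2) = j%:R * (M0 * delta ^+ 2) + M0 * delta ^+ 2 by lra.
    by rewrite -natr1 mulrDl mul1r.
  - by rewrite mulr_ge0// ltW.
  - by rewrite ler_wpM2r ?ler_nat// ltW.
have nd0 : 0 <= n%:R * delta by rewrite mulr_ge0// ltW.
have h1 := tel n (leqnn n).
have h2 := Iadd 0 (n%:R * delta) tau (lexx _) nd0 n1 (lexx _).
have h3 := D1P g tau I gI (n%:R * delta) tau nd0 n1 (lexx _); rewrite mul0r in h3.
have tn : tau - n%:R * delta <= delta by move: n2; lra.
have h4 : D1 * (tau - n%:R * delta) <= D1 * delta by rewrite ler_wpM2l.
have h5 : n%:R * (M0 * delta ^+ 2) <= M0 * tau * delta.
  have -> : n%:R * (M0 * delta ^+ 2) = (M0 * delta) * (n%:R * delta) by ring.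
  by rewrite [M0 * tau * _]mulrAC ler_wpM2l// mulr_ge0// ltW.
have gg : `|g tau - g (n%:R * delta)| <= e / (2 * (C' + 1)).
  apply: unif; first by rewrite (ltW tau0) lexx.
    by rewrite nd0.
  rewrite ger0_norm ?subr_ge0//; lra.
have := lip _ _ delta0 cv n (g tau) (g (n%:R * delta)); rewrite ler_norml => /andP[_ h6].
have h7 : C' * `|g tau - g (n%:R * delta)| <= e / 2.
  apply: (@le_trans _ _ ((C' + 1) * (e / (2 * (C' + 1))))).
    by rewrite ler_pM// lerDl.
  by rewrite mulr_half_div.
have h8 : K * delta <= e / 2.
  apply: (@le_trans _ _ ((K + 1) * (e / (2 * (K + 1))))).
    by rewrite ler_pM ?(ltW delta0)// lerDl.
  by rewrite mulr_half_div.
rewrite /K !mulrDl in h8; rewrite mulrDr in h6; lra.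
Qed.

Lemma chain_limit_le (I : Type) (F : set_system I) (C tau l : R) (delta : I -> R)
    (v : I -> nat -> V -> R) (u0 : V -> R) y : ProperFilter F -> 0 <= C -> 0 < tau ->
  (forall i, 0 < delta i) -> delta @ F --> (0 : R) ->
  (forall i, chain C (delta i) (v i)) -> (forall x, v i 0%N x @[i --> F] --> u0 x) ->
  v i (Num.truncn (tau / delta i)) y @[i --> F] --> l ->
  forall x, l <= u0 x + MA tau x y.
Proof.
move=> PF C0 tau0 delta0 deltaF cv vu vl x; rewrite -lerBlDl.
apply: (minimal_action_ge tH tau0) => g [acg g0 gT].
apply: (action_lower tH tau0 acg) => J gJ _; rewrite lerBlDl; apply/ler_addgt0Pr => e e0.
have [eta eta0 etaP] := chain_below C0 tau0 acg gJ e0.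
have vJ : v i 0%N (g 0) + J 0 tau + e @[i --> F] --> u0 (g 0) + J 0 tau + e.
  exact: (cvgD (cvgD (vu (g 0)) (cvg_cst (J 0 tau))) (cvg_cst e)).
have near_eta : \forall i \near F, `|0 - delta i| <= eta by exact: cvgr_dist_le.
rewrite -g0; apply: (filter_ler_cvg _ vl vJ); near=> i; rewrite -gT; apply: etaP => //.
by rewrite -(gtr0_norm (delta0 i)) -normrN -sub0r; near: i.
Unshelve. all: by end_near. Qed.

(** Fenchel's inequality with the fixed momentum [p], summed over a block; the position is frozen at
    [q] at a cost [B * rho] per unit of time. This is the discrete counterpart of the last clause of
    [partial_action]. *)
Lemma chain_block (P : R) : exists2 B : R, 0 <= B & forall delta v (z : nat -> V) q p rho a b,
  0 < delta -> `|p| <= P -> (a <= b)%N ->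
  (forall k, (a <= k < b)%N -> `|z k - q| <= rho /\
     v k.+1 (z k.+1) = v k (z k) + DA delta (z k) (z k.+1)) ->
  dot p (z b - z a) - (b%:R * delta - a%:R * delta) * (H q p + B * rho) <=
  v b (z b) - v a (z a).
Proof.
have [B B0 BP] := hamiltonian_lip tH P; exists B => // delta v z q p rho a b delta0 pP.
elim: b => [|b IH].
  by rewrite leqn0 => /eqP ->; rewrite !subrr dotC dot0l mul0r subrr.
rewrite leq_eqVlt => /predU1P[<- _|]; first by rewrite !subrr dotC dot0l mul0r subrr.
rewrite ltnS => ab zP.
have [|zq vb] := zP b; first by rewrite ab ltnSn.
have {}IH : dot p (z b - z a) -
    (b%:R * delta - a%:R * delta) * (H q p + B * rho) <= v b (z b) - v a (z a).
  by apply: IH => // k /andP[ak kb]; apply: zP; rewrite ak leqW.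
have h1 := fenchel tH (z b) (delta^-1 *: (z b.+1 - z b)) p.
have {}h1 : dot p (z b.+1 - z b) - delta * H (z b) p <= DA delta (z b) (z b.+1).
  rewrite /discrete_action; apply: le_trans (ler_wpM2l (ltW delta0) h1).
  by rewrite mulrBr dotZr mulVKf ?gt_eqF.
have h2 : H (z b) p <= H q p + B * rho.
  have := BP (z b) q p pP; rewrite ler_norml => /andP[_].
  by have := ler_wpM2l B0 zq; lra.
have h3 := ler_wpM2l (ltW delta0) h2.
have -> : z b.+1 - z a = (z b.+1 - z b) - (z a - z b) by rewrite opprB addrA subrK.
have h4 : dot p (z b - z a) = - dot p (z a - z b).
  by rewrite -opprB dotC -[- _]scaleN1r dotC dotZr mulN1r.
rewrite dotBr vb; rewrite h4 in IH.
have -> : (b.+1%:R * delta - a%:R * delta) * (H q p + B * rho) =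
  (b%:R * delta - a%:R * delta) * (H q p + B * rho) + delta * (H q p + B * rho).
  by rewrite -natr1; ring.
lra.
Qed.

(** * Limit curves of minimising chains *)

Section Attained.
Context (U : set_system nat) (C tau l : R) (delta : nat -> R)
  (v : nat -> nat -> V -> R) (u0 : V -> R) (y : V).
Context (UU : UltraFilter U).
Context (C0 : 0 <= C) (tau0 : 0 < tau) (delta0 : forall i, 0 < delta i).
Context (deltaU : delta @ U --> (0 : R)) (cv : forall i, chain C (delta i) (v i)).
Context (vu : forall x, v i 0%N x @[i --> U] --> u0 x).
Context (vl : v i (Num.truncn (tau / delta i)) y @[i --> U] --> l).
Local Notation n i := (Num.truncn (tau / delta i)).
Local Notation idx i t := (Num.truncn (t / delta i)).

Let PU : ProperFilter U. Proof. exact: ultra_proper. Qed.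
#[local] Existing Instance PU.

Lemma idx_cvg t : 0 <= t -> (idx i t)%:R * delta i @[i --> U] --> t.
Proof.
move=> t0; apply/cvgrPdist_le => /= e e0; near=> i.
have /andP[h1 h2] := truncn_scaled (delta0 i) t0.
have de : `|0 - delta i| <= e by near: i; exact: cvgr_dist_le.
rewrite sub0r normrN (gtr0_norm (delta0 i)) in de.
rewrite ger0_norm ?subr_ge0//; lra.
Unshelve. all: by end_near. Qed.

Lemma idx_le i s t : 0 <= s -> s <= t -> (idx i s <= idx i t)%N.
Proof. by move=> s0 st; apply: le_truncn; rewrite ler_pM2r// invr_gt0. Qed.

(* The step functions [s i] built on backward minimising chains converge to a
   Lipschitz curve [g]. Its Riemann sums on a grid are controlled by testing, on
   each grid cell, the momentum that is optimal for the difference quotient of [g]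
   against the corresponding block of the chain. *)
Lemma chain_limit_attained : exists x, u0 x + MA tau x y <= l.
Proof.
have [r r0 speed] := chain_speed C0; have [C' C'0 lip] := chain_lip C.
have /choice[z zP] i : exists z : nat -> V, z (n i) = y /\ forall j, (j < n i)%N ->
    v i j.+1 (z j.+1) = v i j (z j) + DA (delta i) (z j) (z j.+1).
  by have [sv _] := cv i; exact: step_chain.
have z1 i j : (j < n i)%N -> `|z i j.+1 - z i j| <= r * delta i.
  by move=> jn; have [_ zE] := zP i; exact: (speed _ _ (delta0 i) (cv i) j _ _ (zE j jn)).
have zlip i a b : (a <= b)%N -> (b <= n i)%N ->
    `|z i b - z i a| <= r * (b%:R * delta i - a%:R * delta i).
  move=> + bn; elim: b bn => [_|b IH bn].
    by rewrite leqn0 => /eqP ->; rewrite !subrr normr0 mulr0.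
  rewrite leq_eqVlt => /predU1P[->|]; first by rewrite !subrr normr0 mulr0.
  rewrite ltnS => ab.
  have -> : z i b.+1 - z i a = (z i b.+1 - z i b) + (z i b - z i a) by rewrite addrA subrK.
  rewrite (le_trans (ler_normD _ _))//; have := IH (ltnW bn) ab; have := z1 i b bn.
  rewrite -natr1 [(_ + 1) * _]mulrDl mul1r; lra.
pose s i t := z i (idx i t).
have slip i t t' : 0 <= t -> t <= t' -> t' <= tau ->
    `|s i t' - s i t| <= r * ((idx i t')%:R * delta i - (idx i t)%:R * delta i).
  by move=> t0 tt' t'T; apply: zlip; apply: idx_le => //; exact: le_trans tt'.
have sT i : s i tau = y by have [] := zP i.
have sbd i t : 0 <= t <= tau -> `|s i t| <= `|y| + r * tau.
  move=> /andP[t0 tT]; have h := slip i t tau t0 tT (lexx _); rewrite sT in h.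
  have := ler_normB y (y - s i t); rewrite opprB addrC subrK => h1.
  have /andP[h2 _] := truncn_scaled (delta0 i) (ltW tau0).
  have h3 : 0 <= (idx i t)%:R * delta i by rewrite mulr_ge0// ltW.
  have : r * ((n i)%:R * delta i - (idx i t)%:R * delta i) <= r * tau.
    by rewrite ler_wpM2l//; lra.
  lra.
(* Pointwise limits along [U], at every time of [0, tau]; elsewhere [g] has the dummy value 0. *)
have /choice[g gP] t : exists x, 0 <= t <= tau -> s i t @[i --> U] --> x.
  have [tT|tT] := boolP (0 <= t <= tau); last by exists 0.
  have [x _ sx] := norm_bounded_ultra_cvg UU (fun i => sbd i t tT); by exists x.
have glip1 t t' : 0 <= t -> t <= t' -> t' <= tau -> `|g t' - g t| <= r * (t' - t).
  move=> t0 tt' t'T.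
  have gt := gP t; rewrite t0 (le_trans tt' t'T) in gt; have {}gt := gt isT.
  have gt' := gP t'; rewrite (le_trans t0 tt') t'T in gt'; have {}gt' := gt' isT.
  have i1 := idx_cvg t0; have i2 := idx_cvg (le_trans t0 tt').
  apply: (filter_ler_cvg _ (cvg_norm (cvgB gt' gt)) (cvgM (cvg_cst r) (cvgB i2 i1))).
  by apply: nearW => i; exact: slip.
have glip t t' : 0 <= t <= tau -> 0 <= t' <= tau -> `|g t - g t'| <= r * `|t - t'|.
  move=> /andP[t0 tT] /andP[t'0 t'T]; have [tt'|/ltW tt'] := leP t' t.
    by rewrite ger0_norm ?subr_ge0//; exact: glip1.
  by rewrite distrC [`|t - _|]distrC ger0_norm ?subr_ge0//; exact: glip1.
have su t : 0 <= t <= tau -> `|s i t - g t| @[i --> U] --> (0 : R).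
  move=> /gP sg; apply/cvgrPdist_le => /= e e0; near=> i.
  by rewrite sub0r normrN normr_id distrC; near: i; exact: cvgr_dist_le.
have s0 i : s i 0 = z i 0%N by rewrite /s mul0r truncn0.
have vg : v i 0%N (z i 0%N) @[i --> U] --> u0 (g 0).
  (* The starting point moves with [i], while [vu] is only pointwise: the Lipschitz estimate up to
     [delta i] transfers it to the fixed point [g 0]. *)
  apply: (@cvg_dominated_diff _ _ _ _ (fun i => v i 0%N (g 0))
    (fun i => C' * (`|s i 0 - g 0| + delta i))) => //.
    by move=> i; rewrite s0; exact: lip.
  have g00 : (0 : R) <= 0 <= tau by rewrite lexx ltW.
  have h := cvgM (cvg_cst C') (cvgD (su 0 g00) deltaU).
  by rewrite addr0 mulr0 in h; exact: h.
exists (g 0); rewrite addrC -lerBrDr.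
have gT : g tau = y.
  have g00 : 0 <= tau <= tau by rewrite lexx ltW.
  have sE : (fun i => s i tau) = cst y by exact: funext.
  have : (fun i => s i tau) @ U --> y by rewrite sE; exact: cvg_cst.
  exact: (cvg_unique _ (gP tau g00)).
have cg : curve tau (g 0) y g by split=> //; exact: lipschitz_abs_continuous glip.
rewrite -lee_fin; apply: le_trans (minimal_action_le tH tau0 cg) _.
apply: (action_le_grid tH tau0 r0 glip) => e e0.
have [P P0 PP] := lagrangian_max tH r; have [B B0 blk] := chain_block P.
near=> m; set h := tau / m.+1%:R.
have h0 : 0 < h by rewrite divr_gt0.
pose t j := h * j%:R; have tT : t m.+1 = tau by rewrite /t divfK.
have t0 j : 0 <= t j by rewrite mulr_ge0// ltW.
have tS j : t j.+1 = t j + h by rewrite /t -natr1 mulrDr mulr1.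
have tle j k : (j <= k)%N -> t j <= t k by move=> jk; rewrite ler_wpM2l ?ler_nat// ltW.
have tI j : (j <= m.+1)%N -> 0 <= t j <= tau by move=> jm; rewrite t0 -tT tle.
pose w j := h^-1 *: (g (t j.+1) - g (t j)).
have /choice[p pP] j : exists p, (j < m.+1)%N ->
    `|p| <= P /\ L (g (t j)) (w j) = dot p (w j) - H (g (t j)) p.
  have [jm|] := ltnP j m.+1; last by exists 0.
  have wr : `|w j| <= r.
    apply: velocity_le => //; have := glip1 (t j) (t j.+1) (t0 j) (tle _ _ (leqnSn j)) _.
    by rewrite tS addrAC subrr add0r; apply; rewrite -tS -tT tle.
  by have [q qP [qE _]] := PP (g (t j)) (w j) wr; exists q.
(* The radius in [chain_block] is the length travelled during one cell, at speed [r] and up to one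
   step, plus the distance from the start of the block to [g (t j)]. *)
pose rhs j i := dot (p j) (s i (t j.+1) - s i (t j)) -
  ((idx i (t j.+1))%:R * delta i - (idx i (t j))%:R * delta i) *
  (H (g (t j)) (p j) + B * (r * (h + delta i) + `|s i (t j) - g (t j)|)).
have rhs_le j i : (j < m.+1)%N -> rhs j i <=
    v i (idx i (t j.+1)) (s i (t j.+1)) - v i (idx i (t j)) (s i (t j)).
  move=> jm; have [pj _] := pP j jm.
  apply: blk => //; first by apply: idx_le => //; exact: tle.
  move=> k /andP[k1 k2].
  have kn : (k < n i)%N.
    by apply: (leq_trans k2); apply: idx_le => //; have /andP[] := tI j.+1 jm.
  split; last by have [_] := zP i; exact.
  have := zlip i _ _ k1 (ltnW kn) => h1.
  have h2 : k%:R * delta i - (idx i (t j))%:R * delta i <= h + delta i.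
    have /andP[_] := truncn_scaled (delta0 i) (t0 j).
    have /andP[+ _] := truncn_scaled (delta0 i) (t0 j.+1).
    have : k%:R * delta i <= (idx i (t j.+1))%:R * delta i.
      by rewrite ler_wpM2r ?(ltW (delta0 i))// ler_nat ltnW.
    rewrite tS; lra.
  have -> : z i k - g (t j) = (z i k - s i (t j)) + (s i (t j) - g (t j)).
    by rewrite addrA subrK.
  by rewrite (le_trans (ler_normD _ _))// lerD2r (le_trans h1)// ler_wpM2l.
pose lim j := dot (p j) (g (t j.+1) - g (t j)) -
  (t j.+1 - t j) * (H (g (t j)) (p j) + B * (r * (h + 0) + 0)).
have rhs_lim j : (j < m.+1)%N -> rhs j @ U --> lim j.
  move=> jm; have jm' := ltnW jm.
  have c1 : dot (p j) (s i (t j.+1) - s i (t j)) @[i --> U] -->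
      dot (p j) (g (t j.+1) - g (t j)).
    have cdot : continuous (dot (p j)).
      have -> : dot (p j) = dot^~ (p j) by apply: funext => q; rewrite dotC.
      exact: dot_continuous.
    exact: (continuous_cvg _ (cdot _) (cvgB (gP _ (tI _ jm)) (gP _ (tI _ jm')))).
  have c2 : (idx i (t j.+1))%:R * delta i - (idx i (t j))%:R * delta i @[i --> U] -->
      t j.+1 - t j by exact: (cvgB (idx_cvg (t0 j.+1)) (idx_cvg (t0 j))).
  have c3 : B * (r * (h + delta i) + `|s i (t j) - g (t j)|) @[i --> U] -->
      B * (r * (h + 0) + 0).
    apply: cvgM; first exact: cvg_cst.
    apply: cvgD; last exact: (su _ (tI _ jm')).
    by apply: cvgM; [exact: cvg_cst|apply: cvgD; [exact: cvg_cst|exact: deltaU]].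
  exact: (cvgB c1 (cvgM c2 (cvgD (cvg_cst (H (g (t j)) (p j))) c3))).
have sumlim : \sum_(0 <= j < m.+1) lim j <= l - u0 (g 0).
  apply: (filter_ler_cvg _ (cvg_sum_nat _ rhs_lim) (cvgB vl vg)); apply: nearW => i.
  pose f j := v i (idx i (t j)) (s i (t j)).
  have fE : v i (n i) y - v i 0%N (z i 0%N) = f m.+1 - f 0%N.
    by rewrite /f tT sT /t mulr0 s0 mul0r truncn0.
  change (\sum_(0 <= j < m.+1) rhs j i <= v i (n i) y - v i 0%N (z i 0%N)).
  rewrite fE -telescope_sumr//; apply: ler_sum_nat => j /andP[_ jm]; exact: rhs_le.
have limE j : (j < m.+1)%N -> h * L (g (t j)) (w j) = lim j + h * (B * (r * h)).
  move=> jm; have [_ ->] := pP j jm.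
  rewrite mulrBr /w dotZr mulVKf ?gt_eqF// /lim tS; ring.
have -> : \sum_(0 <= j < m.+1) h * L (g (t j)) (w j) =
    \sum_(0 <= j < m.+1) (lim j + h * (B * (r * h))).
  by apply: eq_big_nat => j /andP[_ jm]; exact: limE.
(* Over all cells the freezing error is B r tau^2 / (m + 1), below [e] for large [m]. *)
rewrite big_split/= sumr_const_nat subn0 lerD// -mulr_natl mulrA.
rewrite /h [m.+1%:R * _]mulrC divfK// !mulrA ler_pdivrMr// -ler_pdivrMl//.
rewrite (@le_trans _ _ m%:R)// ?ler_nat//; near: m; exact: nbhs_infty_ger.
Unshelve. all: by end_near. Qed.

End Attained.

End ChainLimits.

(** * The continuous equation *)

Lemma cvg_harmonic_ultra (R : realType) (U : set_system nat) : \oo `<=` U ->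
  (fun n => n.+1%:R^-1 : R) @ U --> (0 : R).
Proof. by move=> leU A /(@cvg_harmonic R) h; exact: leU. Qed.

Lemma cvg_uniform_dist (R : realType) (T : choiceType) (f : nat -> T -> R) (g : T -> R) :
  (forall e : R, 0 < e -> \forall n \near \oo, forall x, `|g x - f n x| <= e) ->
  {uniform, f @ \oo --> g}.
Proof.
move=> fg P /uniform_nbhs[E [entE EP]].
move: entE; rewrite -entourage_from_ballE => -[e /= e0 eE].
have e2 : 0 < e / 2 by rewrite divr_gt0.
apply: filterS (fg _ e2) => n fn; apply: EP => x _; apply: eE => /=.
by rewrite /ball/= (le_lt_trans (fn x))// ltr_pdivrMr// ltr_pMr// ltr1n.
Qed.

Lemma cvg_uniform_pointwise (R : realType) (T : choiceType) (f : nat -> T -> R) (g : T -> R) x :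
  {uniform, f @ \oo --> g} -> f n x @[n --> \oo] --> g x.
Proof.
move=> fg; apply/cvgrPdist_lt => /= e e0.
apply: (fg [set h | `|g x - h x| < e]); apply/uniform_nbhs.
exists [set xy | ball xy.1 e xy.2]; split=> [|h /(_ x I)//].
exact: (entourage_ball _ (PosNum e0)).
Qed.

Section Solutions.
Context {R : realType} {d : nat}.
Local Notation V := 'rV[R]_d.
Context (H : V -> V -> R) (tH : tonelli H).
Local Notation L := (lagrangian H).
Local Notation DA := (discrete_action L).
Local Notation MA := (minimal_action L).
Implicit Types (tau c h : R) (x y : V) (u v : V -> R).

Lemma lip_periodic_osc (C : R) u : periodic u ->
  (forall x y, `|u x - u y| <= C * `|x - y|) -> 0 <= C -> forall x y, `|u x - u y| <= C.
Proof.
move=> pu uC C0 x y; have [k xk] := unit_cell (x - y).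
rewrite -(pu x k) (le_trans (uC _ _))//.
by rewrite -[leRHS]mulr1 ler_wpM2l// addrAC.
Qed.

(** The slack [eps] accommodates iterates, whose Lipschitz bound in [chain_lip] carries the additive
    error [delta]; it vanishes in the limit. *)
Lemma cvg_lip (I : Type) (F : set_system I) (us : I -> V -> R) u (C : R) (eps : I -> R) :
  ProperFilter F -> eps @ F --> (0 : R) ->
  (forall i x y, `|us i x - us i y| <= C * (`|x - y| + eps i)) ->
  (forall x, us i x @[i --> F] --> u x) ->
  forall x y, `|u x - u y| <= C * `|x - y|.
Proof.
move=> PF e0 usC uu x y.
have h1 : `|us i x - us i y| @[i --> F] --> `|u x - u y|.
  exact: (cvg_norm (cvgB (uu x) (uu y))).
have h2 : C * (`|x - y| + eps i) @[i --> F] --> C * (`|x - y| + 0).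
  by apply: cvgM; [exact: cvg_cst|apply: cvgD; [exact: cvg_cst|exact: e0]].
rewrite addr0 in h2; apply: (filter_ler_cvg _ h1 h2); apply: nearW => i; exact: usC.
Qed.

Lemma cvg_periodic (I : Type) (F : set_system I) (us : I -> V -> R) u :
  ProperFilter F -> (forall i, periodic (us i)) ->
  (forall x, us i x @[i --> F] --> u x) -> periodic u.
Proof.
move=> PF pus uu x k; have := uu (x + map_mx intr k).
have -> : (fun i => us i (x + map_mx intr k)) = (fun i => us i x).
  by apply: funext => i; rewrite pus.
by move=> h; exact: (cvg_unique _ h (uu x)).
Qed.

(** Equicontinuity makes the convergence locally uniform; compactness of the unit ball and
    periodicity make it uniform. *)
Lemma cvg_equilipschitz (I : Type) (F : set_system I) (us : I -> V -> R) u (C : R) :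
  ProperFilter F -> 0 <= C -> (forall i, periodic (us i)) ->
  (forall i x y, `|us i x - us i y| <= C * `|x - y|) ->
  (forall x, us i x @[i --> F] --> u x) ->
  forall e, 0 < e -> \forall i \near F, forall x, `|u x - us i x| <= e.
Proof.
move=> PF C0 pus usC uu e e0.
have pu := cvg_periodic PF pus uu.
have uC : forall x y, `|u x - u y| <= C * `|x - y|.
  by apply: (cvg_lip PF (cvg_cst (0 : R)) _ uu) => i x y; rewrite addr0.
pose r := e / (2 * (2 * C + 1)).
have r0 : 0 < r by rewrite divr_gt0// mulr_gt0// ltr_wpDl// mulr_ge0.
have /compact_near_coveringP cov := @closed_ball_compact R d 1.
have := cov I F (fun i x => `|u x - us i x| <= e) _ _.
move=> h; have {}h : \forall i \near F, [set x : V | `|x| <= 1] `<=` (fun x => `|u x - us i x| <= e).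
  apply: h => x _; near=> z i.
  have xz : `|x - z| <= r by near: z; apply: cvgr_dist_le; [exact: cvg_id|].
  have ui : `|u x - us i x| <= e / 2 by near: i; apply: cvgr_dist_le; [exact: uu|exact: divr_gt0].
  have -> : u z - us i z = (u z - u x) + (u x - us i x) + (us i x - us i z) by ring.
  rewrite (le_trans (ler_normD _ _))// (le_trans (lerD (ler_normD _ _) (lexx _)))//.
  have h1 := uC z x; have h2 := usC i x z; rewrite distrC in h1.
  have h3 : C * `|x - z| <= C * r by rewrite ler_wpM2l.
  have h4 : (2 * C + 1) * r = e / 2 by rewrite mulr_half_div// mulr_ge0.
  rewrite distrC in h1; rewrite [`|z - x|]distrC in h1; lra.
apply: filterS h => i ui x; have [k xk] := unit_cell x.
by rewrite -(pu x k) -(pus i x k); exact: ui.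
Unshelve. all: by end_near. Qed.

Lemma sol_discrete_unique tau c c' u u' :
  sol_discrete L tau c u -> sol_discrete L tau c' u' -> c = c'.
Proof.
move=> /inf_mean_discrete_action h /inf_mean_discrete_action h'.
exact: (cvg_unique _ h h').
Qed.

Lemma sol_discrete_shift tau c u (a : R) :
  sol_discrete L tau c u -> sol_discrete L tau c (fun x => u x + a).
Proof.
move=> [cu pu su]; split.
- move=> x; have ca := @cst_continuous V R a; exact: (continuousD (cu x) (ca x)).
- by move=> x k; rewrite pu.
- move=> y; have := step_shift a su y; rewrite [in X in _ -> X]addrAC; exact.
Qed.

Lemma chain_sol_discrete : exists2 C : R, 0 <= C & forall tau c u, 0 < tau ->
  sol_discrete L tau c u -> chain H C tau (fun n x => u x + n%:R * c).
Proof.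
have [C C0 CP] := discrete_constant_bounded tH; exists C => // tau c u tau0 su.
split; first exact: sol_step.
move=> n x; have -> : u x + n.+1%:R * c - (u x + n%:R * c) = c by rewrite -natr1; ring.
exact: CP su.
Qed.

(** After n = floor (t / tau i) steps the chain has gained n c = (n tau) (c / tau), which tends to -
    t h; [t] is arbitrary, so the same [u] serves all times. *)
Lemma limit_sol_continuous (U : set_system nat) (tau c : nat -> R) (us : nat -> V -> R) u h :
  UltraFilter U -> (forall i, 0 < tau i) -> tau @ U --> (0 : R) ->
  (forall i, sol_discrete L (tau i) (c i) (us i)) ->
  (forall x, us i x @[i --> U] --> u x) -> c i / tau i @[i --> U] --> - h ->
  sol_continuous L h u.
Proof.
move=> UU tau0 tauU sus uu ch; have PU := @ultra_proper _ U UU.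
have [C C0 CP] := sol_discrete_lip tH; have [B B0 BP] := chain_sol_discrete.
have uC : forall x y, `|u x - u y| <= C * `|x - y|.
  apply: (cvg_lip PU (cvg_cst (0 : R)) _ uu) => i x y; rewrite addr0.
  by have [h1 _] := CP _ _ _ (tau0 i) (sus i); exact: h1.
split; first exact: (lipschitz_continuous uC).
  by apply: (cvg_periodic PU _ uu) => i; have [] := sus i.
move=> y t t0; pose v i n x := us i x + n%:R * c i.
have cv i : chain H B (tau i) (v i) by exact: BP.
have v0 x : v i 0%N x @[i --> U] --> u x.
  have -> : (fun i => v i 0%N x) = (fun i => us i x); last exact: uu.
  by apply: funext => i; rewrite /v mul0r addr0.
have vl : v i (Num.truncn (t / tau i)) y @[i --> U] --> u y - t * h.
  have -> : (fun i => v i (Num.truncn (t / tau i)) y) =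
     (fun i => us i y + ((Num.truncn (t / tau i))%:R * tau i) * (c i / tau i)).
    by apply: funext => i; rewrite /v -mulrA [tau i * _]mulrC divfK// gt_eqF.
  rewrite -mulrN; apply: cvgD; first exact: uu.
  by apply: cvgM; [exact: (idx_cvg UU tau0 tauU (ltW t0))|exact: ch].
have le := chain_limit_le tH PU B0 t0 tau0 tauU cv v0 vl.
have [x xP] := chain_limit_attained tH UU B0 t0 tau0 tauU cv v0 vl.
split; last by move=> _ [z _ <-]; exact: le.
by exists x => //; apply/eqP; rewrite eq_le xP le.
Qed.

Lemma minimal_action_bounded (r : R) : exists2 B : R, 0 <= B & forall tau x y, 0 < tau ->
  `|y - x| <= r * tau -> MA tau x y <= tau * B.
Proof.
have [B B0 BP] := lagrangian_bounded tH r; exists B => // tau x y tau0 yx.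
rewrite -lee_fin (le_trans (minimal_action_le tH tau0 (curve_line x y tau0)))//.
apply: action_line => // t _; rewrite (le_trans (ler_norm _))// BP//.
exact: velocity_le.
Qed.

Lemma sol_continuous_lip h : exists2 C : R, 0 <= C & forall u, sol_continuous L h u ->
  (forall x y, `|u x - u y| <= C * `|x - y|) /\
  (forall tau x y, 0 < tau -> u y - tau * h = u x + MA tau x y -> `|y - x| <= C * tau).
Proof.
have [B B0 BP] := minimal_action_bounded 1.
pose C1 := B + `|h|; have C10 : 0 <= C1 by rewrite addr_ge0.
have [D D0 DP] := minimal_action_coercive tH (addr_ge0 C10 (@ler01 R)).
exists (C1 + (D + `|h|)) => [|u [cu pu su]]; first by rewrite !addr_ge0.
have Dh0 : 0 <= D + `|h| by rewrite addr_ge0.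
have lip x y : u x - u y <= C1 * `|x - y|.
  have [->|xy] := eqVneq x y; first by rewrite !subrr normr0 mulr0.
  have s0 : 0 < `|x - y| by rewrite normr_gt0 subr_eq0.
  (* The equation is used at the time [|x - y|], so that the connecting line has velocity at most
     1. *)
  have [_ /(_ (u y + MA `|x - y| y x))] := su x _ s0.
  move=> /(_ (ex_intro2 _ _ y I erefl)).
  have := BP `|x - y| y x s0; rewrite mul1r => /(_ (lexx _)).
  have : `|x - y| * h <= `|x - y| * `|h| by rewrite ler_wpM2l// ler_norm.
  rewrite /C1 mulrDl; lra.
have lipC x y : C1 * `|x - y| <= (C1 + (D + `|h|)) * `|x - y|.
  by rewrite ler_wpM2r// lerDl.
split=> [x y|tau x y tau0 E].
  by rewrite ler_norml lerNl opprB (le_trans (lip y x)) ?(le_trans (lip x y))// distrC.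
have := DP tau x y tau0; have := lip y x.
have : - (tau * h) <= `|h| * tau by rewrite -mulrN mulrC ler_wpM2r ?(ltW tau0)// -normrN ler_norm.
have : 0 <= C1 * tau by rewrite mulr_ge0// ltW.
rewrite !mulrDl mul1r; lra.
Qed.

(** Over a time t the two equations give t (h - h') <= 2 M + 2 M', and t is chosen so that the
    right-hand side is less than t e. *)
Lemma sol_continuous_le h h' u u' :
  sol_continuous L h u -> sol_continuous L h' u' -> h <= h'.
Proof.
move=> [cu pu su] [cu' pu' su'].
have [M M0 MP] := periodic_bounded cu pu; have [M' M'0 MP'] := periodic_bounded cu' pu'.
apply/ler_addgt0Pr => e e0; pose t := (2 * M + 2 * M' + 1) / e.
have t0 : 0 < t by rewrite divr_gt0// ltr_wpDl// addr_ge0// mulr_ge0.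
have [[x _ xE] _] := su 0 t t0; have [_ /(_ (u' x + MA t x 0))] := su' 0 t t0.
move=> /(_ (ex_intro2 _ _ x I erefl)).
have := MP x; have := MP 0; have := MP' x; have := MP' 0.
rewrite !ler_norml => /andP[? ?] /andP[? ?] /andP[? ?] /andP[? ?] ?.
have te : t * e = 2 * M + 2 * M' + 1 by rewrite divfK// gt_eqF.
rewrite -(ler_pM2l t0) mulrDr; lra.
Qed.

(* Compare the two minimisation problems at the maximum and at the minimum of
   [u - v]: there [MA] and [DA] differ by [O(tau ^+ 2)]. *)
Lemma sol_comparison h : exists2 C : R, 0 <= C & forall tau c u v, 0 < tau ->
  sol_discrete L tau c v -> sol_continuous L h u -> `|c / tau + h| <= C * tau.
Proof.
have [C1 C10 C1P] := sol_discrete_lip tH; have [C2 C20 C2P] := sol_continuous_lip h.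
have [D D0 DP] := minimal_action_discrete_le tH (addr_ge0 C10 C20).
exists D => // tau c u v tau0 sv su.
have [_ speed1] := C1P tau c v tau0 sv; have [_ speed2] := C2P u su.
have [cu pu mu] := su; have [cv pv mv] := sv.
have C1t : 0 <= C1 * tau by rewrite mulr_ge0// ltW.
have C2t : 0 <= C2 * tau by rewrite mulr_ge0// ltW.
have key : `|c + tau * h| <= D * tau ^+ 2.
  have [||y0 y0P] := @periodic_min R d (fun x => v x - u x).
  - by move=> x; exact: (continuousB (cv x) (cu x)).
  - by move=> x k; rewrite pu pv.
  have [||y1 y1P] := @periodic_min R d (fun x => u x - v x).
  - by move=> x; exact: (continuousB (cu x) (cv x)).
  - by move=> x k; rewrite pu pv.
  (* At [y0] the discrete minimiser is a competitor in (E2), which bounds c + tau h from below; at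
     [y1] the roles are exchanged. *)
  have [x0 E0] := step_argmin y0 mv; have [[x1 _ E1] _] := mu y1 tau tau0.
  have d0 : `|y0 - x0| <= (C1 + C2) * tau.
    by rewrite (le_trans (speed1 _ _ E0))// mulrDl lerDl.
  have d1 : `|y1 - x1| <= (C1 + C2) * tau.
    by rewrite (le_trans (speed2 _ _ _ tau0 (esym E1)))// mulrDl lerDr.
  have := DP _ _ _ tau0 d0; have := DP _ _ _ tau0 d1.
  have [_ /(_ _ (ex_intro2 _ _ x0 I erefl))] := mu y0 tau tau0.
  have := step_le x1 y1 mv; have := y0P x0; have := y1P x1.
  rewrite !ler_norml => ? ? ? ? /andP[? ?] /andP[? ?]; apply/andP; split; lra.
have -> : c / tau + h = (c + tau * h) / tau by rewrite mulrDl mulrAC divff ?gt_eqF// mul1r.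
by rewrite normrM normfV (gtr0_norm tau0) ler_pdivrMr// -mulrA -expr2.
Qed.

Lemma min_action_exists tau : 0 < tau -> exists m,
  is_min (range (fun xy : (V * V)%type => MA tau xy.1 xy.2)) m.
Proof.
move=> tau0; have [U UU leU] := ultrafilter_infty; have PU := @ultra_proper _ U UU.
pose delta i : R := i.+1%:R^-1; have delta0 i : 0 < delta i by rewrite invr_gt0.
have /choice[v vP] i := step_iter tH (delta0 i).
have [B B0 BP] := discrete_action_bounded tH 0.
have [D D0 DP] := discrete_action_coercive tH (lexx 0).
have BD0 : 0 <= B + D by exact: addr_ge0.
have cv i : chain H (B + D) (delta i) (v i).
  have [v0 vS] := vP i; have sv n : step H (delta i) (v i n) (v i n.+1) by have [] := vS n.
  have v1 x : `|v i 1%N x| <= (B + D) * delta i.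
    have h1 := step_le x x (sv 0%N); have [z h2] := step_argmin x (sv 0%N).
    rewrite v0 /cst/= add0r in h1 h2.
    have h3 : DA (delta i) x x <= delta i * B by apply: BP; rewrite // subrr normr0 mul0r.
    have := DP _ z x (delta0 i); rewrite mul0r.
    have := mulr_ge0 B0 (ltW (delta0 i)); have := mulr_ge0 D0 (ltW (delta0 i)).
    by move=> *; rewrite mulrDl ler_norml; apply/andP; split; lra.
  (* The bound on the first step propagates: comparison of the sequence with its shift by one index
     preserves it. *)
  split=> // n x; rewrite ler_norml; apply/andP; split.
    have := @step_comparison R d H (delta i) (v i) (fun n => v i n.+1) ((B + D) * delta i)
      sv (fun n => sv n.+1) _ n x.
    rewrite v0 => h; suff : v i n x <= v i n.+1 x + (B + D) * delta i by lra.
    by apply: h => z; have := v1 z; rewrite ler_norml /cst => /andP[? ?]; lra.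
  have := @step_comparison R d H (delta i) (fun n => v i n.+1) (v i) ((B + D) * delta i)
    (fun n => sv n.+1) sv _ n x.
  rewrite v0 => h; suff : v i n.+1 x <= v i n x + (B + D) * delta i by lra.
  by apply: h => z; have := v1 z; rewrite ler_norml /cst => /andP[? ?]; lra.
have v0 x : v i 0%N x @[i --> U] --> (0 : R).
  have -> : (fun i => v i 0%N x) = cst 0; last exact: cvg_cst.
  by apply: funext => i; have [-> _] := vP i.
have vbd i y : `|v i (Num.truncn (tau / delta i)) y| <= (B + D) * tau.
  have /andP[h1 _] := truncn_scaled (delta0 i) (ltW tau0).
  suff h n : `|v i n y| <= (B + D) * (n%:R * delta i).
    by rewrite (le_trans (h _))// ler_wpM2l.
  elim: n => [|n IH]; first by have [-> _] := vP i; rewrite normr0 mul0r mulr0.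
  have [_ /(_ n y) h] := cv i.
  have -> : v i n.+1 y = v i n y + (v i n.+1 y - v i n y) by rewrite addrC subrK.
  have -> : n.+1%:R * delta i = n%:R * delta i + delta i by rewrite -natr1 mulrDl mul1r.
  by rewrite (le_trans (ler_normD _ _))// mulrDr lerD.
have lex y : exists l : R, v i (Num.truncn (tau / delta i)) y @[i --> U] --> l.
  by have [l _ vl] := bounded_ultra_cvg UU (fun i => vbd i y); exists l.
(* [l y] will be the minimum over x of the minimal action; being Lipschitz and periodic, [l] has a
   minimum in turn. *)
have [l lP] := choice lex.
have deltaU : delta @ U --> (0 : R) := cvg_harmonic_ultra leU.
have le y x : l y <= MA tau x y.
  by have := chain_limit_le tH PU BD0 tau0 delta0 deltaU cv v0 (lP y) x; rewrite add0r.
have [C C0 CP] := chain_lip tH (B + D).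
have lC : forall x y, `|l x - l y| <= C * `|x - y|.
  by apply: (cvg_lip PU deltaU _ lP) => i x y; exact: CP.
have pl : periodic l.
  by apply: (cvg_periodic PU _ lP) => i; have [_ /(_ (Num.truncn (tau / delta i)))[]] := vP i.
have [y yP] := periodic_min (lipschitz_continuous lC) pl.
have [x xP] := chain_limit_attained tH UU BD0 tau0 delta0 deltaU cv v0 (lP y).
rewrite add0r in xP; exists (MA tau x y); split; first by exists (x, y).
by move=> _ [[z w] _ <-] /=; rewrite (le_trans xP)// (le_trans (yP w)).
Qed.

Lemma cvg_min_action h u (m : R -> R) : sol_continuous L h u ->
  (forall tau, 0 < tau ->
     is_min (range (fun xy : (V * V)%type => MA tau xy.1 xy.2)) (m tau)) ->
  tau^-1 * m tau @[tau --> +oo] --> - h.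
Proof.
move=> [cu pu su] mP; have [M M0 MP] := periodic_bounded cu pu.
apply/cvgrPdist_le => /= e e0; near=> t.
have t0 : 0 < t by near: t; exact: nbhs_pinfty_gt.
have te : 2 * M <= t * e by rewrite -ler_pdivrMr//; near: t; exact: nbhs_pinfty_ge.
have [[[x y] _ /= xyE] lb] := mP t t0.
have [_ /(_ _ (ex_intro2 _ _ x I erefl))] := su y t t0; rewrite xyE.
have [[z _ zE] _] := su 0 t t0; have := lb _ (ex_intro2 _ _ (z, 0) I erefl) => /=.
have := MP x; have := MP y; have := MP z; have := MP 0.
rewrite !ler_norml => /andP[? ?] /andP[? ?] /andP[? ?] /andP[? ?] ? ?.
have -> : - h - t^-1 * m t = t^-1 * (- (t * h) - m t).
  by rewrite mulrBr mulrN mulrA mulVf ?gt_eqF// mul1r.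
by rewrite ler_pdivlMl// ler_pdivrMl//; apply/andP; split; lra.
Unshelve. all: by end_near. Qed.

Lemma cvg_discrete_sols_exists (Lbar : R -> R) :
  (forall tau, 0 < tau -> exists u, sol_discrete L tau (Lbar tau) u) ->
  exists (tau : nat -> R) us u h, cvg_discrete_sols L Lbar tau us u /\ sol_continuous L h u.
Proof.
move=> LbarP; have [U UU leU] := ultrafilter_infty; have PU := @ultra_proper _ U UU.
pose delta i : R := i.+1%:R^-1; have delta0 i : 0 < delta i by rewrite invr_gt0.
have deltaU : delta @ U --> (0 : R) := cvg_harmonic_ultra leU.
have [C C0 CP] := sol_discrete_lip tH.
have /choice[us usP] i : exists u, sol_discrete L (delta i) (Lbar (delta i)) u /\ u 0 = 0.
  (* Normalised at 0, equi-Lipschitz periodic functions are uniformly bounded. *)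
  have [u su] := LbarP _ (delta0 i); exists (fun x => u x - u 0).
  by rewrite subrr; split=> //; exact: sol_discrete_shift.
have usL i x y : `|us i x - us i y| <= C * `|x - y|.
  by have [su _] := usP i; have [h _] := CP _ _ _ (delta0 i) su; exact: h.
have pus i : periodic (us i) by have [[_ + _] _] := usP i.
have usC x i : `|us i x| <= C.
  have [_ us0] := usP i; rewrite -[us i x]subr0 -us0.
  exact: (lip_periodic_osc (pus i) (usL i) C0).
have uex x : exists l : R, us i x @[i --> U] --> l.
  by have [l _ ul] := bounded_ultra_cvg UU (usC x); exists l.
have [u uu] := choice uex.
have [D D0 DP] := discrete_constant_bounded tH.
have cD i : `|Lbar (delta i) / delta i| <= D.
  have [su _] := usP i; rewrite normrM normfV (gtr0_norm (delta0 i)) ler_pdivrMr//.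
  exact: DP su.
have [h _ ch] := bounded_ultra_cvg UU cD.
have unif := cvg_equilipschitz PU C0 pus usL uu.
(* Returns from the ultrafilter to an actual sequence: a set of [U] meets every tail of the
   integers. *)
have /choice[phi phiP] k : exists i, (k <= i)%N /\ forall x, `|u x - us i x| <= k.+1%:R^-1.
  have k0 : 0 < k.+1%:R^-1 :> R by rewrite invr_gt0.
  have [i [ik iu]] := filter_ex (filterI (leU _ (nbhs_infty_ge k)) (unif _ k0)).
  by exists i.
exists (delta \o phi), (us \o phi), u, (- h); split; last first.
  apply: (limit_sol_continuous UU delta0 deltaU _ uu); last by rewrite opprK; exact: ch.
  by move=> i; have [] := usP i.
have small (e : R) : 0 < e -> \forall k \near \oo, k.+1%:R^-1 <= e.
  by move=> e0; apply: filterS (near_infty_natSinv_lt (PosNum e0)) => k /ltW.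
split.
- by move=> i; exact: delta0.
- apply/cvgrPdist_le => /= e e0; apply: filterS (small e e0) => k; apply: le_trans.
  rewrite sub0r normrN gtr0_norm ?delta0// lef_pV2 ?posrE// ler_nat ltnS.
  by have [] := phiP k.
- by move=> i; have [] := usP (phi i).
- apply: cvg_uniform_dist => e e0; apply: filterS (small e e0) => k ke x.
  by apply: le_trans ke; have [_] := phiP k; exact.
Qed.

(** The solution [u0] already at hand enters through [sol_comparison], whose rate forces Lbar / tau
    to converge to - h along any such sequence. *)
Lemma cvg_discrete_sols_continuous (Lbar : R -> R) h u0 (tau : nat -> R) us u :
  sol_continuous L h u0 -> cvg_discrete_sols L Lbar tau us u -> sol_continuous L h u.
Proof.
move=> su0 [tau0 tauoo sus unif].
have [U UU leU] := ultrafilter_infty; have PU := @ultra_proper _ U UU.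
have tauU : tau @ U --> (0 : R) by move=> A /tauoo h1; exact: leU.
have [C C0 CP] := sol_comparison h.
apply: (limit_sol_continuous UU tau0 tauU sus).
  by move=> x A /(cvg_uniform_pointwise (x := x) unif) h1; exact: leU.
have Ctau : C * tau i @[i --> U] --> C * 0 by apply: cvgM; [exact: cvg_cst|exact: tauU].
rewrite mulr0 in Ctau.
apply: (cvg_dominated_diff _ _ Ctau (cvg_cst (- h))) => i; rewrite opprK.
exact: (CP _ _ u0 (us i)).
Qed.

Lemma Lip_le (C : R) u : 0 <= C -> (forall x y, `|u x - u y| <= C * `|x - y|) ->
  (Lip u <= C%:E)%E.
Proof.
move=> C0 uC; apply: ereal_inf_lbound; exists C => //; split=> //.
by move=> [x y] _ /=; exact: uC.
Qed.

Lemma norm_infty_le (C : R) u : 0 <= C -> periodic u ->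
  (forall x y, `|u x - u y| <= C * `|x - y|) -> is_min (range u) 0 ->
  (norm_infty u <= C%:E)%E.
Proof.
move=> C0 pu uC [[m _ um] _]; apply: ge_ereal_sup => _ [x _ <-].
by rewrite lee_fin -[u x]subr0 -um; exact: lip_periodic_osc.
Qed.

End Solutions.

Theorem theorem9 (R : realType) (d : nat) (H : 'rV[R]_d -> 'rV[R]_d -> R) :
  tonelli H ->
  let L := lagrangian H in
  exists (Lbar : R -> R) (Hbar : R),
  (* (i) *)
  (forall tau : R, 0 < tau ->
     unique (fun c : R => exists u, sol_discrete L tau c u) (Lbar tau) /\
     (fun k : nat => inf (range (mean_discrete_action L tau k))) @ \oo
       --> Lbar tau) /\
  (* (ii) *)
  (unique (fun h : R => exists u, sol_continuous L h u) Hbar /\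
   exists2 m : R -> R,
     (forall tau : R, 0 < tau ->
        is_min (range (fun xy : ('rV[R]_d * 'rV[R]_d)%type =>
                  minimal_action L tau xy.1 xy.2)) (m tau)) &
     tau^-1 * m tau @[tau --> +oo] --> - Hbar) /\
  (* (iii) *)
  (exists2 C : R, 0 < C &
     forall tau : R, 0 < tau <= 1 -> `|Lbar tau / tau + Hbar| <= C * tau) /\
  (* (iv) *)
  (exists C r : R, [/\ 0 < C, 0 < r &
     forall tau : R, 0 < tau <= 1 ->
     forall (v : 'rV[R]_d -> R) (E : 'rV[R]_d -> 'rV[R]_d -> R),
       (sol_discrete L tau (Lbar tau) v /\ E = discrete_action L tau) \/
       (sol_continuous L Hbar v /\ E = minimal_action L tau) ->
       [/\ (Lip v <= C%:E)%E,
           is_min (range v) 0 -> (norm_infty v <= C%:E)%E &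
           forall y x : 'rV[R]_d, argmin (fun z => v z + E z y) x ->
             `|y - x| <= tau * r]]) /\
  (* (v) *)
  ((exists (tau : nat -> R) (us : nat -> 'rV[R]_d -> R) (u : 'rV[R]_d -> R),
      cvg_discrete_sols L Lbar tau us u) /\
   (forall (tau : nat -> R) (us : nat -> 'rV[R]_d -> R) (u : 'rV[R]_d -> R),
      cvg_discrete_sols L Lbar tau us u -> sol_continuous L Hbar u)).
Proof.
move=> tH L.
(* [Lbar] is a total function; for tau <= 0 its value is a dummy. *)
have cP tau : exists c, 0 < tau -> exists u, sol_discrete L tau c u.
  have [tau0|_] := boolP (0 < tau); last by exists 0.
  by have [c cu] := sol_discrete_exists tH tau0; exists c.
have [Lbar LbarP] := choice cP.
have [tau1 [us1 [u0 [Hbar [cvg1 su0]]]]] := cvg_discrete_sols_exists tH LbarP.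
exists Lbar, Hbar; split.
  move=> tau tau0; have [u su] := LbarP tau tau0; split; last exact: inf_mean_discrete_action su.
  split; first by exists u.
  by move=> c' [u' su']; exact: (sol_discrete_unique su su').
split.
  split.
    split; first by exists u0.
    move=> h' [u' su']; apply/eqP; rewrite eq_le.
    by rewrite (sol_continuous_le su0 su') (sol_continuous_le su' su0).
  have mP tau : exists m, 0 < tau -> is_min (range (fun xy : ('rV[R]_d * 'rV[R]_d)%type =>
      minimal_action L tau xy.1 xy.2)) m.
    have [tau0|_] := boolP (0 < tau); last by exists 0.
    by have [m mP] := min_action_exists tH tau0; exists m.
  have [m mE] := choice mP; exists m => //; exact: (cvg_min_action su0 mE).
have [C1 C10 C1P] := sol_discrete_lip tH; have [C2 C20 C2P] := sol_continuous_lip tH Hbar.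
split.
  have [C C0 CP] := sol_comparison tH Hbar.
  exists (C + 1) => [|tau /andP[tau0 _]]; first by rewrite ltr_wpDl.
  have [u su] := LbarP tau tau0; have := CP _ _ _ _ tau0 su su0.
  by move=> /le_trans; apply; rewrite ler_wpM2r ?lerDl// ltW.
split; last first.
  split; first by exists tau1, us1, u0.
  by move=> tau us u; exact: cvg_discrete_sols_continuous su0.
pose C := C1 + C2 + 1.
have C1C : C1 <= C by rewrite /C -addrA lerDl addr_ge0.
have C2C : C2 <= C by rewrite /C addrAC [leRHS]addrC lerDl addr_ge0.
have C0 : 0 < C by rewrite ltr_wpDl// addr_ge0.
exists C, C; split=> // tau /andP[tau0 _] v E.
(* Both equations have this form, with c = Lbar tau or c = - tau Hbar. *)
suff lipE c : periodic v -> (forall y, is_min (range (fun x => v x + E x y)) (v y + c)) ->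
    (forall x y, `|v x - v y| <= C * `|x - y|) ->
    (forall x y, v y + c = v x + E x y -> `|y - x| <= C * tau) ->
    [/\ (Lip v <= C%:E)%E, is_min (range v) 0 -> (norm_infty v <= C%:E)%E &
       forall y x, argmin (fun z => v z + E z y) x -> `|y - x| <= tau * C].
  case=> [[sv EE]|[sv EE]]; rewrite EE in lipE *.
    have [lip speed] := C1P _ _ _ tau0 sv; have [_ pv mv] := sv.
    apply: (lipE (Lbar tau)) => // [x y|x y xy].
      by rewrite (le_trans (lip x y))// ler_wpM2r.
    by rewrite (le_trans (speed x y xy))// ler_wpM2r// ltW.
  have [lip speed] := C2P _ sv; have [_ pv mv] := sv.
  apply: (lipE (- (tau * Hbar))) => // [y|x y|x y xy]; first exact: mv.
    by rewrite (le_trans (lip x y))// ler_wpM2r.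
  by rewrite (le_trans (speed _ x y tau0 xy))// ler_wpM2r// ltW.
move=> pv mv lip speed; split; first exact: Lip_le (ltW C0) lip.
  exact: norm_infty_le (ltW C0) pv lip.
move=> y x xmin; rewrite mulrC; apply: speed; have [[z _ zE] lb] := mv y.
by apply/eqP; rewrite eq_le lb; [rewrite -zE xmin|exists x].
Qed.
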